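(* Let $\ell\in F_\epsilon'$ be symmetric. Assume the discrete inf-sup condition $$\inf_{w\in S(\widehat E^k_\pi)}\ \sup_{v\in S(\widehat F^k_\epsilon)}\mathcal{B}^k(w,v)\ge C_k^{-1}.$$ Then the exact solution $U\in E_\pi$ to $$B(U,v)-\rho^2\Delta(U,v)=\ell(v)\quad\forall v\in F_\epsilon$$ and the postprocessed discrete solution $\bar U^k\in Q_kE^k_\pi$ to $$\bar{\mathcal{B}}^k(\bar U^k,v)=\ell(v)\quad\forall v\in F^k_\epsilon$$ differ by $$\|U-\bar U^k\|_\pi\le(1+C_k\|\mathcal{B}^k\|)\inf_{w\in Q_kE^k_\pi}\|U-w\|_\pi$$ for the $\text{CN}^\star_2$ scheme, and by $$\|U-\bar U^k\|_\pi\le(1+C_k\|\mathcal{B}^k\|)\inf_{w\in Q_kE^k_\pi}\|U-w\|_\pi+\tfrac14C_k\,\|(\mathcal{B}-\bar{\mathcal{B}}^k)U\|_{(F^k_\epsilon)'}$$ for any of the $\text{iE}^\star_2$ schemes ($\text{iE}^\star_2$, $\text{iE}^\star_2/Q$, and $\text{iE}^\star_2$ with the box rule).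
   Context: Let $T>0$, $J=(0,T)$, $\lambda>0$, $\rho\ge0$. $E = L_2(J)$ with $\|w\|_E^2 := \lambda \|w\|_{L_2(J)}^2$; $F = \{v\in H^1(J): v(T)=0\}$ with $\|v\|_F^2 := \lambda^{-1}\|v'\|_{L_2(J)}^2 + \lambda\|v\|_{L_2(J)}^2 + |v(0)|^2$. $b(w,v) := \int_J w(-v'+\lambda v)\,dt$ on $E\times F$. $E_\pi=E\otimes_\pi E$ is the projective and $F_\epsilon=F\otimes_\epsilon F$ the injective tensor product, with norms $\|\cdot\|_\pi$, $\|\cdot\|_\epsilon$. $B$ is the unique continuous bilinear form on $E_\pi\times F_\epsilon$ with $B(w_1\otimes w_2,v_1\otimes v_2)=b(w_1,v_1)b(w_2,v_2)$; $\Delta$ is the unique continuous bilinear form on $E_\pi\times F_\epsilon$ with $\Delta(w,v)=\int_Jw(t,t)v(t,t)dt$ on algebraic tensors; $\mathcal{B}:=B-\rho^2\Delta$. A functional $\ell$ is symmetric if $\ell(\psi\otimes\tilde\psi)=\ell(\tilde\psi\otimes\psi)$ for all $\psi,\tilde\psi\in F$. Bilinear forms on $E_\pi\times F_\epsilon$ are identified with operators $E_\pi\to F_\epsilon'$; $\|\mathcal{B}^k\|$ is the operator norm. $S(\cdot)$ denotes unit spheres. Uniform mesh $0=t_0<\dots<t_N=T$, $J_n=(t_{n-1},t_n)$, $k_n=t_n-t_{n-1}$. $F^k\subset F$: continuous functions affine on each $J_n$, vanishing at $T$, with hat basis $\{v_i\}_{0\le i\le N-1}$, $v_i(t_j)=\delta_{ij}$.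 $E^k=\operatorname{span}\{e_n\}_{1\le n\le N}$, with $e_n$ supported on $\overline{J_n}$ and on $J_n$ a positive multiple of either the constant $1$ ($\text{CN}^\star$) or $t\mapsto4-6(t-t_{n-1})/k_n$ ($\text{iE}^\star$), normalized to $\|e_n\|_E=1$. $E^k_\pi=E^k\otimes E^k\subset E_\pi$, $F^k_\epsilon=F^k\otimes F^k\subset F_\epsilon$; $\widehat E^k_\pi$, $\widehat F^k_\epsilon$ are their subspaces of symmetric functions; $\|f\|_{(F^k_\epsilon)'}=\sup_{v\in S(F^k_\epsilon)}|f(v)|$. $q_k:E\to\partial_tF^k$ is the orthogonal projection onto $\partial_tF^k$ (piecewise constants on the mesh), $Q_k:=q_k\otimes q_k$ (extended to $E_\pi$); $q_k$ is injective on $E^k$, and $Q_k^{-1}$ denotes the inverse of $Q_k:E^k_\pi\to Q_kE^k_\pi$ (note $Q_kE_\pi=Q_kE^k_\pi$). Schemes: $\text{CN}^\star_2$: $\text{CN}^\star$ with $\Delta^k:=\Delta$. $\text{iE}^\star_2$: $\text{iE}^\star$ with $\Delta^k:=\Delta$. $\text{iE}^\star_2/Q$: $\text{iE}^\star$ with $\Delta^k:=\Delta\circ Q_k$, i.e. $\Delta^k(w,v)=\Delta(Q_kw,v)$. $\text{iE}^\star_2$ with box rule: $\text{iE}^\star$ with $\Delta^k(w,v):=\sum_{n=1}^Nk_n^{-1}\int_{J_n\times J_n}w(s,t)v(s,t)\,ds\,dt$. Set $\mathcal{B}^k:=B-\rho^2\Delta^k$ and $\bar{\mathcal{B}}^k:=\mathcal{B}^k\circ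 Q_k^{-1}Q_k:E_\pi\to F_\epsilon'$. (If $U^k\in E^k_\pi$ solves $\mathcal{B}^k(U^k,v)=\ell(v)$ for all $v\in F^k_\epsilon$, the postprocessed solution is $\bar U^k=Q_kU^k$.) The constant $C_k$: let $\gamma_k:=\inf_{w\in S(E^k)}\sup_{v\in S(F^k)}b(w,v)>0$, $b_{in}:=b(e_n,v_i)$, $\Delta^n_{11}:=\Delta^k(e_n\otimes e_n,v_{n-1}\otimes v_{n-1})$, $\Delta^n_{12}:=\Delta^k(e_n\otimes e_n,v_{n-1}\otimes v_n)$, $\Delta^n_{22}:=\Delta^k(e_n\otimes e_n,v_n\otimes v_n)$, $\beta:=(1-\rho^2b_{n-1,n}^{-2}\Delta^n_{11})^{-1}>0$, $\theta:=b_{n-1,n}^{-1}b_{n-1,n-1}$, $\alpha:=\beta[\theta^2+\rho^2b_{n-1,n}^{-2}(\Delta^{n-1}_{22}-2b_{n-2,n-1}^{-1}b_{n-1,n-1}\Delta^{n-1}_{12})]$ (independent of $n$ on the uniform mesh). Then $C_k:=\gamma_k^{-2}\beta(1+(\alpha-\theta^2)\tfrac{\alpha^{N-1}-1}{\alpha-1})$, with $C_k=\gamma_k^{-2}\beta(\theta^2+N(1-\theta^2))$ if $\alpha=1$. *)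

(* Defs.v *)
From HB Require Import structures.
From mathcomp Require Import all_boot all_order all_algebra.
From mathcomp Require Import all_classical all_reals all_analysis.

Set Implicit Arguments.
Unset Strict Implicit.
Unset Printing Implicit Defensive.
Import Order.TTheory GRing.Theory Num.Theory.
Import numFieldNormedType.Exports.

Local Open Scope classical_set_scope.
Local Open Scope ring_scope.

(* A space of functions on the interval J is given by a set [X] of
   representatives R -> R together with a seminorm [nX]; the normed space that
   is meant is the quotient of X by the functions of seminorm 0 (values outside
   the closure of J, and on null sets for L2, are thereby ignored). *)

Section TensorProducts.
Context {R : realType}.
Implicit Types (X : set (R -> R)) (nX : (R -> R) -> R).

Definition linear_on X (phi : (R -> R) -> R) : Prop :=
  forall (a : R) (x y : R -> R), X x -> X y ->
    phi (fun t => a * x t + y t) = a * phi x + phi y.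

Definition bilinear_on (V : lmodType R) X (tens : (R -> R) -> (R -> R) -> V)
    : Prop :=
  forall (a : R) (x y z : R -> R), X x -> X y -> X z ->
    tens (fun t => a * x t + y t) z = a *: tens x z + tens y z /\
    tens z (fun t => a * x t + y t) = a *: tens z x + tens z y.

(* Bilinear forms on the quotient of X by the functions of seminorm 0. *)
Definition bilinear_form X nX (phi : (R -> R) -> (R -> R) -> R^o) : Prop :=
  bilinear_on X phi /\
  forall x z : R -> R, X x -> X z -> nX x = 0 -> phi x z = 0 /\ phi z x = 0.

(* The formal sums sum_i x_i (x) y_i and sum_j x'_j (x) y'_j are the same
   element of the algebraic tensor product. *)
Definition same_tensor X nX (n : nat) (x y : 'I_n -> R -> R)
    (m : nat) (x' y' : 'I_m -> R -> R) : Prop :=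
  forall phi, bilinear_form X nX phi ->
    \sum_(i < n) phi (x i) (y i) = \sum_(j < m) phi (x' j) (y' j).

Definition projective_norm X nX (n : nat) (x y : 'I_n -> R -> R) : R :=
  inf [set r | exists (m : nat) (x' y' : 'I_m -> R -> R),
    [/\ forall j, X (x' j) /\ X (y' j), same_tensor X nX x y x' y' &
        r = \sum_(j < m) nX (x' j) * nX (y' j)]].

(* The closed unit ball of the dual space. *)
Definition dual_ball X nX : set ((R -> R) -> R) :=
  [set phi | linear_on X phi /\ forall x, X x -> `|phi x| <= nX x].

Definition injective_norm X nX (n : nat) (x y : 'I_n -> R -> R) : R :=
  sup [set r | exists phi psi,
    [/\ dual_ball X nX phi, dual_ball X nX psi &
        r = `| \sum_(i < n) phi (x i) * psi (y i) |]].

(* A (x) A inside a realization of the tensor product. *)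
Definition tensor_span (V : lmodType R) (tens : (R -> R) -> (R -> R) -> V)
    (A : set (R -> R)) : set V :=
  [set u | exists (n : nat) (x y : 'I_n -> R -> R),
     (forall i, A (x i) /\ A (y i)) /\ u = \sum_(i < n) tens (x i) (y i)].

(* The symmetric elements of A (x) A: those fixed by the transposition
   x (x) y |-> y (x) x, i.e. w(s,t) = w(t,s). *)
Definition sym_tensor_span (V : lmodType R)
    (tens : (R -> R) -> (R -> R) -> V) (A : set (R -> R)) : set V :=
  [set u | exists (n : nat) (x y : 'I_n -> R -> R),
     [/\ forall i, A (x i) /\ A (y i), u = \sum_(i < n) tens (x i) (y i) &
         u = \sum_(i < n) tens (y i) (x i)]].

(* The Banach space V, with (x, y) |-> tens x y, is the completion of the
   algebraic tensor product of X with itself for the given tensor norm. *)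
Definition tensor_completion X
    (tnorm : forall n : nat, ('I_n -> R -> R) -> ('I_n -> R -> R) -> R)
    (V : completeNormedModType R) (tens : (R -> R) -> (R -> R) -> V) : Prop :=
  [/\ bilinear_on X tens,
      forall (n : nat) (x y : 'I_n -> R -> R),
        (forall i, X (x i) /\ X (y i)) ->
        `| \sum_(i < n) tens (x i) (y i) | = tnorm n x y &
      closure (tensor_span tens X) = setT].

Definition projective_tensor X nX (V : completeNormedModType R)
    (tens : (R -> R) -> (R -> R) -> V) : Prop :=
  tensor_completion X (projective_norm X nX) tens.

Definition injective_tensor X nX (V : completeNormedModType R)
    (tens : (R -> R) -> (R -> R) -> V) : Prop :=
  tensor_completion X (injective_norm X nX) tens.

End TensorProducts.

Section Norms.
Context {R : realType}.

Definition unit_sphere_in (V : normedModType R) (A : set V) : set V :=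
  [set u | A u /\ `|u| = 1].

(* Norm of a bounded bilinear form on V x W, viewed as an operator V -> W'. *)
Definition operator_norm (V W : normedModType R) (beta : V -> W -> R) : R :=
  sup [set r | exists w v, [/\ `|w| = 1, `|v| = 1 & r = `|beta w v|]].

Definition dual_norm (V : normedModType R) (A : set V) (f : V -> R) : R :=
  sup [set `|f v| | v in unit_sphere_in A].

Definition inf_sup (V W : normedModType R) (A : set V) (A' : set W)
    (beta : V -> W -> R) : R :=
  inf [set sup [set beta w v | v in unit_sphere_in A']
      | w in unit_sphere_in A].

Definition best_approximation (V : normedModType R) (A : set V) (u : V) : R :=
  inf [set `|u - w| | w in A].

End Norms.

Section Spaces.
Context {R : realType}.
Variables (T lam : R).
Notation mu := (@lebesgue_measure R).

Definition J : set R := `]0, T[.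

Definition L2 (w : R -> R) : Prop := (w \_ J) \in Lfun mu 2%:E.

Definition L2normsq (w : R -> R) : R := \int[mu]_(t in J) (w t ^+ 2).

Definition E : set (R -> R) := [set w | L2 w].

Definition normE (w : R -> R) : R := Num.sqrt (lam * L2normsq w).

(* C^1 functions with compact support in the open interval J. *)
Definition test_function (phi : R -> R) : Prop :=
  [/\ forall t, derivable phi t 1, continuous (derive1 phi) &
      exists a b, [/\ 0 < a, b < T & forall t, t \notin `[a, b] -> phi t = 0]].

Definition weak_derivative (v g : R -> R) : Prop :=
  L2 g /\ forall phi, test_function phi ->
    \int[mu]_(t in J) (v t * derive1 phi t) = - \int[mu]_(t in J) (g t * phi t).

(* A choice of the weak derivative, which is unique almost everywhere on J. *)
Definition wderiv (v : R -> R) : R -> R :=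
  xget (fun=> 0) [set g | weak_derivative v g].

(* Functions in H^1(J) are given by their continuous representative on the
   closure of J. *)
Definition H1 (v : R -> R) : Prop :=
  [/\ {within `[0, T], continuous v}, L2 v & exists g, weak_derivative v g].

Definition F : set (R -> R) := [set v | H1 v /\ v T = 0].

Definition normF (v : R -> R) : R :=
  Num.sqrt (lam^-1 * L2normsq (wderiv v) + lam * L2normsq v + v 0 ^+ 2).

Definition b (w v : R -> R) : R :=
  \int[mu]_(t in J) (w t * (- wderiv v t + lam * v t)).

End Spaces.

Inductive scheme := CN2 | iE2 | iE2Q | iE2box.

Section Discretization.
Context {R : realType}.
Variables (T lam : R) (N : nat) (s : scheme).
Notation mu := (@lebesgue_measure R).

Definition node (n : nat) : R := n%:R * (T / N%:R).
Definition step (n : nat) : R := node n - node n.-1.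
Definition Jn (n : nat) : set R := `]node n.-1, node n[.

Definition hat (i : nat) (t : R) : R :=
  Num.max 0 (1 - `|t - node i| / (T / N%:R)).

Definition Fk : set (R -> R) :=
  [set v | [/\ {within `[0, T], continuous v},
               forall n, (1 <= n <= N)%N ->
                 exists c d : R, forall t, Jn n t -> v t = c + d * t &
               v T = 0]].

(* The normalization to unit E-norm is done in [e]; CN2 is the CN* scheme, all
   other schemes share the iE* trial space. *)
Definition profile (n : nat) (t : R) : R :=
  if s is CN2 then 1 else 4 - 6 * (t - node n.-1) / step n.

Definition e (n : nat) (t : R) : R :=
  (normE T lam (profile n \_ (Jn n)))^-1 * (profile n \_ (Jn n)) t.

Definition Ek : set (R -> R) :=
  [set w | exists c : nat -> R, w = fun t => \sum_(1 <= n < N.+1) c n * e n t].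

Definition dFk : set (R -> R) :=
  [set g | exists2 v, Fk v & weak_derivative T v g].

Definition orthogonal_projection (q : (R -> R) -> R -> R) : Prop :=
  forall w, E T w -> dFk (q w) /\
    forall z, dFk z -> \int[mu]_(t in J T) ((w t - q w t) * z t) = 0.

Definition gammak : R :=
  inf [set sup [set b T lam w v | v in [set v | Fk v /\ normF T lam v = 1]]
      | w in [set w | Ek w /\ normE T lam w = 1]].

Definition bmat (i n : nat) : R := b T lam (e n) (hat i).

(* [trace_form] and [box_form] are the values on elementary tensors
   w1 (x) w2, v1 (x) v2. *)
Definition trace_form (w1 w2 v1 v2 : R -> R) : R :=
  \int[mu]_(t in J T) (w1 t * w2 t * (v1 t * v2 t)).

Definition box_form (w1 w2 v1 v2 : R -> R) : R :=
  \sum_(1 <= n < N.+1) (step n)^-1 *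
    \int[(mu \x mu)%E]_(z in Jn n `*` Jn n)
       (w1 z.1 * w2 z.2 * (v1 z.1 * v2 z.2)).

End Discretization.

Section Schemes.
Context {R : realType}.
Variables (T lam rho : R) (N : nat) (s : scheme).
Variables (Epi Feps : completeNormedModType R).
Variables (tE : (R -> R) -> (R -> R) -> Epi).
Variables (tF : (R -> R) -> (R -> R) -> Feps).
Notation e := (e T lam N s).
Notation hat := (hat T N).
Notation bm := (bmat T lam N s).

(* A continuous bilinear form on Epi x Feps with prescribed values on
   elementary tensors (such a form is unique, by density). *)
Definition extends_form
    (phi : (R -> R) -> (R -> R) -> (R -> R) -> (R -> R) -> R)
    (Phi : {bilinear Epi -> Feps -> R^o}) : Prop :=
  continuous (fun p : Epi * Feps => Phi p.1 p.2) /\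
  forall w1 w2 v1 v2, E T w1 -> E T w2 -> F T v1 -> F T v2 ->
    Phi (tE w1 w2) (tF v1 v2) = phi w1 w2 v1 v2.

Definition extends_map (q : (R -> R) -> R -> R) (Q : {linear Epi -> Epi})
    : Prop :=
  continuous Q /\
  forall w1 w2, E T w1 -> E T w2 -> Q (tE w1 w2) = tE (q w1) (q w2).

Definition Ekpi : set Epi := tensor_span tE (Ek T lam N s).
Definition Ekpi_sym : set Epi := sym_tensor_span tE (Ek T lam N s).
Definition Fkeps : set Feps := tensor_span tF (Fk T N).
Definition Fkeps_sym : set Feps := sym_tensor_span tF (Fk T N).

Definition Deltak (Delta box : Epi -> Feps -> R) (Q : Epi -> Epi)
    : Epi -> Feps -> R :=
  match s with
  | CN2 | iE2 => Delta
  | iE2Q => fun w v => Delta (Q w) v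
  | iE2box => box
  end.

Definition calB (B D : Epi -> Feps -> R) (w : Epi) (v : Feps) : R :=
  B w v - rho ^+ 2 * D w v.

(* The inverse of Q restricted to Ekpi, on Q @` Ekpi. *)
Definition Qinv (Q : Epi -> Epi) (z : Epi) : Epi :=
  xget 0 [set w | Ekpi w /\ Q w = z].

Definition calBbar (Bk : Epi -> Feps -> R) (Q : Epi -> Epi)
    (w : Epi) (v : Feps) : R :=
  Bk (Qinv Q (Q w)) v.

Section StabilityConstant.
Variable Dk : Epi -> Feps -> R.

Definition Delta11 (n : nat) : R :=
  Dk (tE (e n) (e n)) (tF (hat n.-1) (hat n.-1)).
Definition Delta12 (n : nat) : R :=
  Dk (tE (e n) (e n)) (tF (hat n.-1) (hat n)).
Definition Delta22 (n : nat) : R :=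
  Dk (tE (e n) (e n)) (tF (hat n) (hat n)).

Definition betan (n : nat) : R :=
  (1 - rho ^+ 2 * (bm n.-1 n) ^- 2 * Delta11 n)^-1.
Definition thetan (n : nat) : R := (bm n.-1 n)^-1 * bm n.-1 n.-1.
Definition alphan (n : nat) : R :=
  betan n * (thetan n ^+ 2 + rho ^+ 2 * (bm n.-1 n) ^- 2 *
    (Delta22 n.-1 - 2 * (bm n.-2 n.-1)^-1 * bm n.-1 n.-1 * Delta12 n.-1)).

(* On the uniform mesh the quantities above do not depend on n, where betan n
   is meaningful for 1 <= n <= N and thetan n, alphan n for 2 <= n <= N; they
   are read off at n = N. For N = 1 the values of theta and alpha are
   irrelevant, as they cancel out of Ck. *)
Definition beta : R := betan N.
Definition theta : R := thetan N.
Definition alpha : R := alphan N.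

Definition Ck : R :=
  let g := gammak T lam N s in
  if alpha == 1 then
    g ^- 2 * beta * (theta ^+ 2 + N%:R * (1 - theta ^+ 2))
  else
    g ^- 2 * beta *
      (1 + (alpha - theta ^+ 2) * ((alpha ^+ N.-1 - 1) / (alpha - 1))).

End StabilityConstant.

End Schemes.

(* Main.v *)
(* Cea's argument on symmetric tensors. The map Q^-1 Q extends to a bounded
   projection W of E_pi onto E^k_pi of norm at most kappa^-2, while Q has norm
   kappa^2 on E^k_pi, where kappa = 1 for CN and 1/2 for iE: these are the
   factor 1/4 of the consistency term and the factor 4 that it absorbs in front
   of the best approximation error. For symmetric w in E^k_pi the inf-sup
   condition bounds |w - W Ubar| by C_k times the norm of the functional
   BBk (W (Q w - U)) - (BB - BBbar) U, and U - Ubar = (U - Q w) + Q (w - W Ubar).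

   The solutions are symmetric because B and Delta^k are compatible with the
   transposition and functions dual to the trial space separate E^k_pi. For U
   this gives |U - w'| <= |U - w| with w' the transpose of w, so the infimum may
   be taken over symmetric w: up to an arbitrarily small error U is its image
   under the tensor square of an orthogonal projection onto a finite dimensional
   space, which is a symmetric tensor.

   Finally C_k > 0: gamma_k > 0 by duality, and with v = v_n - theta v_(n-1),
   alpha - theta^2 = beta rho^2 b^-2 Delta^k(e (x) e, v (x) v) >= 0. *)

Require Import Defs.
From HB Require Import structures.
From mathcomp Require Import all_boot all_order all_algebra.
From mathcomp Require Import all_classical all_reals all_analysis.
From mathcomp Require Import measurable_realfun ring lra.

Set Implicit Arguments.
Unset Strict Implicit.
Unset Printing Implicit Defensive.
Import Order.TTheory GRing.Theory Num.Theory.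
Import numFieldNormedType.Exports.

Local Open Scope classical_set_scope.
Local Open Scope ring_scope.

(** * Square integrable functions and weak derivatives *)

(** Only finite sums are concrete here: the norm of [Epi] is an infimum over representations, and a
    general element is a mere limit. Bounded operators on [Epi] are therefore built with [B] itself
    as the source of continuous functionals. Since [v |-> - v' + lam v] maps [F] onto L2, each
    coefficient [<w, f>] in [E] equals [b w psi] for some [psi] in [F], and
    [B u (tF (psi i) (psi j))] is the corresponding coefficient of an arbitrary [u]. The tensor
    square of a finite rank map of [E] arises in this way, and Bessel's inequality, applied inside
    every representation, makes it a contraction. Both [Q] on the trial tensors and [W] are
    multiples of such maps.

    The transposition is handled on finite sums only. For a limit such as [U], symmetry is expressed
    on the test side, by exchanging the factors of [tF v1 v2].

    Functions are representatives, weak derivatives are chosen values and [q] is determined only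
    almost everywhere, so many identities between functions hold up to null functions; elementary
    tensors do not see the difference. *)

Section SquareIntegrable.
Context {R : realType}.
Variables (T lam : R).
Implicit Types (w x y z : R -> R).
Notation mu := (@lebesgue_measure R).

Lemma measurable_J : @measurable _ (measurableTypeR R) (J T).
Proof. exact: measurable_itv. Qed.
Hint Resolve measurable_J : core.

Lemma J_finite : (mu (J T) < +oo)%E.
Proof. by rewrite lebesgue_measure_itv/=; case: ifPn => // _; rewrite ltry. Qed.

Lemma L2P w : L2 T w <-> measurable_fun (J T) w /\
  mu.-integrable (J T) (EFin \o (fun t => w t ^+ 2)).
Proof.
have sqE : (EFin \o (fun t => (w \_ (J T)) t ^+ 2)) =
    (EFin \o (fun t => w t ^+ 2)) \_ (J T) :> (R -> \bar R).
  by apply/funext => t; rewrite /= !patchE; case: ifP => // _; rewrite expr0n.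
split=> [wL|[mw iw]].
  split.
    apply/measurable_restrictT => //.
    by move: wL => /andP[/set_mem].
  have := Lfun2_integrable_sqr wL.
  by rewrite sqE => /integrable_restrict; rewrite setTI; apply.
apply/andP; split.
  have mr : measurable_fun setT (w \_ (J T)).
    by apply/(measurable_restrictT w measurable_J).
  exact/mem_set.
apply/mem_set; rewrite /= /finite_norm unlock.
apply: poweR_lty.
have : mu.-integrable setT (EFin \o (fun t => (w \_ (J T)) t ^+ 2)).
  by rewrite sqE; apply/integrable_restrict => //; rewrite setTI.
move=> /integrableP[_]; apply: le_lt_trans; rewrite le_eqVlt; apply/orP; left.
apply/eqP; apply: eq_integral => t _ /=.
by rewrite powR_mulrn// real_normK ?num_real// ger0_norm ?sqr_ge0.
Qed.

Lemma L2_measurable w : L2 T w -> measurable_fun (J T) w.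
Proof. by move/L2P => []. Qed.

Lemma L2_le w v : measurable_fun (J T) w -> L2 T v ->
  (forall t, J T t -> `|w t| <= `|v t|) -> L2 T w.
Proof.
move=> mw /L2P[_ iv] wv; apply/L2P; split => //.
apply: le_integrable iv => //.
  by apply/measurable_EFinP; exact: measurable_funX.
move=> t Jt /=; rewrite lee_fin !normrX lerXn2r ?nnegrE//; exact: wv.
Qed.

Lemma L2_mul x y : L2 T x -> L2 T y ->
  mu.-integrable (J T) (EFin \o (fun t => x t * y t)).
Proof.
move=> /L2P[mx ix] /L2P[my iy].
have ixy : mu.-integrable (J T) (EFin \o (fun t => x t ^+ 2 + y t ^+ 2)).
  by have := integrableD measurable_J ix iy.
apply: le_integrable ixy => //.
  by apply/measurable_EFinP; exact: measurable_funM.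
move=> t _ /=; rewrite lee_fin normrM [leRHS]ger0_norm ?addr_ge0 ?sqr_ge0//.
have := sqr_ge0 (`|x t| - `|y t|).
rewrite -(real_normK (num_real (x t))) -(real_normK (num_real (y t))).
have := normr_ge0 (x t); have := normr_ge0 (y t); nra.
Qed.

Lemma L2_lin (a : R) x y : L2 T x -> L2 T y -> L2 T (fun t => a * x t + y t).
Proof.
move=> Lx Ly; apply/L2P; split.
  apply: measurable_funD; last exact: L2_measurable.
  by apply: measurable_funM => //; exact: L2_measurable.
have -> : (EFin \o (fun t => (a * x t + y t) ^+ 2)) =
   (fun t => (a ^+ 2)%:E * (x t * x t)%:E + (2 * a)%:E * (x t * y t)%:E +
     (y t * y t)%:E)%E.
  by apply/funext => t /=; rewrite -!EFinM -!EFinD; congr EFin; ring.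
do ![apply: integrableD => //]; last exact: L2_mul.
  by apply: integrableZl => //; exact: L2_mul.
by apply: integrableZl => //; exact: L2_mul.
Qed.

Lemma L2_bounded w (M : R) : measurable_fun (J T) w ->
  (forall t, J T t -> `|w t| <= M) -> L2 T w.
Proof.
move=> mw wM; apply/L2P; split => //.
apply: measurable_bounded_integrable => //.
- exact: J_finite.
- exact: measurable_funX.
- exists (M ^+ 2); split; first exact: num_real.
  move=> x Mx t Jt /=; apply: le_trans (ltW Mx); rewrite normrX.
  by rewrite lerXn2r ?nnegrE// ?wM// (le_trans _ (wM _ Jt)).
Qed.

Lemma L2_cst (c : R) : L2 T (fun=> c).
Proof. by apply: (@L2_bounded _ `|c|). Qed.

Lemma L2_integrable w : L2 T w -> mu.-integrable (J T) (EFin \o w).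
Proof.
move=> Lw; have := L2_mul Lw (L2_cst 1).
by congr integrable; apply/funext => t /=; rewrite mulr1.
Qed.

Lemma L2_scale (a : R) x : L2 T x -> L2 T (fun t => a * x t).
Proof.
move=> Lx; have := L2_lin a Lx (L2_cst 0).
by congr L2; apply/funext => t; rewrite addr0.
Qed.

(** Families are indexed by [nat] rather than by ordinals, so that an induction on the length keeps
    the same family; only the entries below [m] count. *)
Definition lc (m : nat) (a : nat -> R) (g : nat -> R -> R) : R -> R :=
  fun t => \sum_(i < m) a i * g i t.

Lemma lc0 a g : lc 0 a g = fun=> 0.
Proof. by apply/funext => t; rewrite /lc big_ord0. Qed.

Lemma lcS m a g : lc m.+1 a g = fun t => a m * g m t + lc m a g t.
Proof. by apply/funext => t; rewrite /lc big_ord_recr/= addrC. Qed.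

Lemma L2_lc (m : nat) (a : nat -> R) (g : nat -> R -> R) :
  (forall i, (i < m)%N -> L2 T (g i)) -> L2 T (lc m a g).
Proof.
elim: m => [|m IH] Lg; first by rewrite lc0; exact: L2_cst.
by rewrite lcS; apply: L2_lin; [exact: Lg|apply: IH => i im; exact/Lg/ltnW].
Qed.

(** The inner product of [E]. With weight 1 in place of [lam] it also serves as the plain L2 pairing
    in computations with [b]. *)
Definition ip x y : R := lam * \int[mu]_(t in J T) (x t * y t).

Lemma ipC x y : ip x y = ip y x.
Proof. by congr (_ * _); apply: eq_Rintegral => t _; rewrite mulrC. Qed.

Lemma ip_linl (a : R) x y z : L2 T x -> L2 T y -> L2 T z ->
  ip (fun t => a * x t + y t) z = a * ip x z + ip y z.
Proof.
move=> Lx Ly Lz; rewrite /ip mulrCA -mulrDr; congr (_ * _).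
rewrite -RintegralZl//; last exact: L2_mul.
rewrite -RintegralD//; last 2 first.
- by have := L2_mul (L2_scale a Lx) Lz; congr integrable; apply/funext => t /=;
    rewrite mulrA.
- exact: L2_mul.
by apply: eq_Rintegral => t _; rewrite mulrDl mulrA.
Qed.

Lemma ip_linr (a : R) x y z : L2 T x -> L2 T y -> L2 T z ->
  ip z (fun t => a * x t + y t) = a * ip z x + ip z y.
Proof. by move=> Lx Ly Lz; rewrite ipC ip_linl// !(ipC z). Qed.

Lemma ip0l z : ip (fun=> 0) z = 0.
Proof.
rewrite /ip (_ : Rintegral _ _ _ = 0) ?mulr0//.
rewrite -[RHS](_ : \int[mu]_(t in J T) 0 = 0); last by rewrite Rintegral_cst// mul0r.
by apply: eq_Rintegral => t _; rewrite mul0r.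
Qed.

Lemma ip_lc (m : nat) (a : nat -> R) (g : nat -> R -> R) z :
  (forall i, (i < m)%N -> L2 T (g i)) -> L2 T z ->
  ip (lc m a g) z = \sum_(i < m) a i * ip (g i) z.
Proof.
elim: m => [|m IH] Lg Lz; first by rewrite big_ord0 lc0 ip0l.
have Lg' i : (i < m)%N -> L2 T (g i) by move=> im; exact/Lg/ltnW.
rewrite big_ord_recr/= -IH// lcS ip_linl//; [|exact: Lg|exact: L2_lc].
by rewrite addrC.
Qed.

Lemma sum_delta (m k : nat) (a : nat -> R) : (k < m)%N ->
  \sum_(i < m) a i * (i == k :> nat)%:R = a k.
Proof.
move=> km; rewrite (bigD1 (Ordinal km))//= eqxx mulr1 big1 ?addr0// => i ik.
by rewrite (_ : (i == k :> nat) = false) ?mulr0//; exact/negbTE.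
Qed.

Lemma ip_scaler (c : R) x y : L2 T x -> L2 T y ->
  ip x (fun t => c * y t) = c * ip x y.
Proof.
move=> Lx Ly; have := ip_linr c Ly (L2_cst 0) Lx.
rewrite (ipC _ (fun=> 0)) ip0l addr0 => <-.
by congr ip; apply/funext => t; rewrite addr0.
Qed.

Hypothesis lam_gt0 : 0 < lam.

Lemma ip_ge0 x : 0 <= ip x x.
Proof.
by rewrite mulr_ge0 ?(ltW lam_gt0)//; apply: Rintegral_ge0 => t _; rewrite -expr2 sqr_ge0.
Qed.

Lemma normE_ip x : normE T lam x = Num.sqrt (ip x x).
Proof. by []. Qed.

Lemma normE_sq x : normE T lam x ^+ 2 = ip x x.
Proof. by rewrite normE_ip sqr_sqrtr// ip_ge0. Qed.

Lemma normE_ge0 x : 0 <= normE T lam x.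
Proof. exact: sqrtr_ge0. Qed.

Lemma normE_eq0 x : (normE T lam x == 0) = (ip x x == 0).
Proof. by rewrite -normE_sq sqrf_eq0. Qed.

(* The coefficients of [x] in an orthonormal system give a residual of square
   norm |x|^2 - sum of their squares. *)
Lemma ip_residual (m : nat) (f : nat -> R -> R) x :
  (forall i, (i < m)%N -> L2 T (f i)) -> L2 T x ->
  (forall i j, (i < m)%N -> (j < m)%N -> ip (f i) (f j) = (i == j)%:R) ->
  let p := lc m (fun i => ip x (f i)) f in
  (forall i, (i < m)%N -> ip p (f i) = ip x (f i)) /\
  ip p p = \sum_(i < m) ip x (f i) ^+ 2 /\
  ip (fun t => -1 * p t + x t) (fun t => -1 * p t + x t) =
    ip x x - \sum_(i < m) ip x (f i) ^+ 2.
Proof.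
move=> Lf Lx of_ p.
have Lp : L2 T p by exact: L2_lc.
have pf i : (i < m)%N -> ip p (f i) = ip x (f i).
  move=> im; rewrite /p ip_lc//; last exact: Lf.
  rewrite -[RHS](sum_delta (fun i => ip x (f i)) im).
  by apply: eq_bigr => j _; rewrite of_.
have pz z : L2 T z -> ip p z = \sum_(i < m) ip x (f i) * ip (f i) z.
  by move=> Lz; rewrite /p ip_lc.
have pp : ip p p = \sum_(i < m) ip x (f i) ^+ 2.
  by rewrite pz//; apply: eq_bigr => i _; rewrite (ipC _ p) pf// expr2.
split => //; split => //.
have px : ip p x = \sum_(i < m) ip x (f i) ^+ 2.
  by rewrite pz//; apply: eq_bigr => i _; rewrite (ipC _ x) expr2.
rewrite ip_linl//; last exact: L2_lin.
by rewrite !ip_linr// (ipC x p) px pp; ring.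
Qed.

(** The residual with respect to [f] has nonnegative square norm. The coefficients are then attached
    to a second orthonormal system [g], which keeps their square sum: [x |-> sum_i <x, f i> g i] is
    a partial isometry. *)
Lemma bessel (m : nat) (f g : nat -> R -> R) x :
  (forall i, (i < m)%N -> L2 T (f i)) -> (forall i, (i < m)%N -> L2 T (g i)) ->
  L2 T x ->
  (forall i j, (i < m)%N -> (j < m)%N -> ip (f i) (f j) = (i == j)%:R) ->
  (forall i j, (i < m)%N -> (j < m)%N -> ip (g i) (g j) = (i == j)%:R) ->
  normE T lam (lc m (fun i => ip x (f i)) g) <= normE T lam x.
Proof.
move=> Lf Lg Lx of_ og; rewrite !normE_ip ler_wsqrtr//.
have [_ [_ res]] := ip_residual Lf Lx of_.
have := ip_ge0 (fun t => -1 * lc m (fun i => ip x (f i)) f t + x t).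
rewrite res subr_ge0; apply: le_trans.
rewrite ip_lc//; last exact: L2_lc.
apply: ler_sum => i _; rewrite (ipC (g i)) ip_lc//; last exact: Lg.
rewrite (_ : \sum_(j < m) _ = ip x (f i)) ?expr2//.
rewrite -(sum_delta (fun i => ip x (f i)) (ltn_ord i)).
by apply: eq_bigr => j _; rewrite og.
Qed.

(** If [<x, x> = 0] but [<x, y>] is nonzero, the square norm of [c x + y] is affine in [c], and the
    chosen [c] makes it -1. *)
Lemma ip_null x y : L2 T x -> L2 T y -> normE T lam x = 0 -> ip x y = 0.
Proof.
move=> Lx Ly x0; have d0 : ip x x = 0 by rewrite -normE_sq x0 expr0n.
apply/eqP/negPn/negP => xy0.
have := ip_ge0 (fun t => (- (ip y y + 1) / (2 * ip x y)) * x t + y t).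
rewrite ip_linl//; last exact: L2_lin.
rewrite !ip_linr// d0 (ipC y x).
rewrite (_ : _ + _ = -1); first by rewrite oppr_ge0 ler10.
by field.
Qed.

(** Induction on the family: the residual of the next entry is normalized and appended, or dropped
    when it is null. Hence [m] may be smaller than [n], and each entry agrees with its projection
    only up to a null function. *)
Lemma gram_schmidt (n : nat) (xs : nat -> R -> R) :
  (forall i, (i < n)%N -> L2 T (xs i)) ->
  exists (m : nat) (f : nat -> R -> R),
  [/\ forall i, (i < m)%N -> L2 T (f i),
      forall i j, (i < m)%N -> (j < m)%N -> ip (f i) (f j) = (i == j)%:R &
      forall k, (k < n)%N -> normE T lam
        (fun t => -1 * lc m (fun i => ip (xs k) (f i)) f t + xs k t) = 0].
Proof.
elim: n => [|n IH] Lxs; first by exists 0%N, (fun=> fun=> 0).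
have [|m [f [Lf of_ fx]]] := IH; first by move=> i im; exact: Lxs (ltnW im).
pose x := xs n; pose p := lc m (fun i => ip x (f i)) f.
pose r := fun t => -1 * p t + x t.
have Lx : L2 T x by exact: Lxs.
have Lp : L2 T p by exact: L2_lc.
have Lr : L2 T r by exact: L2_lin.
have [r0|r0] := eqVneq (normE T lam r) 0.
  exists m, f; split => // k; rewrite ltnS leq_eqVlt => /predU1P[->//|]; exact: fx.
have [pf _] := ip_residual Lf Lx of_.
have rf i : (i < m)%N -> ip r (f i) = 0.
  move=> im; rewrite ip_linl//; last exact: Lf.
  by rewrite -/p pf// mulN1r addNr.
pose c := (normE T lam r)^-1.
have scale0 z : L2 T z -> ip (fun t => c * r t) z = c * ip r z.
  move=> Lz; have := ip_linl c Lr (L2_cst 0) Lz.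
  by rewrite ip0l addr0 => <-; congr ip; apply/funext => t; rewrite addr0.
pose g i := if i == m then (fun t => c * r t) else f i.
have gm : g m = (fun t => c * r t) by rewrite /g eqxx.
have gf i : (i < m)%N -> g i = f i by move=> im; rewrite /g ltn_eqF.
have Lg i : (i < m.+1)%N -> L2 T (g i).
  rewrite ltnS leq_eqVlt => /predU1P[->|im]; first by rewrite gm; exact: L2_scale.
  by rewrite gf//; exact: Lf.
have gmf i : (i < m)%N -> ip (g m) (f i) = 0.
  by move=> im; rewrite gm scale0 ?rf ?mulr0//; exact: Lf.
have rlc a : ip r (lc m a f) = 0.
  by rewrite ipC ip_lc// big1// => i _; rewrite ipC rf// mulr0.
have rx : ip r r = ip r x by rewrite {2}/r ip_linr// rlc mulr0 add0r.
exists m.+1, g; split => //.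
- move=> i j; rewrite ltnS leq_eqVlt => /predU1P[->|im];
    rewrite ltnS leq_eqVlt => /predU1P[->|jm].
  + rewrite eqxx mulr1n gm scale0; last exact: L2_scale.
    by rewrite ipC scale0// -normE_sq /c; field.
  + by rewrite gtn_eqF// (gf j)// gmf.
  + by rewrite ltn_eqF// (gf i)// ipC gmf.
  + by rewrite !gf// of_.
move=> k; rewrite ltnS => kn.
have Lk : L2 T (xs k) by apply: Lxs; rewrite ltnS.
have sumE : lc m.+1 (fun i => ip (xs k) (g i)) g =
    fun t => c * ip r (xs k) * (c * r t) + lc m (fun i => ip (xs k) (f i)) f t.
  rewrite lcS; apply/funext => t; rewrite gm (ipC (xs k)) scale0//.
  by congr (_ + _); apply: eq_bigr => i _; rewrite gf.
rewrite sumE.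
move: kn; rewrite leq_eqVlt => /predU1P[->|kn].
  rewrite -/x -rx -normE_sq -/p.
  rewrite (_ : (fun t => _) = fun=> 0); first by apply/eqP; rewrite normE_eq0 ip0l.
  apply/funext => t; have -> : x t = r t + p t by rewrite /r; ring.
  by rewrite /c; field.
rewrite (_ : ip r (xs k) = 0).
  by apply: etrans (fx _ kn); congr normE; apply/funext => t; rewrite mulr0 mul0r add0r.
(* An earlier [xs k] differs from its projection by a null function, and [r] is orthogonal to that
   projection, hence to [xs k]. *)
pose pk := lc m (fun i => ip (xs k) (f i)) f.
have Lpk : L2 T pk by exact: L2_lc.
have -> : ip r (xs k) = ip r (fun t => -1 * pk t + xs k t).
  by rewrite ip_linr// rlc mulr0 add0r.
by rewrite ipC ip_null//; [exact: L2_lin|exact: fx].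
Qed.

End SquareIntegrable.
#[global] Hint Resolve measurable_J : core.

(** * Fubini's theorem on squares and triangles *)

Section Fubini.
Context {R : realType}.
Implicit Types (f g h : R -> R).
Notation mu := (@lebesgue_measure R).

Lemma integrable_patch (A : set R) f : @measurable _ (measurableTypeR R) A ->
  mu.-integrable A (EFin \o f) -> mu.-integrable setT (EFin \o (f \_ A)).
Proof.
by move=> mA fi; rewrite -restrict_EFin; apply/integrable_restrict => //;
  rewrite setTI.
Qed.

Lemma integrable_prod f g : mu.-integrable setT (EFin \o f) ->
  mu.-integrable setT (EFin \o g) ->
  (mu \x mu)%E.-integrable setT (EFin \o (fun z : R * R => f z.1 * g z.2)).
Proof.
move=> fi gi.
have mf : measurable_fun setT f by move/(measurable_int mu)/measurable_EFinP: fi.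
have mg : measurable_fun setT g by move/(measurable_int mu)/measurable_EFinP: gi.
have mfg : measurable_fun setT (EFin \o (fun z : R * R => f z.1 * g z.2)).
  apply/measurable_EFinP; apply: measurable_funM.
    exact: (measurableT_comp mf measurable_fst).
  exact: (measurableT_comp mg measurable_snd).
apply/(integrable12ltyP mu mu mfg).
rewrite /=; have -> : (\int[mu]_x \int[mu]_y `|(f x * g y)%R%:E|)%E
    = (\int[mu]_x (`|(f x)%:E| * \int[mu]_y `|(g y)%:E|))%E.
  apply: eq_integral => x _.
  rewrite -ge0_integralZl//.
    by apply: eq_integral => y _; rewrite /= normrM EFinM.
  by apply/measurable_EFinP; exact: measurableT_comp.
have gy : (\int[mu]_y `|(g y)%:E| < +oo)%E by case/integrableP: gi.
have fy : (\int[mu]_y `|(f y)%:E| < +oo)%E by case/integrableP: fi.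
have g0 : (0 <= \int[mu]_y `|(g y)%:E|)%E by exact: integral_ge0.
have f0 : (0 <= \int[mu]_y `|(f y)%:E|)%E by exact: integral_ge0.
rewrite ge0_integralZr//; last first.
  by apply/measurable_EFinP; exact: measurableT_comp.
by rewrite lte_mul_pinfty// ge0_fin_numE.
Qed.

Lemma Rintegral_prod (A : set R) f g : @measurable _ (measurableTypeR R) A ->
  mu.-integrable A (EFin \o f) -> mu.-integrable A (EFin \o g) ->
  \int[(mu \x mu)%E]_(z in A `*` A) (f z.1 * g z.2) =
  \int[mu]_(x in A) f x * \int[mu]_(x in A) g x.
Proof.
move=> mA fi gi.
have Fi := integrable_patch mA fi; have Gi := integrable_patch mA gi.
rewrite Rintegral_mkcond [in RHS]Rintegral_mkcond [X in _ * X]Rintegral_mkcond.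
have -> : (fun z : R * R => f z.1 * g z.2) \_ (A `*` A) =
    fun z => (f \_ A) z.1 * (g \_ A) z.2.
  apply/funext => -[x y]; rewrite !patchE/= in_setX/=.
  by case: (x \in A); case: (y \in A) => /=; rewrite ?mul0r ?mulr0.
rewrite /Rintegral -fineM ?integrable_fin_num//.
rewrite -(@integral12_prod_meas1 _ _ _ _ _ mu mu _ (integrable_prod Fi Gi)).
have Gn : (\int[mu]_y ((g \_ A) y)%:E)%E \is a fin_num by exact: integrable_fin_num.
rewrite -[X in (_ * X)%E](fineK Gn) -integralZr//; congr fine.
by apply: eq_integral => x _; rewrite fineK// /fubini_F/= -integralZl.
Qed.

(** Both sides integrate [g t * h s] over the triangle [0 < t < s < T]. This plays the part of
    integration by parts for the tail integral of a merely integrable [h]. *)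
Lemma Rintegral_triangle (T : R) g h :
  mu.-integrable (J T) (EFin \o g) -> mu.-integrable (J T) (EFin \o h) ->
  \int[mu]_(t in J T) (g t * \int[mu]_(s in `]t, T[) h s) =
  \int[mu]_(s in J T) (h s * \int[mu]_(t in `]0, s[) g t).
Proof.
move=> gi hi.
have Gi := integrable_patch (@measurable_J R T) gi.
have Hi := integrable_patch (@measurable_J R T) hi.
set G := g \_ (J T) in Gi; set H := h \_ (J T) in Hi.
pose D := [set z : R * R | z.1 < z.2].
have mD : measurable D.
  rewrite (_ : D = [set z | (z.1 < z.2) = true])//.
  have := @measurable_fun_ltr _ (R * R)%type R setT fst snd measurable_fst measurable_snd.
  by move=> /(_ measurableT [set true]); rewrite setTI; apply.
pose K (z : R * R) := \1_D z * (G z.1 * H z.2).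
have Ki : (mu \x mu)%E.-integrable setT (EFin \o K).
  apply: le_integrable (integrable_prod Gi Hi) => //.
    apply/measurable_EFinP; apply: measurable_funM.
      exact: measurable_indic.
    by have /measurable_EFinP := measurable_int _ (integrable_prod Gi Hi).
  move=> z _ /=; rewrite lee_fin normrM ler_piMl//.
  by rewrite indicE; case: (_ \in _); rewrite ?normr0 ?normr1.
transitivity (fine (\int[mu]_x \int[mu]_y (EFin \o K) (x, y))%E).
  rewrite Rintegral_mkcond /Rintegral; congr fine; apply: eq_integral => t _.
  rewrite patchE; case: ifPn => [/set_mem Jt|nJt]; last first.
    rewrite integral0_eq// => s _; rewrite /K/= /G patchE (negbTE nJt).
    by rewrite mul0r mulr0.
  have Jt' : 0 < t < T by move: Jt; rewrite /J/= in_itv.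
  have -> : (\int[mu]_y (EFin \o K) (t, y) = \int[mu]_y ((g t)%:E * ((h \_ `]t, T[) y)%:E))%E.
    apply: eq_integral => s _; rewrite -EFinM /K/= /G /H /D !patchE indicE.
    rewrite (mem_set Jt) mulrCA; congr (_ * _)%:E.
    have -> : (s \in [set` `]t, T[]) = (t < s) && (s < T).
      by rewrite mem_setE in_itv.
    have -> : ((t, s) \in [set z : R * R | z.1 < z.2]) = (t < s).
      by apply/idP/idP; rewrite inE.
    have [ts|ts] /= := ltP t s; last by rewrite mul0r.
    rewrite mul1r (_ : (s \in J T) = (s < T))//.
    by rewrite /J mem_setE in_itv/= (lt_trans _ ts)//; case/andP: Jt'.
  have hti : mu.-integrable setT (EFin \o (h \_ `]t, T[)).
    apply: integrable_patch => //; apply: integrableS hi => //.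
    by apply: subset_itvr; rewrite bnd_simp; case/andP: Jt' => /ltW.
  have := Rintegral_mkcond mu `]t, T[ h; rewrite /Rintegral => ->.
  by rewrite EFinM fineK ?integralZl//; exact: integrable_fin_num.
rewrite (@Fubini _ _ _ _ _ mu mu _ Ki) Rintegral_mkcond /Rintegral; congr fine; apply: eq_integral => s _.
rewrite patchE; case: ifPn => [/set_mem Js|nJs]; last first.
  rewrite integral0_eq// => t _; rewrite /K/= /H patchE (negbTE nJs).
  by rewrite !mulr0.
have Js' : 0 < s < T by move: Js; rewrite /J/= in_itv.
have -> : (\int[mu]_x (EFin \o K) (x, s) = \int[mu]_x ((h s)%:E * ((g \_ `]0%R, s[) x)%:E))%E.
  apply: eq_integral => t _; rewrite -EFinM /K/= /G /H /D !patchE indicE.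
  rewrite (mem_set Js) mulrA mulrC; congr (_ * _)%:E.
  have -> : (t \in [set` `]0, s[]) = (0 < t) && (t < s).
    by rewrite mem_setE in_itv.
  have -> : ((t, s) \in [set z : R * R | z.1 < z.2]) = (t < s).
    by apply/idP/idP; rewrite inE.
  have [ts|ts] /= := ltP t s; last by rewrite mul0r andbF.
  rewrite mul1r andbT (_ : (t \in J T) = (0 < t))//.
  by rewrite /J mem_setE in_itv/= (lt_trans ts) ?andbT//; case/andP: Js'.
have gti : mu.-integrable setT (EFin \o (g \_ `]0, s[)).
  apply: integrable_patch => //; apply: integrableS gi => //.
  by apply: subset_itvl; rewrite bnd_simp; case/andP: Js' => _ /ltW.
have := Rintegral_mkcond mu `]0, s[ g; rewrite /Rintegral => ->.
by rewrite EFinM fineK ?integralZl//; exact: integrable_fin_num.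
Qed.

End Fubini.

(** * Test functions approximating the indicator of an interval *)

Section Bump.
Context {R : realType}.

Lemma continuous_pospart : continuous (fun x : R => Num.max 0 x).
Proof.
move=> x.
by apply: (@continuous_max R R (fun=> 0) id) => //; exact: cst_continuous.
Qed.

Lemma is_derive_pospart_sq (x : R) :
  is_derive x 1 (fun t : R => Num.max 0 t ^+ 2) (2 * Num.max 0 x).
Proof.
have [x0|x0|->] := ltgtP x 0.
- apply: (@near_eq_is_derive _ _ _ (cst 0)).
    near=> t; rewrite /cst (_ : Num.max 0 t = 0) ?expr0n//.
    by apply: max_idPl; apply: ltW; near: t; exact: lt_nbhsl.
  rewrite mulr0; exact: is_derive_cst.
- apply: (@near_eq_is_derive R R R (fun t : R => t ^+ 2)).
    near=> t; rewrite (_ : Num.max 0 t = t)//.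
    by apply: max_idPr; apply: ltW; near: t; exact: lt_nbhsr.
  have := @is_deriveX _ _ id 2 x 1 1 (is_derive_id x 1).
  by move=> /is_derive_eq; apply; rewrite /= expr1 /GRing.scale/= mulr1.
(* At the origin the difference quotient of [max(0, z)^2] is [max(0, z)], which is continuous and
   vanishes there. *)
- rewrite mulr0; apply/is_derive1_caratheodory; exists (fun z => Num.max 0 z); split.
  + move=> z; rewrite maxxx expr0n/= !subr0 expr2.
    by have [z0|z0] := leP 0 z; rewrite ?mul0r.
  + exact: continuous_pospart.
  + by rewrite maxxx.
Unshelve. all: by end_near. Qed.

(* A [C^1] function with support [[c, d]] which increases to the indicator of
   the open interval as [eps] tends to 0. *)
Definition bump (c d eps t : R) : R :=
  let u := Num.max 0 ((t - c) * (d - t)) ^+ 2 in u / (u + eps).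

(** The quotient rule gives [eps * u' / (u + eps)^2] for [u / (u + eps)], where [u = p^2] and
    [u' = 2 p (c + d - 2 t)]. *)
Definition dbump (c d eps t : R) : R :=
  let p := Num.max 0 ((t - c) * (d - t)) in
  eps * (p ^+ 2 + eps) ^- 2 * (2 * p * (c + d - 2 * t)).

Lemma is_derive_bump (c d eps t : R) : 0 < eps ->
  is_derive t 1 (bump c d eps) (dbump c d eps t).
Proof.
move=> e0.
pose q (s : R) := (s - c) * (d - s).
have dq : is_derive t 1 q (c + d - 2 * t).
  have h1 : is_derive t 1 (fun s : R => s - c) 1.
    have := is_deriveB (is_derive_id t 1) (is_derive_cst c t 1).
    by move=> /is_derive_eq; apply; rewrite subr0.
  have h2 : is_derive t 1 (fun s : R => d - s) (-1).
    have := is_deriveB (is_derive_cst d t 1) (is_derive_id t 1).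
    by move=> /is_derive_eq; apply; rewrite sub0r.
  have := is_deriveM h1 h2.
  by move=> /is_derive_eq; apply; rewrite /GRing.scale/=; ring.
pose u (s : R) := Num.max 0 (q s) ^+ 2.
have du : is_derive t 1 u (2 * Num.max 0 (q t) * (c + d - 2 * t)).
  exact: (is_derive1_comp (is_derive_pospart_sq (q t)) dq).
have den0 s : u s + eps != 0.
  by rewrite gt_eqF// ltr_wpDl// sqr_ge0.
have dden : is_derive t 1 (fun s => u s + eps) (2 * Num.max 0 (q t) * (c + d - 2 * t)).
  have := is_deriveD du (is_derive_cst eps t 1).
  by move=> /is_derive_eq; apply; rewrite addr0.
have dinv := @is_deriveV R (fun s => u s + eps) _ _ _ (den0 t) dden.
have := is_deriveM du dinv.
move=> /is_derive_eq; apply; rewrite /GRing.scale/= /dbump -/(q t) -/(u t).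
have := den0 t; set a := 2 * Num.max 0 (q t) * (c + d - 2 * t).
move=> ut; field; exact: ut.
Qed.

Lemma continuous_dbump (c d eps : R) : 0 < eps -> continuous (dbump c d eps).
Proof.
move=> e0 t.
have cq : {for t, continuous (fun s : R => (s - c) * (d - s))}.
  by apply: continuousM; apply: continuousB; (exact: cst_continuous || exact: cvg_id).
have cp : {for t, continuous (fun s : R => Num.max 0 ((s - c) * (d - s)))}.
  exact: (continuous_comp cq (@continuous_pospart _)).
pose p (s : R) := Num.max 0 ((s - c) * (d - s)).
have cw : {for t, continuous (fun s => p s ^+ 2 + eps)}.
  by apply: continuousD; [exact: (continuousM cp cp)|exact: cst_continuous].
have ci : {for t, continuous (fun s => (p s ^+ 2 + eps) ^- 2)}.
  apply: (@continuousV _ _ (fun s => (p s ^+ 2 + eps) ^+ 2)).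
    by rewrite expf_neq0// gt_eqF// ltr_wpDl// sqr_ge0.
  exact: (continuousM cw cw).
have cl : {for t, continuous (fun s : R => c + d - 2 * s)}.
  apply: continuousB; first exact: cst_continuous.
  by apply: continuousM; [exact: cst_continuous|exact: cvg_id].
have c1 : {for t, continuous (fun s => eps * (p s ^+ 2 + eps) ^- 2)}.
  by apply: (continuousM _ ci); exact: cst_continuous.
have c2 : {for t, continuous (fun s => 2 * p s)}.
  by apply: (continuousM _ cp); exact: cst_continuous.
exact: (continuousM c1 (continuousM c2 cl)).
Qed.

Lemma bump_out (c d eps t : R) : c < d -> t \notin `[c, d] -> bump c d eps t = 0.
Proof.
move=> cd; rewrite in_itv/= => h.
rewrite /bump (_ : Num.max 0 _ = 0) ?expr0n/= ?mul0r//.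
apply/max_idPl; move: h; rewrite negb_and -!ltNge => /orP[tc|dt].
  by rewrite nmulr_rle0 ?subr_lt0// subr_ge0 ltW// (lt_trans tc).
by rewrite pmulr_rle0 ?subr_gt0 ?(lt_trans cd)// subr_le0 ltW.
Qed.

Lemma test_function_bump (T c d eps : R) : 0 < eps -> 0 < c -> c < d -> d < T ->
  test_function T (bump c d eps).
Proof.
move=> e0 c0 cd dT; split.
- by move=> t; exact: (ex_derive (is_derive := is_derive_bump c d t e0)).
- rewrite (_ : derive1 _ = dbump c d eps); first exact: continuous_dbump.
  apply/funext => t; rewrite derive1E.
  exact: (derive_val (is_derive := is_derive_bump c d t e0)).
- by exists c, d; split => // t; exact: bump_out.
Qed.

Lemma bump_bound (c d eps t : R) : 0 < eps -> `|bump c d eps t| <= 1.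
Proof.
move=> e0; rewrite /bump; set u := _ ^+ 2.
have u0 : 0 <= u by exact: sqr_ge0.
have ue : 0 < u + eps by rewrite ltr_wpDl.
rewrite ger0_norm ?divr_ge0 ?(ltW ue)//.
by rewrite ler_pdivrMr// mul1r lerDl ltW.
Qed.

Lemma bump_cvg (c d t : R) : c < d ->
  bump c d (n.+1%:R^-1) t @[n --> \oo] --> (\1_(`]c, d[%classic) t : R).
Proof.
move=> cd; rewrite indicE mem_setE in_itv/=.
have [/andP[ct td]|/negP tcd] := boolP (c < t < d); last first.
  rewrite (_ : (fun _ => _) = fun=> 0); first exact: cvg_cst.
  apply/funext => n; rewrite /bump (_ : Num.max 0 _ = 0) ?expr0n/= ?mul0r//.
  apply/max_idPl; have [tc|ct] := leP t c.
    rewrite mulr_le0_ge0 ?subr_le0 ?subr_ge0//; apply: le_trans tc _; exact: ltW.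
  have [dt|td] := leP d t; last by case: tcd; rewrite ct td.
  by rewrite mulr_ge0_le0 ?subr_le0 ?subr_ge0// ltW.
rewrite /bump; set u := _ ^+ 2.
have u0 : 0 < u.
  by rewrite exprn_gt0// lt_max mulr_gt0 ?orbT// subr_gt0.
rewrite [X in _ --> X](_ : _ = u / (u + 0)); last first.
  by rewrite addr0 divff// gt_eqF.
apply: cvgM; first exact: cvg_cst.
apply: cvgV; first by rewrite addr0 gt_eqF.
by apply: cvgD; [exact: cvg_cst|exact: cvg_harmonic].
Qed.

End Bump.

(** * Weak derivatives: tail integrals and uniqueness *)

Section WeakDerivative.
Context {R : realType}.
Variable T : R.
Hypothesis T_gt0 : 0 < T.
Implicit Types (v g h w : R -> R).
Notation mu := (@lebesgue_measure R).

Lemma L2_within_continuous v : {within `[0, T], continuous v} -> L2 T v.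
Proof.
move=> cv; have JT : J T `<=` `[0, T]%classic by exact: subset_itv_oo_cc.
have /compact_bounded[M [_ /(_ (M + 1))]] :=
  continuous_compact cv (@segment_compact _ _ _).
rewrite ltrDl => /(_ ltr01) vM.
apply: (@L2_bounded _ _ _ (M + 1)) => [|t Jt]; last first.
  by apply: vM; exists t => //; exact: JT.
apply: measurable_funS JT _ => //.
apply: subspace_continuous_measurable_fun => //.
Qed.

Lemma Rintegral_FTC (a b : R) (F f : R -> R) : a < b ->
  (forall t : R, is_derive t 1 F (f t)) -> continuous f ->
  \int[mu]_(t in `]a, b[) f t = F b - F a.
Proof.
move=> ab dF cf.
have fi : mu.-integrable `[a, b] (EFin \o f).
  apply: continuous_compact_integrable; first exact: segment_compact.
  exact: continuous_subspaceT.
have cF : continuous F.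
  move=> t; apply: differentiable_continuous; apply/derivable1_diffP.
  exact: (ex_derive (is_derive := dF t)).
rewrite Rintegral_itv_bndo_bndc; last first.
  by apply: integrableS fi => //; exact: subset_itv_oo_cc.
rewrite Rintegral_itv_obnd_cbnd; last first.
  by apply: integrableS fi => //; exact: subset_itv_oc_cc.
rewrite /Rintegral (@continuous_FTC2 _ f F a b)//.
- exact: continuous_subspaceT.
- split.
  + by move=> x _; exact: (ex_derive (is_derive := dF x)).
  + by apply: cvg_at_right_filter; exact: cF.
  + by apply: cvg_at_left_filter; exact: cF.
- by move=> x _; rewrite derive1E; exact: (derive_val (is_derive := dF x)).
Qed.

(** The primitive is anchored at [T], where the functions of [F] vanish; hence the minus sign in its
    weak derivative. *)
Definition tail_integral h (t : R) : R := \int[mu]_(s in `]t, T[) h s.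

Lemma tail_integralT h : tail_integral h T = 0.
Proof. by rewrite /tail_integral set_itv_ge ?Rintegral_set0// bnd_simp ltxx. Qed.

Lemma continuous_tail_integral h : mu.-integrable (J T) (EFin \o h) ->
  {within `[0, T], continuous (tail_integral h)}.
Proof.
move=> hi; pose h0 := h \_ (J T).
have h0i : mu.-integrable setT (EFin \o h0) by exact: integrable_patch.
have h0S (A : set R) : @measurable _ (measurableTypeR R) A ->
    mu.-integrable A (EFin \o h0) by move=> mA; exact: integrableS h0i.
pose P t := \int[mu]_(s in `[0, T]) h0 s - parameterized_integral mu 0 t h0.
apply: (@subspace_eq_continuous _ _ _ P).
  move=> t; rewrite inE/= in_itv/= => /andP[t0 tT].
  rewrite /P /parameterized_integral Rintegral_itvB ?bnd_simp//; last exact: h0S.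
  rewrite -Rintegral_itv_bndo_bndc; last exact: h0S.
  apply: eq_Rintegral => s; rewrite mem_setE in_itv/= => /andP[ts sT].
  by rewrite /h0 patchE mem_set// /J/= in_itv/= sT (le_lt_trans t0).
move=> t; apply: cvgB; first exact: cvg_cst.
have := @parameterized_integral_continuous R 0 T h0 (ltW T_gt0) (h0S _ (measurable_itv _)).
exact.
Qed.

Lemma test_function_L2 phi : test_function T phi -> L2 T phi /\ L2 T (derive1 phi).
Proof.
move=> [dphi cphi _]; split; apply: L2_within_continuous;
  apply: continuous_subspaceT => // t.
by apply: differentiable_continuous; exact/derivable1_diffP.
Qed.

Lemma test_function0 phi : test_function T phi -> phi 0 = 0.
Proof.
by move=> [_ _ [a [b [a0 bT]]]]; apply; rewrite in_itv/= leNgt a0.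
Qed.

(** Exchanging the order of integration turns the pairing of the tail integral with [phi'] into the
    pairing of [h] with [phi s - phi 0 = phi s]. *)
Lemma weak_derivative_tail h v : L2 T h ->
  (forall t, 0 <= t <= T -> v t = tail_integral h t) ->
  F T v /\ weak_derivative T v (fun t => - h t).
Proof.
move=> Lh vE; have hi := L2_integrable Lh.
have cv : {within `[0, T], continuous v}.
  apply: subspace_eq_continuous (continuous_tail_integral hi).
  by move=> t; rewrite inE/= in_itv/= => /vE.
have Lv := L2_within_continuous cv.
suff wd : weak_derivative T v (fun t => - h t).
  split => //; split; last by rewrite vE ?tail_integralT// lexx ltW.
  by split => //; exists (fun t => - h t).
split.
  by have := L2_scale (-1) Lh; congr L2; apply/funext => t; rewrite mulN1r.
move=> phi tphi; have [Lphi Ldphi] := test_function_L2 tphi.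
transitivity (\int[mu]_(t in J T) (derive1 phi t * \int[mu]_(s in `]t, T[) h s)).
  apply: eq_Rintegral => t; rewrite inE /J/= in_itv/= => /andP[t0 tT].
  by rewrite vE ?(ltW t0) ?(ltW tT)// mulrC.
rewrite Rintegral_triangle//; last exact: L2_integrable.
have cphi : continuous (derive1 phi) by case: tphi.
have dphi (s : R) : is_derive s 1 phi (derive1 phi s).
  by case: tphi => dphi _ _; apply: DeriveDef; [exact: dphi|rewrite derive1E].
transitivity (\int[mu]_(t in J T) (h t * phi t)).
  apply: eq_Rintegral => t; rewrite inE /J/= in_itv/= => /andP[t0 tT].
  by rewrite (Rintegral_FTC t0 dphi cphi) (test_function0 tphi) subr0.
rewrite -mulN1r -RintegralZl//; last first.
  have := L2_mul (L2_scale (-1) Lh) Lphi.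
  by congr integrable; apply/funext => t /=; rewrite mulN1r.
by apply: eq_Rintegral => t _; rewrite mulN1r mulNr opprK.
Qed.

(** Dominated convergence along bumps tending to the indicator of the interval, with majorant
    [|g|]. *)
Lemma Rintegral_bump (g : R -> R) (c d : R) : L2 T g ->
  (forall phi, test_function T phi -> \int[mu]_(t in J T) (g t * phi t) = 0) ->
  0 < c -> c < d -> d < T -> \int[mu]_(t in `]c, d[) g t = 0.
Proof.
move=> Lg g0 c0 cd dT.
have gi := L2_integrable Lg; have mg := L2_measurable Lg.
pose phi n := bump c d (n.+1%:R^-1 : R).
have tphi n : test_function T (phi n) by exact: test_function_bump.
have := @dominated_cvg _ _ _ mu (J T) (@measurable_J R T)
  (fun n t => (g t * phi n t)%:E) (fun t => (g t * \1_(`]c, d[%classic) t)%:E)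
  (fun t => `|g t|%:E).
move=> /(_ _ _ _ _ _) H.
have {}H : (\int[mu]_(x in J T) (g x * phi n x)%:E)%E @[n --> \oo] -->
    (\int[mu]_(t in J T) (g t * \1_(`]c, d[%classic) t)%:E)%E.
  apply: H => //.
  - move=> n; apply/measurable_EFinP; apply: measurable_funM => //.
    by have [Lp _] := test_function_L2 (tphi n); exact: (L2_measurable Lp).
  - move=> t _; apply: cvg_EFin; first exact: nearW.
    by apply: cvgM; [exact: cvg_cst|exact: bump_cvg].
  - exact: (integrable_norm gi).
  - move=> n t _; rewrite lee_fin normrM ler_piMr//; exact: bump_bound.
have z n : (\int[mu]_(x in J T) (g x * phi n x)%:E = 0)%E.
  have [Lp _] := test_function_L2 (tphi n).
  rewrite -[LHS]fineK; last by apply: integrable_fin_num => //; exact: (L2_mul Lg Lp).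
  by congr EFin; exact: g0 (tphi n).
move: H; rewrite (funext z) => H.
have E0 := cvg_unique (@ereal_hausdorff R) H (cvg_cst 0%E).
transitivity (\int[mu]_(t in J T) (g t * \1_(`]c, d[%classic) t)); last first.
  by rewrite /Rintegral E0.
rewrite [RHS]Rintegral_mkcond [LHS]Rintegral_mkcond.
apply: eq_Rintegral => t _; rewrite !patchE indicE.
case: ifPn => [/set_mem|]; last by rewrite mulr0 if_same.
rewrite /= in_itv/= => /andP[ct td]; rewrite mulr1 ifT//.
by rewrite inE /J/= in_itv/= (lt_trans c0)//= (lt_trans td).
Qed.

(** The difference [d] of two weak derivatives has integral 0 over every interval with endpoints
    inside [J], so its indefinite integral is constant on [J]. By Lebesgue differentiation [d] is
    almost everywhere the derivative of that integral, hence 0. *)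
Lemma weak_derivative_unique v g g' : weak_derivative T v g ->
  weak_derivative T v g' -> ae_eq mu (J T) g g'.
Proof.
move=> [Lg wg] [Lg' wg'].
pose d t := -1 * g' t + g t.
have Ld : L2 T d by exact: L2_lin.
have d0 phi : test_function T phi -> \int[mu]_(t in J T) (d t * phi t) = 0.
  move=> tphi; have [Lphi _] := test_function_L2 tphi.
  have := @ip_linl _ T 1 (-1) g' g phi Lg' Lg Lphi.
  rewrite /ip !mul1r => ->; rewrite mulN1r -wg'// wg//; first by rewrite addNr.
suff: {ae mu, forall t, J T t -> d t = 0}.
  apply: filterS; first exact: (ae_filter_ringOfSetsType mu).
  move=> t dt Jt; have := dt Jt; rewrite /d mulN1r addrC => /eqP.
  by rewrite subr_eq0 => /eqP.
pose f := d \_ (J T).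
have fi : mu.-integrable setT (EFin \o f).
  by apply: integrable_patch => //; exact: L2_integrable.
have locf : locally_integrable setT f.
  split; [by move/(measurable_int mu)/measurable_EFinP: fi|exact: openT|].
  move=> K _ cK; have /integrableP[_] : mu.-integrable K (EFin \o f).
    by apply: integrableS fi => //; exact: compact_measurable.
  exact.
have fiy (y : R) : mu.-integrable `]-oo, y] (EFin \o f) by apply: integrableS fi.
have := FTC1Ny fiy locf.
apply: filterS; first exact: (ae_filter_ringOfSetsType mu).
move=> x [_ dF] Jx.
have : f x = d x by rewrite /f patchE mem_set.
move=> <-; rewrite -dF derive1E.
move: (Jx); rewrite /J/= in_itv/= => /andP[x0 xT].
set P := (X in 'D_1 X x).
have Pconst y z : 0 < y -> y < z -> z < T -> P z = P y.
  move=> y0 yz zT; apply/eqP; rewrite -subr_eq0; apply/eqP.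
  rewrite /P Rintegral_itvB ?bnd_simp//; last by rewrite ltW.
  rewrite -Rintegral_itv_bndo_bndc; last by apply: integrableS fi.
  rewrite -[RHS](Rintegral_bump Ld d0 y0 yz zT); apply: eq_Rintegral => t.
  rewrite mem_setE in_itv/= => /andP[yt tz]; rewrite /f patchE mem_set//.
  by rewrite /J/= in_itv/= (lt_trans y0)//= (lt_trans tz).
rewrite (@near_eq_derive _ _ _ P (cst (P x)) x 1).
  by rewrite -derive1E derive1_cst.
near=> y; rewrite /cst.
have y0 : 0 < y by near: y; exact: lt_nbhsr.
have yT : y < T by near: y; exact: lt_nbhsl.
have [yx|xy|->//] := ltgtP y x; last exact: Pconst.
by apply/esym; exact: Pconst.
Unshelve. all: by end_near. Qed.

End WeakDerivative.

(** * The bilinear form on [E] and [F] *)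

Section BilinearForm.
Context {R : realType}.
Variables (T lam : R).
Hypotheses (T_gt0 : 0 < T) (lam_gt0 : 0 < lam).
Implicit Types (v g h w x : R -> R).
Notation mu := (@lebesgue_measure R).

Lemma wderivP v : F T v -> weak_derivative T v (wderiv T v).
Proof. by move=> [[_ _ [g vg]] _]; exact: (xgetPex (fun=> 0) (ex_intro _ g vg)). Qed.

Lemma F_L2 v : F T v -> L2 T v.
Proof. by move=> [[]]. Qed.

Lemma wderiv_L2 v : F T v -> L2 T (wderiv T v).
Proof. by move=> /wderivP[]. Qed.

Lemma wderiv_ae v g : F T v -> weak_derivative T v g ->
  ae_eq mu (J T) (wderiv T v) g.
Proof. by move=> /wderivP; exact: weak_derivative_unique. Qed.

Lemma ae_eq_RintegralM w g g' : L2 T w -> L2 T g -> L2 T g' ->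
  ae_eq mu (J T) g g' ->
  \int[mu]_(t in J T) (w t * g t) = \int[mu]_(t in J T) (w t * g' t).
Proof.
move=> Lw Lg Lg' gg'; congr fine.
have mw := L2_measurable Lw; have mg := L2_measurable Lg.
have mg' := L2_measurable Lg'.
apply: ae_eq_integral => //; do ?by apply/measurable_EFinP/measurable_funM.
apply: filterS gg'.
by move=> t gt Jt; rewrite /= gt.
Qed.

Lemma weak_derivative_lin (a : R) v v' g g' : L2 T v -> L2 T v' ->
  weak_derivative T v g -> weak_derivative T v' g' ->
  weak_derivative T (fun t => a * v t + v' t) (fun t => a * g t + g' t).
Proof.
move=> Lv Lv' [Lg wg] [Lg' wg']; split; first exact: L2_lin.
move=> phi tphi; have [Lphi Ldphi] := test_function_L2 tphi.
have := @ip_linl _ T 1 a v v' (derive1 phi) Lv Lv' Ldphi.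
have := @ip_linl _ T 1 a g g' phi Lg Lg' Lphi.
by rewrite /ip !mul1r => -> ->; rewrite wg// wg'// mulrN opprD.
Qed.

Lemma F_lin (a : R) v v' : F T v -> F T v' -> F T (fun t => a * v t + v' t).
Proof.
move=> Fv Fv'; have [[cv Lv _] vT] := Fv; have [[cv' Lv' _] v'T] := Fv'.
split; last by rewrite vT v'T mulr0 addr0.
split; [|exact: L2_lin|].
  move=> t; apply: cvgD; last exact: cv'.
  by apply: cvgM; [exact: cvg_cst|exact: cv].
exists (fun t => a * wderiv T v t + wderiv T v' t).
by apply: weak_derivative_lin => //; exact: wderivP.
Qed.

Lemma weak_derivative0 : weak_derivative T (fun=> 0) (fun=> 0).
Proof.
split=> [|phi _]; first exact: L2_cst.
rewrite (_ : (fun t => 0 * derive1 phi t) = fun=> 0); last first.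
  by apply/funext => t; rewrite mul0r.
rewrite (_ : (fun t => 0 * phi t) = fun=> 0); last first.
  by apply/funext => t; rewrite mul0r.
by rewrite Rintegral_cst// mul0r oppr0.
Qed.

Lemma F0 : F T (fun=> 0).
Proof.
split => //; split; [|exact: L2_cst|].
  by move=> t; exact: cvg_cst.
by exists (fun=> 0); exact: weak_derivative0.
Qed.

Lemma F_scale (a : R) v : F T v -> F T (fun t => a * v t).
Proof.
move=> Fv; have := F_lin a Fv F0.
by congr F; apply/funext => t; rewrite addr0.
Qed.

Lemma F_lc (m : nat) (a : nat -> R) (g : nat -> R -> R) :
  (forall i, (i < m)%N -> F T (g i)) -> F T (lc m a g).
Proof.
elim: m => [|m IH] Fg; first by rewrite lc0; exact: F0.
by rewrite lcS; apply: F_lin; [exact: Fg|apply: IH => i im; exact/Fg/ltnW].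
Qed.

(** [wderiv] is an arbitrary choice; by almost everywhere uniqueness an explicit weak derivative may
    replace it inside [b]. *)
Lemma b_weak w v g : L2 T w -> F T v -> weak_derivative T v g ->
  b T lam w v = \int[mu]_(t in J T) (w t * (- g t + lam * v t)).
Proof.
move=> Lw Fv vg; have Lv := F_L2 Fv; have Lg := vg.1.
have LN u : L2 T u -> L2 T (fun t => - u t + lam * v t).
  move=> Lu; have := L2_lin (-1) Lu (L2_scale lam Lv).
  by congr L2; apply/funext => t; rewrite mulN1r.
apply: ae_eq_RintegralM => //; [exact/LN/wderiv_L2|exact: LN|].
apply: filterS (wderiv_ae Fv vg).
by move=> t gt Jt; rewrite /= gt.
Qed.

(* [b] is the L2 pairing with the image of its second argument under
   [v |-> - v' + lam v]. *)
Definition bop v : R -> R := fun t => -1 * wderiv T v t + lam * v t.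

Lemma bop_L2 v : F T v -> L2 T (bop v).
Proof. by move=> Fv; apply: L2_lin; [exact: wderiv_L2|apply/L2_scale/F_L2]. Qed.

Lemma b_ip w v : b T lam w v = ip T 1 w (bop v).
Proof.
by rewrite /ip mul1r; apply: eq_Rintegral => t _; rewrite /bop mulN1r.
Qed.

Lemma b_linl (a : R) w w' v : L2 T w -> L2 T w' -> F T v ->
  b T lam (fun t => a * w t + w' t) v = a * b T lam w v + b T lam w' v.
Proof. by move=> Lw Lw' Fv; rewrite !b_ip ip_linl//; exact: bop_L2. Qed.

Lemma b_linr (a : R) w v v' : L2 T w -> F T v -> F T v' ->
  b T lam w (fun t => a * v t + v' t) = a * b T lam w v + b T lam w v'.
Proof.
move=> Lw Fv Fv'; have Fl := F_lin a Fv Fv'.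
have wd := weak_derivative_lin a (F_L2 Fv) (F_L2 Fv') (wderivP Fv) (wderivP Fv').
rewrite (b_weak Lw Fl wd) !b_ip -ip_linr//; [|exact: bop_L2..].
by rewrite /ip mul1r; apply: eq_Rintegral => t _; rewrite /bop; congr (_ * _); ring.
Qed.

Lemma b_lc (m : nat) (a : nat -> R) (g : nat -> R -> R) v :
  (forall i, (i < m)%N -> L2 T (g i)) -> F T v ->
  b T lam (lc m a g) v = \sum_(i < m) a i * b T lam (g i) v.
Proof.
move=> Lg Fv; rewrite b_ip ip_lc//; last exact: bop_L2.
by apply: eq_bigr => i _; rewrite b_ip.
Qed.

Lemma normF_scale (a : R) v : F T v ->
  normF T lam (fun t => a * v t) = `|a| * normF T lam v.
Proof.
move=> Fv; have Lv := F_L2 Fv; have Lw := wderiv_L2 Fv.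
have Fa := F_scale a Fv.
have wda : weak_derivative T (fun t => a * v t) (fun t => a * wderiv T v t).
  have := weak_derivative_lin a Lv (L2_cst T 0) (wderivP Fv) weak_derivative0.
  by congr weak_derivative; apply/funext => t; rewrite addr0.
have sq u : L2 T u -> L2normsq T (fun t => a * u t) = a ^+ 2 * L2normsq T u.
  move=> Lu; rewrite /L2normsq -RintegralZl//; last first.
    by have := L2_mul Lu Lu.
  by apply: eq_Rintegral => t _; rewrite exprMn.
have -> : normF T lam (fun t => a * v t) = Num.sqrt (lam^-1 *
    L2normsq T (fun t => a * wderiv T v t) + lam * L2normsq T (fun t => a * v t) +
    (a * v 0) ^+ 2).
  congr (Num.sqrt (_ * _ + _ + _)); rewrite /L2normsq; congr fine.
  have Lwa := wderiv_L2 Fa; have Law := L2_scale a Lw.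
  apply: ae_eq_integral => //; do ?by apply/measurable_EFinP/measurable_funX;
    exact: L2_measurable.
  apply: filterS (wderiv_ae Fa wda).
  by move=> t gt Jt; rewrite /= gt.
rewrite !sq// exprMn -sqrtr_sqr -sqrtrM ?sqr_ge0//.
by congr Num.sqrt; ring.
Qed.

(** The integrating factor keeps test functions admissible, so it can be moved from the function to
    the test function when differentiating [exp(lam t) H] weakly. *)
Lemma test_function_expM phi : test_function T phi ->
  test_function T (fun t => expR (lam * t) * phi t) /\
  forall t, derive1 (fun t => expR (lam * t) * phi t) t =
    expR (lam * t) * derive1 phi t + lam * (expR (lam * t) * phi t).
Proof.
move=> [dphi cphi [a [c [a0 cT sphi]]]].
have de (t : R) : is_derive t 1 (fun s : R => expR (lam * s)) (lam * expR (lam * t)).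
  have dl : is_derive t 1 (fun s : R => lam * s) lam.
    have := is_deriveZ lam (is_derive_id t 1).
    by move=> /is_derive_eq; apply; rewrite /GRing.scale/= mulr1.
  have := is_derive1_comp (is_derive_expR (lam * t)) dl.
  by move=> /is_derive_eq; apply; rewrite mulrC.
have dp (t : R) : is_derive t 1 phi (derive1 phi t).
  by apply: DeriveDef; [exact: dphi|rewrite derive1E].
have dep (t : R) : is_derive t 1 (fun s : R => expR (lam * s) * phi s)
    (expR (lam * t) * derive1 phi t + lam * (expR (lam * t) * phi t)).
  have := is_deriveM (de t) (dp t).
  by move=> /is_derive_eq; apply; rewrite /GRing.scale/=; ring.
have dE (t : R) : derive1 (fun t => expR (lam * t) * phi t) t =
    expR (lam * t) * derive1 phi t + lam * (expR (lam * t) * phi t).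
  by rewrite derive1E; exact: (derive_val (is_derive := dep t)).
split; last exact: dE.
split.
- by move=> t; exact: (ex_derive (is_derive := dep t)).
- have ce (t : R) : {for t, continuous (fun s : R => expR (lam * s))}.
    apply: differentiable_continuous; apply/derivable1_diffP.
    exact: (ex_derive (is_derive := de t)).
  have cp (t : R) : {for t, continuous phi}.
    apply: differentiable_continuous; apply/derivable1_diffP; exact: dphi.
  rewrite (_ : derive1 _ = fun t => expR (lam * t) * derive1 phi t +
      lam * (expR (lam * t) * phi t)); last by apply/funext.
  move=> t; apply: cvgD; first by apply: cvgM; [exact: ce|exact: cphi].
  by apply: cvgM; [exact: cvg_cst|apply: cvgM; [exact: ce|exact: cp]].
- by exists a, c; split => // t /sphi ->; rewrite mulr0.
Qed.

(* The solution is [t |-> exp(lam t) * int_t^T lam exp(-lam s) f(s) ds]. *)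
Lemma b_surjective f : L2 T f ->
  exists v, F T v /\ forall w, L2 T w -> b T lam w v = ip T lam w f.
Proof.
move=> Lf; pose h s := expR (- lam * s) * (lam * f s).
have Llf := L2_scale lam Lf.
have cexp (k : R) : continuous (fun s : R => expR (k * s)).
  move=> t; apply: (@continuous_comp _ _ _ ( *%R k)); last exact: continuous_expR.
  by apply: cvgM; [exact: cvg_cst|exact: cvg_id].
have mexp (k : R) : measurable_fun (J T) (fun s : R => expR (k * s)).
  apply: (measurable_funS measurableT) => //.
  by apply: continuous_measurable_fun; exact: cexp.
have Lh : L2 T h.
  apply: (L2_le _ Llf).
    by apply: measurable_funM => //; exact: L2_measurable.
  move=> t; rewrite /J/= in_itv/= => /andP[t0 _].
  rewrite /h normrM ler_piMl// ger0_norm ?expR_ge0// expR_le1.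
  by rewrite mulNr oppr_le0 mulr_ge0 ?ltW.
pose H := tail_integral T h.
have [FH [LNh wH]] : F T H /\ weak_derivative T H (fun t => - h t).
  exact: weak_derivative_tail.
pose v t := expR (lam * t) * H t.
have cv : {within `[0, T], continuous v}.
  move=> t; apply: cvgM; last by case: FH => -[+ _ _] _; exact.
  exact: (continuous_subspaceT (cexp lam)).
have Lv : L2 T v by exact: L2_within_continuous.
(* The weak product rule: [exp(lam t) phi'] is the derivative of [exp(lam t) phi] minus
   [lam exp(lam t) phi]. It yields [- v' + lam v = lam f], where the factor [lam] matches the weight
   of [ip]. *)
have wv : weak_derivative T v (fun t => lam * v t + - lam * f t).
  split; first by apply: L2_lin => //; exact: L2_scale.
  move=> phi tphi; have [tphi' dE] := test_function_expM tphi.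
  have [Lphi Ldphi] := test_function_L2 tphi.
  have [Lphi' Ldphi'] := test_function_L2 tphi'.
  have -> : \int[mu]_(t in J T) (v t * derive1 phi t) =
      ip T 1 H (fun t => - lam * (expR (lam * t) * phi t) +
        derive1 (fun t => expR (lam * t) * phi t) t).
    rewrite /ip mul1r; apply: eq_Rintegral => t _; rewrite dE /v; ring.
  have LH := F_L2 FH.
  rewrite ip_linr// {2}/ip mul1r wH//.
  have -> : \int[mu]_(t in J T) (- h t * (expR (lam * t) * phi t)) =
      ip T 1 (fun t => - lam * f t) phi.
    rewrite /ip mul1r; apply: eq_Rintegral => t _; rewrite /h.
    have : expR (- lam * t) * expR (lam * t) = 1.
      by rewrite -expRD mulNr addNr expR0.
    by move=> E1; rewrite -[RHS]mul1r -E1; ring.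
  have -> : ip T 1 H (fun t => expR (lam * t) * phi t) = ip T 1 v phi.
    by rewrite /ip !mul1r; apply: eq_Rintegral => t _; rewrite /v; ring.
  have := @ip_linl _ T 1 lam v (fun t => - lam * f t) phi Lv (L2_scale _ Lf) Lphi.
  rewrite {1}/ip mul1r => ->; ring.
exists v.
have Fv : F T v.
  split; last by rewrite /v /H tail_integralT mulr0.
  by split => //; eexists; exact: wv.
split => // w Lw; rewrite (b_weak Lw Fv wv) /ip.
rewrite -RintegralZl//; last exact: L2_mul.
by apply: eq_Rintegral => t _; ring.
Qed.

(** Coefficients against the [f i] become values of [b], so that on [Epi] they can be read off from
    [B]. *)
Lemma b_representation (m : nat) (f : nat -> R -> R) :
  (forall i, (i < m)%N -> L2 T (f i)) -> exists psi : nat -> R -> R,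
  (forall i, (i < m)%N -> F T (psi i)) /\
  (forall i w, (i < m)%N -> L2 T w -> b T lam w (psi i) = ip T lam w (f i)).
Proof.
move=> Lf.
have /choice[psi psiP] : forall i, exists v, (i < m)%N -> F T v /\
    forall w, L2 T w -> b T lam w v = ip T lam w (f i).
  move=> i; have [im|] := boolP (i < m)%N; last by exists (fun=> 0).
  by have [v vP] := b_surjective (Lf i im); exists v.
exists psi; split=> [i im|i w im Lw]; first by case: (psiP i im).
by case: (psiP i im) => _; exact.
Qed.

End BilinearForm.

(** * The mesh, the discrete spaces and the projection *)

Section Mesh.
Context {R : realType}.
Variables (T : R) (N : nat).
Hypotheses (T_gt0 : 0 < T) (N_gt0 : (0 < N)%N).
Implicit Types (v f g h w x : R -> R) (P Q : {poly R}).
Notation mu := (@lebesgue_measure R).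
Notation k := (T / N%:R).
Notation node := (node T N).
Notation cell i := (Jn T N i.+1).

Lemma mesh_gt0 : 0 < k.
Proof. by rewrite divr_gt0// ltr0n. Qed.
Let k_gt0 := mesh_gt0.
Let k_neq0 : k != 0. Proof. by rewrite gt_eqF. Qed.

Lemma node0 : node 0 = 0. Proof. by rewrite /Defs.node mul0r. Qed.

Lemma nodeN : node N = T.
Proof. by rewrite /Defs.node mulrC divfK// pnatr_eq0 -lt0n. Qed.

Lemma nodeS i : node i.+1 = node i + k.
Proof. by rewrite /Defs.node -addn1 natrD mulrDl mul1r. Qed.

Lemma node_lt i j : (node i < node j) = (i < j)%N.
Proof. by rewrite /Defs.node ltr_pM2r// ltr_nat. Qed.

Lemma node_le i j : (node i <= node j) = (i <= j)%N.
Proof. by rewrite /Defs.node ler_pM2r// ler_nat. Qed.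

Lemma node_ge0 i : 0 <= node i.
Proof. by rewrite -node0 node_le. Qed.

Lemma node_leT i : (i <= N)%N -> node i <= T.
Proof. by rewrite -{2}nodeN node_le. Qed.

Lemma step_mesh i : step T N i.+1 = k.
Proof. by rewrite /step/= nodeS addrC addKr. Qed.

Lemma cellP i t : cell i t <-> node i < t < node i.+1.
Proof. by rewrite /Jn/= in_itv. Qed.

Lemma cell_J i : (i < N)%N -> cell i `<=` J T.
Proof.
move=> iN t /cellP/andP[it ti]; rewrite /J/= in_itv/= (le_lt_trans (node_ge0 i))//=.
by rewrite (lt_le_trans ti)// node_leT.
Qed.

Lemma measurable_cell i : @measurable _ (measurableTypeR R) (cell i).
Proof. exact: measurable_itv. Qed.
Hint Resolve measurable_cell : core.

Lemma cell_inj i j t : cell i t -> cell j t -> i = j.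
Proof.
move=> /cellP/andP[it ti] /cellP/andP[jt tj].
have := lt_trans it tj; have := lt_trans jt ti.
by rewrite !node_lt !ltnS => ji ij; apply/eqP; rewrite eqn_leq ij ji.
Qed.

Lemma Rintegral_cell_restrict i f g : (i < N)%N ->
  \int[mu]_(t in J T) ((f \_ (cell i)) t * g t) =
  \int[mu]_(t in cell i) (f t * g t).
Proof.
move=> iN; rewrite [RHS](_ : _ = \int[mu]_(t in J T `&` cell i) (f t * g t)).
  rewrite Rintegral_mkcondr; apply: eq_Rintegral => t _.
  by rewrite !patchE; case: ifP => // _; rewrite mul0r.
by congr Rintegral; apply/esym/setIidr; exact: cell_J.
Qed.

Definition antideriv P : {poly R} := \poly_(i < (size P).+1) (P`_i.-1 / i%:R).

Lemma deriv_antideriv P : (antideriv P)^`()%R = P.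
Proof.
apply/polyP => i; rewrite coef_deriv coef_poly ltnS.
case: ltnP => [iP|Pi]; last by rewrite mul0rn nth_default.
by rewrite -[LHS]mulr_natr divfK ?pnatr_eq0.
Qed.

(** The integral over the reference interval from 0 to 1. Integrals over cells thereby become
    computations with polynomials that do not depend on the cell. *)
Definition polyint P : R := (antideriv P).[1] - (antideriv P).[0].

Lemma Rintegral_antideriv Q i :
  \int[mu]_(t in cell i) (Q^`()%R).[(t - node i) / k] = k * (Q.[1] - Q.[0]).
Proof.
have dF (t : R) : is_derive t 1 (fun s : R => k * Q.[(s - node i) / k])
    (Q^`()%R).[(t - node i) / k].
  have dl : is_derive t 1 (fun s : R => (s - node i) / k) k^-1.
    have := is_deriveM (is_deriveB (is_derive_id t 1) (is_derive_cst (node i) t 1))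
      (is_derive_cst k^-1 t 1).
    move=> /is_derive_eq; apply.
    by rewrite /GRing.scale/= mulr0 add0r subr0 mulr1.
  have := @is_derive1_comp _ (horner Q) (fun s => (s - node i) / k) _ _ _ (is_derive_poly Q ((t - node i) / k)) dl.
  move=> /(is_deriveZ k)/is_derive_eq; apply.
  by rewrite /GRing.scale/= mulrCA divff// mulr1.
have cf : continuous (fun t : R => (Q^`()%R).[(t - node i) / k]).
  move=> t; apply: (@continuous_comp _ _ _ (fun t : R => (t - node i) / k)).
    apply: cvgM; last exact: cvg_cst.
    by apply: cvgB; [exact: cvg_id|exact: cvg_cst].
  exact: continuous_horner.
rewrite /Jn/= (Rintegral_FTC _ dF cf); last by rewrite node_lt.
rewrite -mulrBr nodeS; congr (k * (Q.[_] - Q.[_])); last by rewrite subrr mul0r.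
by rewrite addrC addKr divff.
Qed.

Lemma Rintegral_cell P i :
  \int[mu]_(t in cell i) P.[(t - node i) / k] = k * polyint P.
Proof. by rewrite -(Rintegral_antideriv _ i) deriv_antideriv. Qed.

Lemma polyint_deriv Q : polyint (Q^`()%R) = Q.[1] - Q.[0].
Proof.
by apply: (mulfI k_neq0); rewrite -(Rintegral_cell _ 0) Rintegral_antideriv.
Qed.

Lemma polyint_quad (a b c : R) :
  polyint (a%:P + b *: 'X + c *: 'X^2) = a + b / 2 + c / 3.
Proof.
have -> : a%:P + b *: 'X + c *: 'X^2 =
    ((a *: 'X + (b / 2) *: 'X^2 + (c / 3) *: 'X^3)^`())%R.
  rewrite !derivD !derivZ derivX !derivXn/= expr1 alg_polyC.
  have cancel (x : R) n (p : {poly R}) : (x / n.+1%:R) *: (p *+ n.+1) = x *: p.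
    by rewrite -scalerMnr scalerMnl -[_ *+ _]mulr_natr divfK// pnatr_eq0.
  by rewrite !cancel.
by rewrite polyint_deriv !(hornerE, horner_exp)/=; field.
Qed.

Definition chi i : R -> R := \1_(cell i).

Lemma chiE i t : chi i t = ((fun=> 1 : R) \_ (cell i)) t.
Proof. by rewrite /chi indicE patchE; case: (_ \in _). Qed.

Lemma chi_in i t : cell i t -> chi i t = 1.
Proof. by move=> it; rewrite chiE patchE mem_set. Qed.

Lemma chi_out i t : ~ cell i t -> chi i t = 0.
Proof. by move=> it; rewrite chiE patchE memNset. Qed.

Lemma chi_cell i j t : cell i t -> chi j t = (i == j)%:R.
Proof.
move=> it; have [<-|ij] := eqVneq i j; first exact: chi_in.
by apply: chi_out => jt; move/eqP: ij; apply; exact: cell_inj it jt.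
Qed.

Lemma chi_L2 i : L2 T (chi i).
Proof.
apply: (@L2_bounded _ _ _ 1) => [|t _].
  have mi : measurable (cell i) by exact: measurable_itv.
  exact: measurable_indic.
by rewrite /chi indicE; case: (_ \in _); rewrite ?normr1 ?normr0.
Qed.

Lemma lc_cell (a : nat -> R) i t : (i < N)%N -> cell i t -> lc N a chi t = a i.
Proof.
move=> iN it; rewrite -(sum_delta a iN); apply: eq_bigr => j _.
by rewrite (chi_cell j it) eq_sym.
Qed.

(** A ramp: [k] to the left of the cell, slope -1 across it, 0 to its right. Ramps express a
    function of [Fk] through its slopes, and their weak derivatives are known from the tail
    integral. *)
Definition down i : R -> R := tail_integral T (chi i).

Lemma downE i t : (i < N)%N -> 0 <= t <= T ->
  down i t = Num.max 0 (node i.+1 - Num.max t (node i)).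
Proof.
move=> iN /andP[t0 tT]; rewrite /down /tail_integral.
rewrite (@eq_Rintegral _ _ _ mu _ ((fun=> 1 : R) \_ (cell i))); last by move=> s _; rewrite chiE.
rewrite -Rintegral_mkcondr.
have -> : `]t, T[ `&` cell i = [set` `]Num.max t (node i), node i.+1[].
  apply/seteqP; split => s; rewrite /Jn/= !in_itv/= gt_max.
    by move=> [/andP[-> _] /andP[-> ->]].
  move=> /andP[/andP[-> ->] si]; split => //=.
  by rewrite (lt_le_trans si)// node_leT.
rewrite Rintegral_cst// mul1r/= lebesgue_measure_itv/= lte_fin.
case: ltP => h.
  by rewrite -EFinD/= [RHS](max_idPr _)// subr_ge0 ltW.
by rewrite [RHS](max_idPl _)// subr_le0.
Qed.

Lemma down_right i t : (i < N)%N -> node i.+1 <= t <= T -> down i t = 0.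
Proof.
move=> iN /andP[it tT]; rewrite downE//; last first.
  by rewrite tT andbT (le_trans _ it)// node_ge0.
apply/max_idPl; rewrite subr_le0 (max_idPl _)//.
by rewrite (le_trans _ it)// node_le.
Qed.

Lemma down_left i t : (i < N)%N -> 0 <= t <= node i -> down i t = k.
Proof.
move=> iN /andP[t0 ti]; rewrite downE//; last first.
  by rewrite t0 (le_trans ti)// node_leT// ltnW.
by rewrite (max_idPr ti) nodeS addrC addKr (max_idPr _)// ltW.
Qed.

Lemma down_mid i t : (i < N)%N -> node i <= t <= node i.+1 ->
  down i t = node i.+1 - t.
Proof.
move=> iN /andP[it ti]; rewrite downE; last 2 first.
- exact: iN.
- by rewrite (le_trans (node_ge0 i))//= (le_trans ti)// node_leT.
by rewrite (max_idPl it) (max_idPr _)// subr_ge0.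
Qed.

Lemma down_weak i : (i < N)%N ->
  F T (down i) /\ weak_derivative T (down i) (fun t => - chi i t).
Proof. by move=> iN; apply: weak_derivative_tail => //; exact: chi_L2. Qed.

(** [Fk] prescribes its functions on open cells only; one-sided limits carry an identity over to the
    nodes. *)
Lemma continuous_closed_cell (f : R -> R) (a c : R) : a < c -> 0 <= a -> c <= T ->
  {within `[0, T], continuous f} -> (forall t, a < t < c -> f t = 0) ->
  f a = 0 /\ f c = 0.
Proof.
move=> ac a0 cT cf f0.
have cf' : {within `[a, c], continuous f}.
  by apply: continuous_subspaceW cf; apply: subset_itv; rewrite bnd_simp.
have /(continuous_within_itvP _ ac)[_ fa fc] := cf'.
have za : f t @[t --> a^'+] --> (0 : R).
  apply: cvg_near_cst; near=> t.
  by rewrite f0//; apply/andP; split; near: t; [exact: nbhs_right_gt|exact: nbhs_right_lt].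
have zc : f t @[t --> c^'-] --> (0 : R).
  apply: cvg_near_cst; near=> t.
  by rewrite f0//; apply/andP; split; near: t; [exact: nbhs_left_gt|exact: nbhs_left_lt].
by split; [exact: (cvg_unique _ fa za)|exact: (cvg_unique _ fc zc)].
Unshelve. all: by end_near. Qed.

Lemma Fk_tail v (d : nat -> R) : Fk T N v ->
  (forall i, (i < N)%N -> exists c, forall t, cell i t -> v t = c + d i * t) ->
  forall t, 0 <= t <= T -> v t = lc N (fun i => - d i) down t.
Proof.
move=> [cv _ vT] vd.
pose u := lc N (fun i => - d i) down.
have Fu : F T u by apply: F_lc => i iN; have [] := down_weak iN.
have [[cu _ _] _] := Fu.
have uT : u T = 0 by case: Fu.
have uE j t : (j < N)%N -> node j <= t <= node j.+1 ->
    u t = u (node j.+1) - d j * (node j.+1 - t).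
  move=> jN /andP[jt tj].
  have t0 : 0 <= t by rewrite (le_trans (node_ge0 j)).
  have tT : t <= T by rewrite (le_trans tj)// node_leT.
  rewrite /u /lc (bigD1 (Ordinal jN))//= [in RHS](bigD1 (Ordinal jN))//=.
  rewrite down_mid ?jt// (down_right jN) ?lexx ?node_leT// mulr0 add0r addrC mulNr.
  congr (_ - _); apply: eq_bigr => i ij.
  have iN := ltn_ord i; congr (_ * _).
  have : (i != j :> nat) by [].
  rewrite neq_ltn => /orP[ltij|ltji].
    rewrite down_right//; last by rewrite tT andbT (le_trans _ jt)// node_le.
    by rewrite down_right// node_leT// node_le ltnS ltnW.
  rewrite down_left//; last by rewrite t0 (le_trans tj)// node_le.
  by rewrite down_left// node_ge0 node_le.
(* The induction runs backwards from [T], where both functions vanish, and adds one cell at a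
   time. *)
suff H m : (m <= N)%N -> forall t, node (N - m) <= t <= T -> v t = u t.
  by move=> t tT; apply: (H N) => //; rewrite subnn node0.
elim: m => [|m IH] mN t.
  by rewrite subn0 nodeN -eq_le => /eqP <-; rewrite vT uT.
set j := (N - m.+1)%N; have jE : (N - m)%N = j.+1 by rewrite /j subnSK.
have jN : (j < N)%N by rewrite -jE leq_subr.
move=> /andP[jt tT].
have [tj|jt'] := leP t (node j.+1); last first.
  by apply: (IH (ltnW mN)); rewrite jE (ltW jt').
have [c vc] := vd j jN.
have vuj : v (node j.+1) = u (node j.+1).
  by apply: (IH (ltnW mN)); rewrite jE lexx node_leT.
pose D s := v s - (c + d j * s).
have [Da Dc] : D (node j) = 0 /\ D (node j.+1) = 0.
  apply: continuous_closed_cell.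
  - by rewrite node_lt.
  - exact: node_ge0.
  - exact: node_leT.
  - move=> s; apply: cvgB; first exact: cv.
    apply: (@continuous_subspaceT _ _ _ (fun s : R => c + d j * s)) => r.
    apply: cvgD; first exact: cvg_cst.
    by apply: cvgM; [exact: cvg_cst|exact: cvg_id].
  - by move=> s /cellP js; rewrite /D vc// subrr.
have vt : v t = c + d j * t.
  move: jt tj; rewrite le_eqVlt => /predU1P[<- _|jt].
    by apply/eqP; rewrite -subr_eq0; apply/eqP.
  rewrite le_eqVlt => /predU1P[->|tj]; last by apply: vc; apply/cellP; rewrite jt.
  by apply/eqP; rewrite -subr_eq0; apply/eqP.
rewrite vt (uE j) ?jt// -vuj.
have -> : v (node j.+1) = c + d j * node j.+1.
  by apply/eqP; rewrite -subr_eq0; apply/eqP.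
by ring.
Qed.

(** By linearity from the ramps: the slopes reappear as the coefficients of the cell indicators. *)
Lemma Fk_weak v (d : nat -> R) : Fk T N v ->
  (forall i, (i < N)%N -> exists c, forall t, cell i t -> v t = c + d i * t) ->
  F T v /\ weak_derivative T v (lc N d chi).
Proof.
move=> Fkv vd; have vE := Fk_tail Fkv vd.
pose u := lc N (fun i => - d i) down.
have wu : weak_derivative T u (lc N d chi).
  suff H m : (m <= N)%N ->
      weak_derivative T (lc m (fun i => - d i) down) (lc m d chi) by exact: H.
  elim: m => [_|m IH mN].
    by rewrite !lc0; exact: weak_derivative0.
  have [Fd wd] := down_weak mN.
  rewrite !lcS (_ : (fun t => d m * chi m t + _) =
    fun t => - d m * - chi m t + lc m d chi t); last by apply/funext => t; rewrite mulrNN.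
  apply: weak_derivative_lin => //; [exact: F_L2| |exact/IH/ltnW].
  by apply: L2_lc => i im; apply: F_L2; have [] := down_weak (ltn_trans im mN).
have [cv _ vT] := Fkv.
have wv : weak_derivative T v (lc N d chi).
  case: wu => Lg wg; split => // phi tphi; rewrite -wg//.
  apply: eq_Rintegral => t; rewrite inE /J/= in_itv/= => /andP[t0 tT].
  by rewrite vE// !ltW.
split => //; split => //; split => //; last by eexists; exact: wv.
exact: L2_within_continuous.
Qed.

Lemma Fk_slopes v : Fk T N v -> exists d : nat -> R,
  forall i, (i < N)%N -> exists c, forall t, cell i t -> v t = c + d i * t.
Proof.
move=> [_ va _].
have H i : exists d, (i < N)%N -> exists c, forall t, cell i t -> v t = c + d * t.
  have [iN|] := boolP (i < N)%N; last by exists 0.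
  by have [//|c [d vcd]] := va i.+1 _; exists d => _; exists c.
by have [d] := choice H; exists d.
Qed.

Lemma Fk_F v : Fk T N v -> F T v.
Proof. by move=> Fkv; have [d /(Fk_weak Fkv)[]] := Fk_slopes Fkv. Qed.

Lemma Fk_lin (a : R) v v' : Fk T N v -> Fk T N v' -> Fk T N (fun t => a * v t + v' t).
Proof.
move=> [cv va vT] [cv' va' v'T]; split; last by rewrite vT v'T mulr0 addr0.
  move=> t; apply: cvgD; last exact: cv'.
  by apply: cvgM; [exact: cvg_cst|exact: cv].
move=> n nN; have [c [d vcd]] := va n nN; have [c' [d' vcd']] := va' n nN.
exists (a * c + c'), (a * d + d') => t nt; rewrite vcd// vcd'//; ring.
Qed.

(** The negated ramp is a primitive of the cell indicator that lies in [Fk]. Orthogonality to [dFk]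
    can thus be tested cell by cell. *)
Lemma chi_dFk i : (i < N)%N -> dFk T N (chi i).
Proof.
move=> iN; have [Fd wd] := down_weak iN.
have [[cd _ _] dT] := Fd.
exists (fun t => -1 * down i t); last first.
  have := weak_derivative_lin (-1) (F_L2 Fd) (L2_cst T 0) wd
    (g' := fun=> 0) _.
  rewrite (_ : (fun t => -1 * down i t + 0) = fun t => -1 * down i t); last first.
    by apply/funext => t; rewrite addr0.
  rewrite (_ : (fun t => -1 * - chi i t + 0) = chi i); last first.
    by apply/funext => t; rewrite addr0 mulN1r opprK.
  by apply; exact: weak_derivative0.
split; last by rewrite dT mulr0.
  by move=> t; apply: cvgM; [exact: cvg_cst|exact: cd].
move=> [//|j] /= jN.
have inT t : cell j t -> 0 <= t <= T.
  move=> jt; have := cell_J jN jt.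
  by rewrite /J/= in_itv/= => /andP[/ltW -> /ltW ->].
have [ij|ji|ij] := ltngtP i j.
- exists 0, 0 => t jt; rewrite down_right ?mulr0 ?mul0r ?addr0//.
  have /andP[_ ->] := inT _ jt; rewrite andbT.
  move/cellP: jt => /andP[/ltW jt _]; rewrite (le_trans _ jt)// node_le//.
- exists (- k), 0 => t jt; rewrite down_left ?mul0r ?addr0 ?mulN1r//.
  have /andP[-> _] := inT _ jt.
  move/cellP: jt => /andP[_ /ltW tj]; rewrite (le_trans tj)// node_le//.
- exists (- node i.+1), 1 => t; rewrite -ij => /cellP/andP[/ltW it /ltW ti].
  by rewrite down_mid ?it//; ring.
Qed.

End Mesh.

(** * Trial functions and their inner products *)

Section Scheme.
Context {R : realType}.
Variables (T lam : R) (N : nat) (s : scheme).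
Hypotheses (T_gt0 : 0 < T) (lam_gt0 : 0 < lam) (N_gt0 : (0 < N)%N).
Implicit Types (v f g h w x : R -> R) (P Q : {poly R}).
Notation mu := (@lebesgue_measure R).
Notation k := (T / N%:R).
Notation node := (node T N).
Notation cell i := (Jn T N i.+1).
Notation ip := (ip T lam).
Notation chi := (chi T N).
Let k_gt0 : 0 < k := mesh_gt0 T_gt0 N_gt0.

Lemma polyint_lin (c : R) P Q : polyint (c *: P + Q) = c * polyint P + polyint Q.
Proof.
rewrite -{1}(deriv_antideriv P) -{1}(deriv_antideriv Q) -derivZ -derivD.
by rewrite (polyint_deriv T_gt0 N_gt0) !hornerD !hornerZ /polyint; ring.
Qed.

Lemma polyint0 : polyint (0 : {poly R}) = 0.
Proof.
by have := polyint_lin (-1) 0 0; rewrite scaler0 addr0 mulN1r addNr.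
Qed.

Lemma polyintZ (c : R) P : polyint (c *: P) = c * polyint P.
Proof. by have := polyint_lin c P 0; rewrite polyint0 !addr0. Qed.

Lemma eq_Rintegral_cell i f P : (forall t, cell i t -> f t = P.[(t - node i) / k]) ->
  \int[mu]_(t in cell i) f t = k * polyint P.
Proof.
move=> fP; rewrite -(Rintegral_cell T_gt0 N_gt0 _ i); apply: eq_Rintegral => t.
by rewrite inE => /fP.
Qed.

Definition trial_poly : {poly R} := if s is CN2 then 1 else 4%:P - 6 *: 'X.
Notation pr := trial_poly.

(* The diagonal entries of the Gram matrix of [trial] against [ebar]; the
   projection onto piecewise constants acts on [Ek] as [kappa] times an
   isometry. *)
Definition kappa : R := if s is CN2 then 1 else 2^-1.

Lemma kappa_gt0 : 0 < kappa.
Proof. by rewrite /kappa; case: s; rewrite ?ltr01// invr_gt0 ltr0n. Qed.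

(** The numbers through which the profile enters: mean 1, mean square [kappa^-2], and a positive
    mean against [1 - X]. They allow the constant and the affine profile to be treated together. *)
Lemma trial_polyE : exists a c : R, [/\ pr = a%:P + c *: 'X,
  a + c / 2 = 1, a ^+ 2 + a * c + c ^+ 2 / 3 = kappa ^- 2 &
  0 < a + (c - a) / 2 - c / 3].
Proof.
rewrite /trial_poly /kappa; case: s.
  exists 1, 0; split; [by rewrite scale0r addr0|by field|by field|].
  by rewrite (_ : _ - _ = 2^-1) ?invr_gt0 ?ltr0n//; field.
all: exists 4, (-6); split; [by rewrite scaleNr|by field|by field|].
all: by rewrite (_ : _ - _ = 1) ?ltr01//; field.
Qed.

Lemma polyint_trial : polyint pr = 1.
Proof.
have [a [c [-> ac _ _]]] := trial_polyE.
have := polyint_quad T_gt0 N_gt0 a c 0.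
by rewrite scale0r addr0 mul0r addr0 => ->.
Qed.

Lemma polyint_trial_sq : polyint (pr * pr) = kappa ^- 2.
Proof.
have [a [c [-> _ acq _]]] := trial_polyE.
have -> : (a%:P + c *: 'X) * (a%:P + c *: 'X) =
    (a * a)%:P + (2 * a * c) *: 'X + (c * c) *: 'X^2.
  by rewrite -!mul_polyC !polyCM; ring.
by rewrite (polyint_quad T_gt0 N_gt0) -acq; field.
Qed.

Lemma polyint_trial_left : 0 < polyint (pr * (1 - 'X)).
Proof.
have [a [c [-> _ _]]] := trial_polyE.
have -> : (a%:P + c *: 'X) * (1 - 'X) = a%:P + (c - a) *: 'X + (- c) *: 'X^2.
  by rewrite -!mul_polyC polyCB polyCN; ring.
by rewrite (polyint_quad T_gt0 N_gt0) mulNr.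
Qed.

Lemma profileE i t : profile T N s i.+1 t = pr.[(t - node i) / k].
Proof.
rewrite /profile /trial_poly (step_mesh _ _ i).
by case: s => /=; rewrite !hornerE// mulrA.
Qed.

(** By its mean square [kappa^-2], the profile on one cell has [E]-norm [sqrt(lam k) / kappa]. *)
Definition trial_scale : R := (Num.sqrt (lam * k) * kappa^-1)^-1.
Notation ce := trial_scale.

Lemma sqrt_lam_mesh_gt0 : 0 < Num.sqrt (lam * k).
Proof. by rewrite sqrtr_gt0 mulr_gt0. Qed.

Lemma trial_scale_gt0 : 0 < ce.
Proof.
by rewrite invr_gt0 mulr_gt0 ?sqrt_lam_mesh_gt0// invr_gt0 kappa_gt0.
Qed.

(* Basis functions and cells are numbered from 1 in [Defs] and from 0 below. *)
Definition trial (i : nat) : R -> R := e T lam N s i.+1.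

Lemma trialE i : (i < N)%N ->
  trial i = (fun t => ce * pr.[(t - node i) / k]) \_ (cell i).
Proof.
move=> iN; apply/funext => t; rewrite /trial /e.
have -> : (normE T lam (profile T N s i.+1 \_ (cell i)))^-1 = ce.
  congr (_^-1); rewrite /normE.
  have -> : L2normsq T (profile T N s i.+1 \_ (cell i)) = k * polyint (pr * pr).
    rewrite /L2normsq; under eq_Rintegral do rewrite expr2.
    rewrite Rintegral_cell_restrict//; apply: eq_Rintegral_cell => u iu.
    by rewrite patchE mem_set// profileE hornerM.
  rewrite polyint_trial_sq mulrA sqrtrM; last by rewrite mulr_ge0 ?ltW.
  by rewrite -exprVn sqrtr_sqr ger0_norm// invr_ge0 ltW// kappa_gt0.
by rewrite !patchE; case: ifP => _; rewrite ?mulr0// profileE.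
Qed.

Lemma trial_in i t : (i < N)%N -> cell i t -> trial i t = (ce *: pr).[(t - node i) / k].
Proof. by move=> iN it; rewrite trialE// patchE mem_set// hornerZ. Qed.

Lemma trial_out i t : (i < N)%N -> ~ cell i t -> trial i t = 0.
Proof. by move=> iN it; rewrite trialE// patchE memNset. Qed.

Lemma trial_L2 i : (i < N)%N -> L2 T (trial i).
Proof.
move=> iN; have cpr : continuous (fun t : R => ce * pr.[(t - node i) / k]).
  move=> t; apply: cvgM; first exact: cvg_cst.
  apply: (@continuous_comp _ _ _ (fun t : R => (t - node i) / k)).
    apply: cvgM; last exact: cvg_cst.
    by apply: cvgB; [exact: cvg_id|exact: cvg_cst].
  exact: continuous_horner.
have Lp : L2 T (fun t : R => ce * pr.[(t - node i) / k]).
  by apply: L2_within_continuous => //; exact: continuous_subspaceT.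
apply: (L2_le _ Lp); last first.
  move=> t _; rewrite trialE// patchE; case: ifP => // _.
  by rewrite normr0.
rewrite (_ : trial i = fun t => chi i t * (ce * pr.[(t - node i) / k])).
  by apply: measurable_funM; apply: L2_measurable => //; exact: chi_L2.
apply/funext => t; rewrite trialE// chiE !patchE.
by case: ifP => _; rewrite ?mul1r ?mul0r.
Qed.

Lemma Rintegral_trial i g P : (i < N)%N ->
  (forall t, cell i t -> g t = P.[(t - node i) / k]) ->
  \int[mu]_(t in J T) (trial i t * g t) = ce * k * polyint (pr * P).
Proof.
move=> iN gP; rewrite trialE// Rintegral_cell_restrict//.
rewrite (@eq_Rintegral_cell i _ ((ce *: pr) * P)).
  by rewrite [X in polyint X](_ : _ = ce *: (pr * P)) ?polyintZ ?scalerAl//; ring.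
by move=> t it; rewrite gP// hornerM hornerZ.
Qed.

Lemma scale_sq : lam * ce * ce * k * kappa ^- 2 = 1.
Proof.
rewrite /trial_scale; have := sqr_sqrtr (ltW (mulr_gt0 lam_gt0 k_gt0)).
have := sqrt_lam_mesh_gt0; set r := Num.sqrt _ => r0 rE.
have -> : lam * (r / kappa)^-1 * (r / kappa)^-1 * k * kappa ^- 2 =
   (lam * k) * (r / kappa)^-1 * (r / kappa)^-1 * kappa ^- 2 by ring.
rewrite -rE; field; rewrite (gt_eqF r0) (gt_eqF kappa_gt0)//.
Qed.

Lemma ip_trial i j : (i < N)%N -> (j < N)%N -> ip (trial i) (trial j) = (i == j)%:R.
Proof.
move=> iN jN; rewrite /ip; have [<-|ij] := eqVneq i j.
  rewrite (@Rintegral_trial i _ (ce *: pr))//; last by move=> t; exact: trial_in.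
  rewrite (_ : pr * (ce *: pr) = ce *: (pr * pr)); last by rewrite scalerAr.
  by rewrite polyintZ polyint_trial_sq -[RHS]scale_sq; ring.
rewrite (@Rintegral_trial i _ 0)// ?mulr0 ?polyint0 ?mulr0//.
move=> t it; rewrite horner0 trial_out// => jt.
by move/eqP: ij; apply; exact: (cell_inj T_gt0 N_gt0 it jt).
Qed.

(** The orthonormal basis of the piecewise constants onto which [q] projects. *)
Definition ebar i : R -> R := fun t => (Num.sqrt (lam * k))^-1 * chi i t.

Lemma ebar_L2 i : L2 T (ebar i).
Proof. by apply: L2_scale; exact: chi_L2. Qed.

Lemma ip_chi i w : (i < N)%N -> ip w (chi i) = lam * \int[mu]_(t in cell i) w t.
Proof.
move=> iN; rewrite ipC /ip; congr (_ * _).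
rewrite (_ : chi i = (fun=> 1 : R) \_ (cell i)); last by apply/funext => t; rewrite chiE.
by rewrite Rintegral_cell_restrict//; apply: eq_Rintegral => t _; rewrite mul1r.
Qed.

Lemma ip_ebar w i : (i < N)%N -> L2 T w ->
  ip w (ebar i) = (Num.sqrt (lam * k))^-1 * (lam * \int[mu]_(t in cell i) w t).
Proof. by move=> iN Lw; rewrite ip_scaler ?ip_chi//; exact: chi_L2. Qed.

(** As the profile has mean 1, only the two normalizations remain, and their ratio is [kappa]. Hence
    [q] sends [trial i] to [kappa * ebar i] almost everywhere. *)
Lemma ip_trial_ebar i j : (i < N)%N -> (j < N)%N ->
  ip (trial i) (ebar j) = kappa * (i == j)%:R.
Proof.
move=> iN jN; rewrite ip_scaler; [|exact: trial_L2|exact: chi_L2].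
rewrite /ip (@Rintegral_trial i _ ((i == j)%:R)%:P)//; last first.
  by move=> t it; rewrite hornerC (chi_cell T_gt0 N_gt0 j it).
rewrite (_ : pr * _ = (i == j)%:R *: pr); last by rewrite mulrC mul_polyC.
rewrite polyintZ polyint_trial mulr1 mulrC.
rewrite /trial_scale; have := sqr_sqrtr (ltW (mulr_gt0 lam_gt0 k_gt0)).
have := sqrt_lam_mesh_gt0; set r := Num.sqrt _ => r0 rE.
set d := (_ == _)%:R.
have -> : lam * ((r / kappa)^-1 * k * d) / r = lam * k * ((r / kappa)^-1 * d / r) by ring.
by rewrite -rE; field; rewrite (gt_eqF r0) (gt_eqF kappa_gt0).
Qed.

End Scheme.

(** * The projection, the hat functions and the dual basis *)

Section Hats.
Context {R : realType}.
Variables (T lam : R) (N : nat) (s : scheme).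
Hypotheses (T_gt0 : 0 < T) (lam_gt0 : 0 < lam) (N_gt0 : (0 < N)%N).
Implicit Types (v f g h w x : R -> R) (P Q : {poly R}).
Notation mu := (@lebesgue_measure R).
Notation k := (T / N%:R).
Notation node := (node T N).
Notation cell i := (Jn T N i.+1).
Notation ip := (ip T lam).
Notation chi := (chi T N).
Notation ebar := (ebar T lam N).
Notation trial := (trial T lam N s).
Notation ce := (trial_scale T lam N s).
Notation pr := (@trial_poly R s).
Notation hat := (hat T N).
Let k_gt0 : 0 < k := mesh_gt0 T_gt0 N_gt0.
Let T_neq0 : T != 0. Proof. by rewrite gt_eqF. Qed.
Let N_neq0 : N%:R != 0 :> R. Proof. by rewrite pnatr_eq0 -lt0n. Qed.

Lemma ip_ebar_ebar i j : (i < N)%N -> (j < N)%N -> ip (ebar i) (ebar j) = (i == j)%:R.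
Proof.
move=> iN jN; rewrite ip_ebar//; last exact: ebar_L2.
rewrite (@eq_Rintegral_cell R T N T_gt0 N_gt0 j _
  (((Num.sqrt (lam * k))^-1 * (i == j)%:R) *: 1)); last first.
  move=> t jt; rewrite /ebar (chi_cell T_gt0 N_gt0 i jt) hornerZ hornerC.
  by rewrite mulr1 eq_sym.
rewrite (polyintZ T_gt0 N_gt0) (_ : polyint 1 = 1); last first.
  have := polyint_quad T_gt0 N_gt0 1 0 0.
  by rewrite !scale0r !addr0 !mul0r !addr0.
have := sqr_sqrtr (ltW (mulr_gt0 lam_gt0 k_gt0)).
have := sqrt_lam_mesh_gt0 T_gt0 lam_gt0 N_gt0; set r := Num.sqrt _ => r0 rE.
set d := (_ == _)%:R.
have -> : r^-1 * (lam * (k * (r^-1 * d * 1))) = lam * k * (r^-1 * r^-1 * d) by ring.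
by rewrite -rE; field; rewrite (gt_eqF r0).
Qed.

(** [q w] is a weak derivative of a function of [Fk], hence almost everywhere piecewise constant;
    testing the orthogonality with the indicator of a cell identifies its value there. *)
Lemma projection_ebar (q : (R -> R) -> R -> R) w : orthogonal_projection T N q ->
  E T w -> E T (q w) /\
  ae_eq mu (J T) (q w) (lc N (fun i => ip w (ebar i)) ebar).
Proof.
move=> hq Ew; have [[v Fkv vqw] orth] := hq w Ew; have Lq := vqw.1.
split => //.
have [d vd] := Fk_slopes Fkv; have [Fv wv] := Fk_weak T_gt0 N_gt0 Fkv vd.
have qd := weak_derivative_unique vqw wv.
apply: filterS (qd) => t qt Jt; rewrite qt//; apply: eq_bigr => i _.
have iN := ltn_ord i; rewrite ip_ebar// /ebar.
have wq : ip w (chi i) = ip (q w) (chi i).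
  have [_ /(_ _ (chi_dFk T_gt0 N_gt0 iN))] := hq w Ew.
  have Lc : L2 T (chi i) by exact: chi_L2.
  have := ip_linl lam (-1) Lq Ew Lc; rewrite {1}/ip => H0 H1.
  move: H0; rewrite (_ : Rintegral _ _ _ = 0); last first.
    by rewrite -[RHS]H1; apply: eq_Rintegral => u _; congr (_ * _); ring.
  by rewrite mulr0 mulN1r addrC => /esym/eqP; rewrite subr_eq0 => /eqP.
have : ip (q w) (chi i) = lam * (k * d i).
  rewrite ipC /ip (ae_eq_RintegralM _ _ _ qd) //; last 2 first.
  - exact: chi_L2.
  - by apply: L2_lc => j _; exact: chi_L2.
  congr (_ * _); have -> : chi i = (fun=> 1 : R) \_ (cell i).
    by apply/funext => u; rewrite chiE.
  rewrite Rintegral_cell_restrict// (@eq_Rintegral_cell R T N T_gt0 N_gt0 i _ (d i *: 1)).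
    rewrite (polyintZ T_gt0 N_gt0) (_ : polyint 1 = 1) ?mulr1//.
    have := polyint_quad T_gt0 N_gt0 1 0 0.
    by rewrite !scale0r !addr0 !mul0r !addr0.
  by move=> u iu; rewrite mul1r (lc_cell T_gt0 N_gt0 _ iN iu) hornerZ hornerC mulr1.
rewrite -wq ip_chi// => /(mulfI (lt0r_neq0 lam_gt0)) ->.
have := sqr_sqrtr (ltW (mulr_gt0 lam_gt0 k_gt0)).
have := sqrt_lam_mesh_gt0 T_gt0 lam_gt0 N_gt0; set r := Num.sqrt _ => r0 rE.
transitivity (lam * k * (r^-1 * r^-1) * (d i * chi i t)); last by ring.
by rewrite -rE; field; rewrite (gt_eqF r0).
Qed.

Definition hat_poly (i j : nat) : {poly R} :=
  if j == i then 1 - 'X else if j == i.+1 then 'X else 0.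

Lemma hatE i j t : cell i t -> hat j t = (hat_poly i j).[(t - node i) / k].
Proof.
move=> /cellP/andP[]; rewrite /Defs.hat /hat_poly.
set x := (t - node i) / k => it ti.
have x0 : 0 < x by rewrite divr_gt0// subr_gt0.
have x1 : x < 1 by rewrite ltr_pdivrMr// mul1r ltrBlDl -nodeS.
have -> : `|t - node j| / k = `|i%:R + x - j%:R|.
  rewrite -[X in _ / X](gtr0_norm k_gt0) -normf_div; congr (`|_|).
  by rewrite /x /Defs.node; field; rewrite T_neq0 N_neq0.
have [->|ji] := eqVneq j i.
  rewrite !hornerE (_ : _ + x - _ = x); last by ring.
  by rewrite gtr0_norm// (max_idPr _)// subr_ge0 ltW.
have [->|ji1] := eqVneq j i.+1.
  rewrite hornerX -natr1 (_ : i%:R + x - (i%:R + 1) = - (1 - x)); last by ring.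
  rewrite normrN gtr0_norm ?subr_gt0// opprB addrC subrK (max_idPr _)//; exact: ltW.
rewrite horner0; apply/max_idPl; rewrite subr_le0.
move: ji; rewrite neq_ltn => /orP[ji|ij].
  have h : j.+1%:R <= i%:R :> R by rewrite ler_nat.
  by rewrite -natr1 in h; rewrite ger0_norm; lra.
have : (i.+2 <= j)%N by rewrite ltn_neqAle eq_sym ji1.
rewrite -(ler_nat R) -!natr1 => h.
by rewrite ler0_norm; lra.
Qed.

Lemma continuous_hat j : continuous (hat j).
Proof.
move=> t; apply: (@continuous_comp _ _ _ (fun t : R => 1 - `|t - node j| / k)).
  apply: cvgB; first exact: cvg_cst.
  apply: cvgM; last exact: cvg_cst.
  by apply: cvg_norm; apply: cvgB; [exact: cvg_id|exact: cvg_cst].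
exact: continuous_pospart.
Qed.

Definition hat_slope (j i : nat) : R := ((j == i.+1)%:R - (j == i)%:R) / k.

Lemma hat_slopeP j i : exists c, forall t, cell i t -> hat j t = c + hat_slope j i * t.
Proof.
have [ji|ji] := eqVneq j i.
  exists (1 + node i / k) => t it; rewrite (hatE j it) /hat_poly ji eqxx !hornerE.
  rewrite /hat_slope eqxx (_ : (i == i.+1) = false) ?ltn_eqF//.
  by rewrite mulr1n sub0r; field; rewrite T_neq0 N_neq0.
have [ji1|ji1] := eqVneq j i.+1.
  exists (- node i / k) => t it; rewrite (hatE j it) /hat_poly ji1 eqxx.
  rewrite (_ : (i.+1 == i) = false) ?gtn_eqF// hornerX /hat_slope eqxx.
  rewrite (_ : (i.+1 == i) = false) ?gtn_eqF// mulr1n subr0.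
  by field; rewrite T_neq0 N_neq0.
exists 0 => t it; rewrite (hatE j it) /hat_poly /hat_slope (negbTE ji) (negbTE ji1).
by rewrite horner0 subrr mul0r mul0r addr0.
Qed.

Lemma hat_Fk j : (j < N)%N -> Fk T N (hat j).
Proof.
move=> jN; split.
- by apply: continuous_subspaceT; exact: continuous_hat.
- by move=> [//|i] _; have [c hc] := hat_slopeP j i; exists c, (hat_slope j i).
- apply/max_idPl; rewrite subr_le0 ler_pdivlMr// mul1r.
  rewrite ger0_norm ?subr_ge0 ?(node_leT T_gt0 N_gt0) ?(ltnW jN)//.
  rewrite lerBrDl -nodeS -{2}(nodeN T N_gt0) (node_le T_gt0 N_gt0)//.
Qed.

Lemma hat_F j : (j < N)%N -> F T (hat j).
Proof. by move=> jN; exact: (Fk_F T_gt0 N_gt0 (hat_Fk jN)). Qed.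

(** The values of [b] on a trial function and the hats at the left and right end of its cell, the
    same for all cells of the uniform mesh. For [N >= 2], [theta] is [b_right / b_left]. *)
Definition b_left : R := ce * k * polyint (pr * ((k^-1)%:P + lam *: (1 - 'X))).
Definition b_right : R := ce * k * polyint (pr * ((- k^-1)%:P + lam *: 'X)).

(** Both contributions are positive: the slope term because the profile has mean 1, the mass term
    because of its pairing with [1 - X]. This makes the bidiagonal matrix of [b] invertible. *)
Lemma b_left_gt0 : 0 < b_left.
Proof.
apply: mulr_gt0; first by rewrite mulr_gt0 ?trial_scale_gt0.
rewrite (_ : pr * (_ + _) = k^-1 *: pr + lam *: (pr * (1 - 'X))); last first.
  by rewrite -!mul_polyC; ring.
rewrite (polyint_lin T_gt0 N_gt0) (polyintZ T_gt0 N_gt0).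
rewrite (polyint_trial s T_gt0 N_gt0) mulr1 addr_gt0 ?invr_gt0//.
by rewrite mulr_gt0// (polyint_trial_left s T_gt0 N_gt0).
Qed.

Lemma b_trial_hat i j : (i < N)%N -> (j < N)%N -> b T lam (trial i) (hat j) =
  if j == i then b_left else if j == i.+1 then b_right else 0.
Proof.
move=> iN jN.
have [Fh wh] := Fk_weak T_gt0 N_gt0 (hat_Fk jN) (fun i _ => hat_slopeP j i).
rewrite (b_weak lam _ Fh wh); last exact: trial_L2.
rewrite (@Rintegral_trial _ _ _ _ s T_gt0 lam_gt0 N_gt0 i _
  ((- hat_slope j i)%:P + lam *: hat_poly i j))//; last first.
  move=> t it; rewrite (lc_cell T_gt0 N_gt0 _ iN it) (hatE j it).
  by rewrite hornerD hornerC hornerZ.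
rewrite /hat_slope /hat_poly; have [->|ji] := eqVneq j i.
  rewrite (_ : (i == i.+1) = false) ?ltn_eqF// /b_left.
  by rewrite mulr1n sub0r mulNr opprK mul1r.
have [_|ji1] := eqVneq j i.+1; first by rewrite mulr1n subr0 mul1r.
by rewrite subrr mul0r oppr0 scaler0 addr0 mulr0 (polyint0 T_gt0 N_gt0) mulr0.
Qed.

(* The basis of [Fk] dual to the trial functions; it solves the bidiagonal
   system [b_left phi_i + b_right phi_(i-1) = hat_i]. *)
Fixpoint dual_hat (i : nat) : R -> R :=
  if i is j.+1 then fun t => b_left^-1 * (- b_right * dual_hat j t + hat i t)
  else fun t => b_left^-1 * hat 0 t.

Lemma Fk_scale (a : R) v : Fk T N v -> Fk T N (fun t => a * v t).
Proof.
move=> Fkv; have := Fk_lin (a - 1) Fkv Fkv.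
by congr Fk; apply/funext => t; ring.
Qed.

Lemma dual_hat_Fk i : (i < N)%N -> Fk T N (dual_hat i).
Proof.
elim: i => [|i IH] iN /=; first by apply: Fk_scale; exact: hat_Fk.
apply: Fk_scale; apply: Fk_lin; [exact: IH (ltnW iN)|exact: hat_Fk].
Qed.

Lemma dual_hat_F i : (i < N)%N -> F T (dual_hat i).
Proof. by move=> iN; exact: (Fk_F T_gt0 N_gt0 (dual_hat_Fk iN)). Qed.

Lemma b_scaler (a : R) w v : L2 T w -> F T v ->
  b T lam w (fun t => a * v t) = a * b T lam w v.
Proof.
move=> Lw Fv; have := b_linr lam (a - 1) Lw Fv Fv.
rewrite (_ : (fun t => (a - 1) * v t + v t) = fun t => a * v t) => [->|]; first by ring.
by apply/funext => t; ring.
Qed.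

Lemma b_trial_dual i j : (i < N)%N -> (j < N)%N ->
  b T lam (trial i) (dual_hat j) = (i == j)%:R.
Proof.
move=> iN; have Li := trial_L2 s T_gt0 lam_gt0 N_gt0 iN.
have bl0 := lt0r_neq0 b_left_gt0.
elim: j => [|j IH] jN /=.
  rewrite b_scaler//; last exact: hat_F.
  rewrite b_trial_hat// eq_sym; case: eqP => _; first by rewrite mulVf.
  by rewrite mulr0.
have Fd := dual_hat_F (ltnW jN); have Fh := hat_F jN.
rewrite b_scaler//; last exact: F_lin.
rewrite b_linr// IH ?(ltnW jN)// b_trial_hat//.
have [<-|ij1] := eqVneq j.+1 i.
  by rewrite gtn_eqF// mulr0 add0r mulVf// eqxx.
rewrite eqSS; have [_|_] := eqVneq i j.
  by rewrite mulr1n mulr1 addNr mulr0.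
by rewrite !mulr0 addr0 mulr0.
Qed.

End Hats.

(** * Values of the diagonal forms on trial functions *)

Section DiagonalForms.
Context {R : realType}.
Variables (T lam : R) (N : nat) (s : scheme).
Hypotheses (T_gt0 : 0 < T) (lam_gt0 : 0 < lam) (N_gt0 : (0 < N)%N).
Implicit Types (v f g h w x : R -> R) (P Q : {poly R}).
Notation mu := (@lebesgue_measure R).
Notation k := (T / N%:R).
Notation cell i := (Jn T N i.+1).
Notation ebar := (ebar T lam N).
Notation trial := (trial T lam N s).
Notation ce := (trial_scale T lam N s).
Notation pr := (@trial_poly R s).
Notation hat := (hat T N).

Lemma trace_form_ge0 w v : 0 <= trace_form T w w v v.
Proof.
by apply: Rintegral_ge0 => t _; rewrite -!expr2 mulr_ge0 ?sqr_ge0.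
Qed.

Lemma trace_formC w1 w2 v1 v2 : trace_form T w1 w2 v1 v2 = trace_form T w1 w2 v2 v1.
Proof. by apply: eq_Rintegral => t _; rewrite [v1 t * _]mulrC. Qed.

Lemma hat_diag i t : cell i t -> hat i t = (1 - 'X).[(t - node T N i) / k].
Proof. by move=> it; rewrite (hatE T_gt0 N_gt0 i it) /hat_poly eqxx. Qed.

(** In the local variable nothing depends on the cell: the right side is free of [i]. *)
Lemma trace_trial_diag i : (i < N)%N ->
  trace_form T (trial i) (trial i) (hat i) (hat i) =
  ce * k * polyint (pr * (ce *: pr * ((1 - 'X) * (1 - 'X)))).
Proof.
move=> iN; rewrite -(@Rintegral_trial _ _ _ _ s T_gt0 lam_gt0 N_gt0 i
    (fun t => trial i t * (hat i t * hat i t)))//.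
  by apply: eq_Rintegral => t _; rewrite -mulrA.
move=> t it; rewrite (trial_in s T_gt0 lam_gt0 N_gt0 iN it) hat_diag//.
by rewrite !hornerM.
Qed.

Lemma trace_ebar_diag i : (i < N)%N ->
  trace_form T (ebar i) (ebar i) (hat i) (hat i) =
  k * polyint (((Num.sqrt (lam * k))^-1 ^+ 2) *: ((1 - 'X) * (1 - 'X)) : {poly R}).
Proof.
move=> iN; set r := (Num.sqrt _)^-1.
rewrite -(@eq_Rintegral_cell R T N T_gt0 N_gt0 i
    (fun t => r * (r * (hat i t * hat i t)))); last first.
  by move=> t it; rewrite hat_diag// hornerZ hornerM expr2 -[RHS]mulrA.
rewrite (@eq_Rintegral _ _ _ mu (cell i) (fun t => 1 * (r * (r * (hat i t * hat i t)))));
  last by move=> t _; rewrite mul1r.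
rewrite -(Rintegral_cell_restrict T_gt0 N_gt0 (fun=> 1))//.
apply: eq_Rintegral => t _; rewrite /ebar !chiE !patchE -/r.
case: ifP => _; first by ring.
by rewrite (_ : point = 0 :> R)//; ring.
Qed.

(** A trial function lives on one cell, so at most one square contributes, and there the double
    integral factors. In particular the form vanishes for [i] different from [j]. *)
Lemma box_trial i j v1 v2 : (i < N)%N -> (j < N)%N -> L2 T v1 -> L2 T v2 ->
  box_form T N (trial i) (trial j) v1 v2 =
  (i == j)%:R * (k^-1 * (\int[mu]_(t in J T) (trial i t * v1 t) *
    \int[mu]_(t in J T) (trial j t * v2 t))).
Proof.
move=> iN jN L1 L2'; rewrite /box_form.
have sub (m : nat) : (m < N)%N -> forall f, mu.-integrable (J T) (EFin \o f) ->
    mu.-integrable (cell m) (EFin \o f).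
  move=> mN f; apply: integrableS => //; first exact: measurable_itv.
  exact: cell_J.
have restr m l v : (m < N)%N -> (l < N)%N ->
    \int[mu]_(t in cell m) (trial l t * v t) =
    (m == l)%:R * \int[mu]_(t in J T) (trial l t * v t).
  move=> mN lN; have [->|ml] := eqVneq m l; rewrite ?mul1r ?mul0r.
    rewrite trialE// Rintegral_cell_restrict//.
    by apply: eq_Rintegral => t tl; rewrite patchE tl.
  rewrite -[RHS](_ : \int[mu]_(t in cell m) 0 = 0); last first.
    by rewrite Rintegral_cst ?mul0r//; exact: measurable_itv.
  apply: eq_Rintegral => t; rewrite inE => mt.
  rewrite (trial_out s T_gt0 lam_gt0 N_gt0 lN) ?mul0r// => lt.
  by move/eqP: ml; apply; exact: (cell_inj T_gt0 N_gt0 mt lt).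
rewrite big_add1/= big_mkord.
transitivity (\sum_(m < N) (k^-1 * \int[mu]_(t in cell m) (trial i t * v1 t) *
    \int[mu]_(t in cell m) (trial j t * v2 t))).
  apply: eq_bigr => m _; rewrite step_mesh -mulrA; congr (_ * _).
  rewrite -Rintegral_prod; last 3 first.
  - exact: measurable_itv.
  - by apply: sub => //; apply: L2_mul => //; exact: trial_L2.
  - by apply: sub => //; apply: L2_mul => //; exact: trial_L2.
  by apply: eq_Rintegral => z _; ring.
rewrite (bigD1 (Ordinal iN))//= big1 ?addr0.
  by rewrite !restr// eqxx mulr1n mul1r; ring.
move=> m mi; rewrite (restr _ i)// (_ : (m == i :> nat) = false) ?mul0r ?mulr0 ?mul0r//.
exact/negbTE.
Qed.

End DiagonalForms.

(** * Tensor products *)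

Section BoundedLinear.
Context {R : realType} {V W : normedModType R}.
Implicit Types (f g : V -> W) (D : set V).

(** A predicate on bare functions with an explicit bound, so that composites and finite sums qualify
    without being packaged as linear maps. *)
Definition bounded_linear f : Prop :=
  (forall (a : R) u v, f (a *: u + v) = a *: f u + f v) /\
  exists K : R, 0 < K /\ forall u, `|f u| <= K * `|u|.

Lemma bounded_linearB f u v : bounded_linear f -> f (u - v) = f u - f v.
Proof.
move=> [fl _]; rewrite addrC -scaleN1r fl scaleN1r addrC//.
Qed.

Lemma bounded_linear0 f : bounded_linear f -> f 0 = 0.
Proof. by move=> fl; rewrite -(subrr 0) bounded_linearB// subrr. Qed.

Lemma bounded_linearZ f (a : R) u : bounded_linear f -> f (a *: u) = a *: f u.
Proof. by move=> fl; rewrite -[a *: u]addr0 fl.1 bounded_linear0// addr0. Qed.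

Lemma bounded_linear_sum f n (u : 'I_n -> V) : bounded_linear f ->
  f (\sum_(i < n) u i) = \sum_(i < n) f (u i).
Proof.
move=> fl; elim: n u => [|n IH] u; first by rewrite !big_ord0 bounded_linear0.
rewrite !big_ord_recr/= -IH addrC -[u ord_max]scale1r fl.1 scale1r addrC.
by rewrite scale1r.
Qed.

Lemma bounded_linear_sub f g : bounded_linear f -> bounded_linear g ->
  bounded_linear (fun u => f u - g u).
Proof.
move=> [fl [K [K0 fK]]] [gl [L [L0 gL]]]; split.
  by move=> a u v; rewrite fl gl scalerBr opprD addrACA.
exists (K + L); split; first exact: addr_gt0.
by move=> u; rewrite mulrDl (le_trans (ler_normB _ _))// lerD.
Qed.

(** The sharp constant [M] on the dense set survives; the a priori constant [K] only controls the
    error [f (u - v)], which is why the approximation radius is [e / (K + M)]. *)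
Lemma bounded_linear_dense f D (M : R) : bounded_linear f -> closure D = setT ->
  0 <= M -> (forall u, D u -> `|f u| <= M * `|u|) -> forall u, `|f u| <= M * `|u|.
Proof.
move=> fl Dd M0 fD u; apply/ler_addgt0Pr => e e0.
have [_ [K [K0 fK]]] := fl.
have KM : 0 < K + M by rewrite ltr_wpDr.
have : closure D u by rewrite Dd.
move=> /(_ (ball u (e / (K + M)))) [|v [Dv]].
  by apply: nbhsx_ballx; exact: divr_gt0.
rewrite -ball_normE /= => uv.
have -> : u = (u - v) + v by rewrite subrK.
have -> : f (u - v + v) = f (u - v) + f v.
  by have := fl.1 1 (u - v) v; rewrite !scale1r.
rewrite (le_trans (ler_normD _ _))// subrK.
have vu : `|v| <= `|u| + `|u - v|.
  by rewrite -{1}(subKr u v); exact: ler_normB.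
apply: (@le_trans _ _ (K * `|u - v| + M * (`|u| + `|u - v|))).
  by rewrite lerD ?fK// (le_trans (fD _ Dv))// ler_wpM2l.
rewrite mulrDr addrCA lerD2l -mulrDl -ler_pdivlMl// ltW//.
by rewrite mulrC.
Qed.

Lemma bounded_linear_eq_dense f g D : bounded_linear f -> bounded_linear g ->
  closure D = setT -> (forall u, D u -> f u = g u) -> f =1 g.
Proof.
move=> fl gl Dd fg u; apply/eqP; rewrite -subr_eq0 -normr_le0 -(mul0r `|u|).
apply: (bounded_linear_dense (bounded_linear_sub fl gl) Dd) => // v Dv.
by rewrite fg// subrr normr0 mul0r.
Qed.

Lemma continuous_bounded_linear (f : {linear V -> W}) : continuous f ->
  bounded_linear f.
Proof.
move=> cf; split; first by move=> a u v; rewrite linearP.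
have /linear_boundedP := continuous_linear_bounded 0 (cf 0).
move=> [M [Mr /(_ (Num.max M 0 + 1))]].
rewrite (le_lt_trans (y := Num.max M 0)) ?le_max ?lexx// ?ltrDl// => /(_ isT) fM.
exists (Num.max M 0 + 1); split => //.
by rewrite ltr_wpDl// le_max lexx orbT.
Qed.

Lemma bounded_linear_scale f (a : R) : bounded_linear f ->
  bounded_linear (fun u => a *: f u).
Proof.
move=> [fl [K [K0 fK]]]; split.
  by move=> c u v; rewrite fl scalerDr !scalerA mulrC.
exists (`|a| * K + 1); split; first by rewrite ltr_wpDl// mulr_ge0// ltW.
move=> u; rewrite normrZ mulrDl mul1r ler_wpDr// -mulrA.
exact: ler_wpM2l.
Qed.

End BoundedLinear.

Lemma bounded_linear_id {R : realType} {V : normedModType R} :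
  bounded_linear (id : V -> V).
Proof. by split=> //; exists 1; split=> // u; rewrite mul1r. Qed.

Lemma bounded_linear_comp {R : realType} {U V W : normedModType R}
    (f : V -> W) (g : U -> V) :
  bounded_linear f -> bounded_linear g -> bounded_linear (fun u => f (g u)).
Proof.
move=> [fl [K [K0 fK]]] [gl [L [L0 gL]]]; split.
  by move=> a u v; rewrite gl fl.
exists (K * L); split; first exact: mulr_gt0.
by move=> u; rewrite (le_trans (fK _))// -mulrA ler_wpM2l// ltW.
Qed.

(** * Formal sums and the projective norm *)

Section TensorBasics.
Context {R : realType}.
Variables (X : set (R -> R)) (nX : (R -> R) -> R).
Hypotheses (X_lin : forall (a : R) x y, X x -> X y -> X (fun t => a * x t + y t))
  (X0 : X (fun=> 0)) (nX_ge0 : forall x, 0 <= nX x).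
Implicit Types (x y z : R -> R).

Lemma X_lc m (a : nat -> R) g : (forall i, (i < m)%N -> X (g i)) -> X (lc m a g).
Proof.
elim: m => [|m IH] Xg; first by rewrite lc0.
by rewrite lcS; apply: X_lin; [exact: Xg|apply: IH => i im; exact/Xg/ltnW].
Qed.

Section Bilinear.
Variables (V : lmodType R) (tens : (R -> R) -> (R -> R) -> V).
Hypothesis bil : bilinear_on X tens.

Lemma tens0l z : X z -> tens (fun=> 0) z = 0.
Proof.
move=> Xz; have [+ _] := bil (-1) X0 X0 Xz.
rewrite (_ : (fun _ => _) = fun=> 0); last by apply/funext => t; rewrite mulr0 addr0.
by rewrite scaleN1r addNr.
Qed.

Lemma tens0r z : X z -> tens z (fun=> 0) = 0.
Proof.
move=> Xz; have [_] := bil (-1) X0 X0 Xz.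
rewrite (_ : (fun _ => _) = fun=> 0); last by apply/funext => t; rewrite mulr0 addr0.
by rewrite scaleN1r addNr.
Qed.

Lemma tens_lcl m (a : nat -> R) g z : (forall i, (i < m)%N -> X (g i)) -> X z ->
  tens (lc m a g) z = \sum_(i < m) a i *: tens (g i) z.
Proof.
elim: m => [|m IH] Xg Xz; first by rewrite lc0 big_ord0 tens0l.
have Xg' i : (i < m)%N -> X (g i) by move=> im; exact/Xg/ltnW.
rewrite lcS (bil _ _ _ Xz).1; [|exact: Xg|exact: X_lc].
by rewrite IH// big_ord_recr/= addrC.
Qed.

Lemma tens_lcr m (a : nat -> R) g z : (forall i, (i < m)%N -> X (g i)) -> X z ->
  tens z (lc m a g) = \sum_(i < m) a i *: tens z (g i).
Proof.
elim: m => [|m IH] Xg Xz; first by rewrite lc0 big_ord0 tens0r.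
have Xg' i : (i < m)%N -> X (g i) by move=> im; exact/Xg/ltnW.
rewrite lcS (bil _ _ _ Xz).2; [|exact: Xg|exact: X_lc].
by rewrite IH// big_ord_recr/= addrC.
Qed.

Lemma tens_lc m (a c : nat -> R) g : (forall i, (i < m)%N -> X (g i)) ->
  tens (lc m a g) (lc m c g) =
  \sum_(i < m) \sum_(j < m) (a i * c j) *: tens (g i) (g j).
Proof.
move=> Xg; rewrite tens_lcl//; last exact: X_lc.
apply: eq_bigr => i _; rewrite tens_lcr//; last exact: Xg.
by rewrite scaler_sumr; apply: eq_bigr => j _; rewrite scalerA.
Qed.

Lemma tens_scalel (a : R) x y : X x -> X y ->
  tens (fun t => a * x t) y = a *: tens x y.
Proof.
move=> Xx Xy; have [+ _] := bil a Xx X0 Xy; rewrite tens0l// addr0 => <-.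
by congr tens; apply/funext => t; rewrite addr0.
Qed.

Lemma tensor_span_add (A : set (R -> R)) u v :
  tensor_span tens A u -> tensor_span tens A v -> tensor_span tens A (u + v).
Proof.
move=> [n [x [y [Axy ->]]]] [m [x' [y' [Axy' ->]]]].
pose g (h : 'I_n -> R -> R) (h' : 'I_m -> R -> R) (i : 'I_(n + m)) :=
  match fintype.split i with inl j => h j | inr j => h' j end.
exists (n + m)%N, (g x x'), (g y y'); split.
  by move=> i; rewrite /g; case: (fintype.split i).
rewrite big_split_ord/=; congr (_ + _); apply: eq_bigr => i _; rewrite /g.
  by rewrite (fintype.unsplitK (inl i)).
by rewrite (fintype.unsplitK (inr i)).
Qed.

Lemma tensor_span_sum (A : set (R -> R)) n (u : 'I_n -> V) :
  (forall i, tensor_span tens A (u i)) -> tensor_span tens A (\sum_(i < n) u i).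
Proof.
elim: n u => [|n IH] u Au.
  exists 0%N, (fun=> fun=> 0), (fun=> fun=> 0); split; first by case.
  by rewrite !big_ord0.
by rewrite big_ord_recr/=; apply: tensor_span_add => //; exact: IH.
Qed.

Lemma tensor_span_scale (A : set (R -> R)) (a : R) u : A `<=` X ->
  (forall x, A x -> A (fun t => a * x t)) ->
  tensor_span tens A u -> tensor_span tens A (a *: u).
Proof.
move=> AX Aa [n [x [y [Axy ->]]]].
exists n, (fun i t => a * x i t), y; split.
  by move=> i; split; [apply: Aa|]; case: (Axy i).
rewrite scaler_sumr; apply: eq_bigr => i _.
by rewrite tens_scalel//; apply: AX; case: (Axy i).
Qed.

Lemma tensor_span1 (A : set (R -> R)) x y : A x -> A y -> tensor_span tens A (tens x y).
Proof. by move=> Ax Ay; exists 1%N, (fun=> x), (fun=> y); rewrite big_ord1. Qed.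

Lemma sym_tensor_span_sub (A : set (R -> R)) :
  sym_tensor_span tens A `<=` tensor_span tens A.
Proof. by move=> u [n [x [y [Axy -> _]]]]; exists n, x, y. Qed.

Lemma sym_tensor_span_add (A : set (R -> R)) u v :
  sym_tensor_span tens A u -> sym_tensor_span tens A v ->
  sym_tensor_span tens A (u + v).
Proof.
move=> [n [x [y [Axy ux uy]]]] [m [x' [y' [Axy' vx vy]]]].
pose g (h : 'I_n -> R -> R) (h' : 'I_m -> R -> R) (i : 'I_(n + m)) :=
  match fintype.split i with inl j => h j | inr j => h' j end.
have gl h h' i : g h h' (lshift m i) = h i by rewrite /g (fintype.unsplitK (inl i)).
have gr h h' i : g h h' (rshift n i) = h' i by rewrite /g (fintype.unsplitK (inr i)).
exists (n + m)%N, (g x x'), (g y y'); split.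
- by move=> i; rewrite /g; case: (fintype.split i).
- rewrite big_split_ord/= ux vx; congr (_ + _); apply: eq_bigr => i _.
    by rewrite !gl.
  by rewrite !gr.
- rewrite big_split_ord/= uy vy; congr (_ + _); apply: eq_bigr => i _.
    by rewrite !gl.
  by rewrite !gr.
Qed.

Lemma sym_tensor_span_scale (A : set (R -> R)) (a : R) u : A `<=` X ->
  (forall x, A x -> A (fun t => a * x t)) ->
  sym_tensor_span tens A u -> sym_tensor_span tens A (a *: u).
Proof.
move=> AX Aa [n [x [y [Axy ux uy]]]].
exists n, (fun i t => a * x i t), y; split.
- by move=> i; split; [apply: Aa|]; case: (Axy i).
- rewrite ux scaler_sumr; apply: eq_bigr => i _.
  by rewrite tens_scalel//; apply: AX; case: (Axy i).
- rewrite uy scaler_sumr; apply: eq_bigr => i _.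
  have [Ax Ay] := Axy i; have [_] := bil a (AX _ Ax) X0 (AX _ Ay).
  rewrite tens0r ?addr0; last exact: AX.
  by move=> <-; congr tens; apply/funext => t; rewrite addr0.
Qed.

(** [sym_tensor_span] asks for a single formal sum with the same value when all pairs are reversed;
    listing the pairs together with their reversals provides one. *)
Lemma sym_tensor_span_transpose (A : set (R -> R)) n (x y : 'I_n -> R -> R) :
  (forall i, A (x i) /\ A (y i)) ->
  sym_tensor_span tens A
    (\sum_(i < n) tens (x i) (y i) + \sum_(i < n) tens (y i) (x i)).
Proof.
move=> Axy.
pose g (h h' : 'I_n -> R -> R) (i : 'I_(n + n)) :=
  match fintype.split i with inl j => h j | inr j => h' j end.
have gl h h' i : g h h' (lshift n i) = h i by rewrite /g (fintype.unsplitK (inl i)).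
have gr h h' i : g h h' (rshift n i) = h' i by rewrite /g (fintype.unsplitK (inr i)).
exists (n + n)%N, (g x y), (g y x); split.
- by move=> i; rewrite /g; case: (fintype.split i) => j; have [] := Axy j.
- by rewrite big_split_ord/=; congr (_ + _); apply: eq_bigr => i _; rewrite ?gl ?gr.
- rewrite big_split_ord/= addrC; congr (_ + _); apply: eq_bigr => i _; by rewrite ?gl ?gr.
Qed.

End Bilinear.

Section Projective.
Variables (V : completeNormedModType R) (tens : (R -> R) -> (R -> R) -> V).
Hypothesis hV : projective_tensor X nX tens.

Lemma projective_bilinear : bilinear_on X tens. Proof. by case: hV. Qed.
Let bil := projective_bilinear.

Lemma projective_norm_le n (x y : 'I_n -> R -> R) m (x' y' : 'I_m -> R -> R) :
  (forall i, X (x i) /\ X (y i)) -> (forall i, X (x' i) /\ X (y' i)) ->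
  same_tensor X nX x y x' y' ->
  `|\sum_(i < n) tens (x i) (y i)| <= \sum_(j < m) nX (x' j) * nX (y' j).
Proof.
move=> Xxy Xxy' st; have [_ -> // _] := hV; apply: ge_inf.
  exists 0 => _ [l [u [v [_ _ ->]]]].
  by apply: sumr_ge0 => i _; rewrite mulr_ge0.
by exists m, x', y'.
Qed.

Lemma projective_norm_ge n (x y : 'I_n -> R -> R) (M : R) :
  (forall i, X (x i) /\ X (y i)) ->
  (forall m (x' y' : 'I_m -> R -> R), (forall i, X (x' i) /\ X (y' i)) ->
    same_tensor X nX x y x' y' -> M <= \sum_(j < m) nX (x' j) * nX (y' j)) ->
  M <= `|\sum_(i < n) tens (x i) (y i)|.
Proof.
move=> Xxy H; have [_ -> // _] := hV; apply: lb_le_inf.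
  by exists (\sum_(j < n) nX (x j) * nX (y j)), n, x, y.
by move=> _ [m [x' [y' [Xxy' st ->]]]]; exact: H.
Qed.

Lemma projective_tens_le x y : X x -> X y -> `|tens x y| <= nX x * nX y.
Proof.
move=> Xx Xy; have := @projective_norm_le 1 (fun=> x) (fun=> y) 1 (fun=> x) (fun=> y).
by rewrite !big_ord1; apply.
Qed.

Lemma projective_tens_null x y : X x -> X y -> nX x = 0 ->
  tens x y = 0 /\ tens y x = 0.
Proof.
move=> Xx Xy x0; split; apply/eqP; rewrite -normr_le0.
  by rewrite (le_trans (projective_tens_le Xx Xy))// x0 mul0r.
by rewrite (le_trans (projective_tens_le Xy Xx))// x0 mulr0.
Qed.

Lemma projective_tens_congr x x' y y' : X x -> X x' -> X y -> X y' ->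
  nX (fun t => -1 * x' t + x t) = 0 -> nX (fun t => -1 * y' t + y t) = 0 ->
  tens x y = tens x' y'.
Proof.
move=> Xx Xx' Xy Xy' xx yy.
have [+ _] := bil (-1) Xx' Xx Xy.
rewrite (projective_tens_null (X_lin _ Xx' Xx) Xy xx).1 scaleN1r addrC.
move=> /esym/eqP; rewrite subr_eq0 => /eqP ->.
have [_ +] := bil (-1) Xy' Xy Xx'.
rewrite (projective_tens_null (X_lin _ Xy' Xy) Xx' yy).2 scaleN1r addrC.
by move=> /esym/eqP; rewrite subr_eq0 => /eqP ->.
Qed.

(** Applying [r] to a representation gives a representation of the image that costs no more. The two
    images are the same tensor because [phi (r u) (r v)] is again a bilinear form on the quotient,
    [r] being linear and preserving null functions. *)
Lemma projective_contraction (r : (R -> R) -> R -> R) n (x y : 'I_n -> R -> R) :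
  (forall x, X x -> X (r x)) ->
  (forall (a : R) x y, X x -> X y ->
    r (fun t => a * x t + y t) = fun t => a * r x t + r y t) ->
  (forall x, X x -> nX (r x) <= nX x) ->
  (forall i, X (x i) /\ X (y i)) ->
  `|\sum_(i < n) tens (r (x i)) (r (y i))| <= `|\sum_(i < n) tens (x i) (y i)|.
Proof.
move=> Xr rl rn Xxy; apply: projective_norm_ge => // m x' y' Xxy' st.
apply: (@le_trans _ _ (\sum_(j < m) nX (r (x' j)) * nX (r (y' j)))).
  apply: projective_norm_le.
  - by move=> i; have [? ?] := Xxy i; split; exact: Xr.
  - by move=> i; have [? ?] := Xxy' i; split; exact: Xr.
  move=> phi [phil phi0]; apply: (st (fun u v => phi (r u) (r v))); split.
    move=> a u v w Xu Xv Xw; rewrite rl//.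
    exact: (phil a _ _ _ (Xr _ Xu) (Xr _ Xv) (Xr _ Xw)).
  move=> u v Xu Xv u0; apply: phi0; [exact: Xr..|].
  by apply/eqP; rewrite eq_le nX_ge0 andbT -u0 rn.
by apply: ler_sum => i _; have [? ?] := Xxy' i; rewrite ler_pM// rn.
Qed.

(** The cost of a representation is symmetric in the factors, and transposing a bilinear form gives
    a bilinear form. *)
Lemma projective_transpose n (x y : 'I_n -> R -> R) :
  (forall i, X (x i) /\ X (y i)) ->
  `|\sum_(i < n) tens (y i) (x i)| <= `|\sum_(i < n) tens (x i) (y i)|.
Proof.
move=> Xxy; apply: projective_norm_ge => // m x' y' Xxy' st.
apply: (@le_trans _ _ (\sum_(j < m) nX (y' j) * nX (x' j))); last first.
  by apply: ler_sum => i _; rewrite mulrC.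
apply: projective_norm_le.
- by move=> i; have [? ?] := Xxy i.
- by move=> i; have [? ?] := Xxy' i.
move=> phi [phil phi0]; apply: (st (fun u v => phi v u)); split.
  by move=> a u v w Xu Xv Xw; have [? ?] := phil a _ _ _ Xu Xv Xw.
by move=> u v Xu Xv u0; have [] := phi0 _ _ Xu Xv u0.
Qed.

Lemma projective_dense : closure (tensor_span tens X) = setT.
Proof. by case: hV. Qed.

End Projective.

Lemma injective_tens_le (V : completeNormedModType R)
    (tens : (R -> R) -> (R -> R) -> V) x y :
  injective_tensor X nX tens -> X x -> X y -> `|tens x y| <= nX x * nX y.
Proof.
move=> [_ hn _] Xx Xy; have := hn 1%N (fun=> x) (fun=> y) (fun=> conj Xx Xy).
rewrite big_ord1 => ->; apply: ge_sup.
  exists 0, (fun=> 0), (fun=> 0); split; [split..|].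
  - by move=> a u v _ _; rewrite mulr0 addr0.
  - by move=> u Xu; rewrite normr0.
  - by move=> a u v _ _; rewrite mulr0 addr0.
  - by move=> u Xu; rewrite normr0.
  - by rewrite big_ord1 mul0r normr0.
move=> _ [phi [psi [[_ phin] [_ psin] ->]]].
by rewrite big_ord1 normrM ler_pM// ?phin// psin.
Qed.

End TensorBasics.

(** * Operators on the projective tensor product built from [B] *)

Section Operators.
Context {R : realType}.
Variables (T lam : R).
Hypotheses (T_gt0 : 0 < T) (lam_gt0 : 0 < lam).
Variables (Epi Feps : completeNormedModType R).
Variables (tE : (R -> R) -> (R -> R) -> Epi) (tF : (R -> R) -> (R -> R) -> Feps).
Hypotheses (hEpi : projective_tensor (E T) (normE T lam) tE)
  (hFeps : injective_tensor (F T) (normF T lam) tF).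
Notation ip := (ip T lam).
Notation nE := (normE T lam).

Lemma bilinear_bound (Phi : {bilinear Epi -> Feps -> R^o}) :
  continuous (fun p : Epi * Feps => Phi p.1 p.2) ->
  exists M : R, 0 < M /\ forall u v, `|Phi u v| <= M * `|u| * `|v|.
Proof.
move=> /bilinear_schwarz[M M0 PM]; exists M; split => // u v; exact: PM.
Qed.

Lemma bilinear_bounded_linear (Phi : {bilinear Epi -> Feps -> R^o}) v :
  continuous (fun p : Epi * Feps => Phi p.1 p.2) ->
  bounded_linear (fun u => Phi u v : R^o).
Proof.
move=> /bilinear_bound[M [M0 PM]]; split.
  by move=> a x y; rewrite linearPl.
exists (M * (`|v| + 1)); split; first by rewrite mulr_gt0// ltr_wpDl.
move=> u; rewrite (le_trans (PM u v))// mulrAC ler_wpM2r// ler_wpM2l ?ltW//.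
by rewrite ltrDl.
Qed.

Let E_lin (a : R) x y : E T x -> E T y -> E T (fun t => a * x t + y t).
Proof. exact: L2_lin. Qed.

Let E0 : E T (fun=> 0). Proof. exact: L2_cst. Qed.

Let nE_ge0 x : 0 <= nE x. Proof. exact: normE_ge0. Qed.

Let bilE := projective_bilinear hEpi.

Lemma normE_sub_ae x y : E T x -> E T y -> ae_eq (@lebesgue_measure R) (J T) x y ->
  nE (fun t => -1 * y t + x t) = 0.
Proof.
move=> Ex Ey xy; apply/eqP; rewrite normE_eq0//; apply/eqP.
have Ed : E T (fun t => -1 * y t + x t) by exact: L2_lin.
rewrite /ip (@ae_eq_RintegralM R T _ _ (fun=> 0) Ed Ed (L2_cst T 0)).
  by have := ip0l T lam (fun t => -1 * y t + x t); rewrite ipC.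
by apply: filterS xy => t xt Jt; rewrite xt// mulN1r addNr.
Qed.

Lemma tens_ae x x' y y' : E T x -> E T x' -> E T y -> E T y' ->
  ae_eq (@lebesgue_measure R) (J T) x x' -> ae_eq (@lebesgue_measure R) (J T) y y' ->
  tE x y = tE x' y'.
Proof.
move=> Ex Ex' Ey Ey' xx yy.
by apply: (projective_tens_congr E_lin nE_ge0 hEpi) => //; exact: normE_sub_ae.
Qed.

Lemma span_eq (V' : normedModType R) (f g : Epi -> V') :
  bounded_linear f -> bounded_linear g ->
  (forall x y, E T x -> E T y -> f (tE x y) = g (tE x y)) -> f =1 g.
Proof.
move=> fl gl fg; apply: (bounded_linear_eq_dense fl gl (projective_dense hEpi)).
move=> u [n [x [y [Exy ->]]]]; rewrite !bounded_linear_sum//.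
by apply: eq_bigr => i _; have [? ?] := Exy i; exact: fg.
Qed.

Section WithB.
Variable B : {bilinear Epi -> Feps -> R^o}.
Hypothesis hB : extends_form T tE tF
  (fun w1 w2 v1 v2 => b T lam w1 v1 * b T lam w2 v2) B.

Let cB := hB.1.

(** On [w (x) w] and [v (x) v] the form [B] takes the value [b(w, v)^2], so the square root of its
    bound is a bound for [b]. *)
Lemma b_bounded : exists M : R, 0 < M /\ forall w v, E T w -> F T v ->
  `|b T lam w v| <= M * (nE w * normF T lam v).
Proof.
have [M [M0 BM]] := bilinear_bound cB.
exists (Num.sqrt M); split; first by rewrite sqrtr_gt0.
move=> w v Ew Fv.
rewrite -(@ler_pXn2r _ 2)// ?nnegrE ?mulr_ge0 ?sqrtr_ge0//.
rewrite exprMn sqr_sqrtr ?(ltW M0)// -normrX expr2 -hB.2//.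
rewrite (le_trans (BM _ _))// -mulrA ler_wpM2l ?(ltW M0)// exprMn ler_pM//.
  by rewrite expr2; exact: (projective_tens_le nE_ge0 hEpi).
by rewrite expr2; apply: (injective_tens_le _ hFeps) => // x; exact: sqrtr_ge0.
Qed.

(** The tensor square of [w |-> sum_i b(w, psi i) g i]. Reading the coefficients off [B] defines it
    on the whole completion and makes it bounded at once. *)
Definition tensor_op (m : nat) (psi g : nat -> R -> R) (u : Epi) : Epi :=
  \sum_(i < m) \sum_(j < m) B u (tF (psi i) (psi j)) *: tE (g i) (g j).

Lemma tensor_op_bounded m psi g : bounded_linear (tensor_op m psi g).
Proof.
split.
  move=> a u v; rewrite /tensor_op scaler_sumr -big_split; apply: eq_bigr => i _.
  rewrite scaler_sumr -big_split; apply: eq_bigr => j _.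
  by rewrite linearPl scalerDl scalerA.
have [M [M0 BM]] := bilinear_bound cB.
(* The summand 1 keeps the bound positive when all the tensors vanish. *)
exists (M * \sum_(i < m) \sum_(j < m) `|tF (psi i) (psi j)| * `|tE (g i) (g j)| + 1).
have S0 : 0 <= M * \sum_(i < m) \sum_(j < m) `|tF (psi i) (psi j)| * `|tE (g i) (g j)|.
  apply: mulr_ge0; first exact: ltW.
  by apply: sumr_ge0 => i _; apply: sumr_ge0 => j _; exact: mulr_ge0.
split; first by rewrite ltr_wpDl.
move=> u; rewrite mulrDl mul1r ler_wpDr//.
rewrite -mulrA mulr_suml mulr_sumr (le_trans (ler_norm_sum _ _ _))//.
apply: ler_sum => i _; rewrite mulr_suml mulr_sumr.
rewrite (le_trans (ler_norm_sum _ _ _))//; apply: ler_sum => j _.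
rewrite normrZ (le_trans (ler_wpM2r _ (BM _ _)))//.
by rewrite le_eqVlt; apply/orP; left; apply/eqP; ring.
Qed.

Lemma tensor_op_tens m psi g x y : (forall i, (i < m)%N -> F T (psi i)) ->
  (forall i, (i < m)%N -> E T (g i)) -> E T x -> E T y ->
  tensor_op m psi g (tE x y) =
  tE (lc m (fun i => b T lam x (psi i)) g) (lc m (fun i => b T lam y (psi i)) g).
Proof.
move=> Fpsi Eg Ex Ey; rewrite (tens_lc E_lin E0 bilE)//.
apply: eq_bigr => i _; apply: eq_bigr => j _.
by rewrite hB.2//; exact: Fpsi.
Qed.

(* [psi] represents an orthonormal system [f] of [E] through [b], so that
   [tensor_op] is the tensor square of a contraction of [E]. *)
Lemma tensor_op_contraction m psi f g : (forall i, (i < m)%N -> F T (psi i)) ->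
  (forall i, (i < m)%N -> E T (f i)) -> (forall i, (i < m)%N -> E T (g i)) ->
  (forall i w, (i < m)%N -> E T w -> b T lam w (psi i) = ip w (f i)) ->
  (forall i j, (i < m)%N -> (j < m)%N -> ip (f i) (f j) = (i == j)%:R) ->
  (forall i j, (i < m)%N -> (j < m)%N -> ip (g i) (g j) = (i == j)%:R) ->
  forall u, `|tensor_op m psi g u| <= `|u|.
Proof.
move=> Fpsi Ef Eg bpsi of_ og u; rewrite -[leRHS]mul1r.
apply: (bounded_linear_dense (tensor_op_bounded m psi g) (projective_dense hEpi)) => //.
move=> _ [n [x [y [Exy ->]]]]; rewrite mul1r.
rewrite (bounded_linear_sum _ (tensor_op_bounded m psi g)).
pose r w := lc m (fun i => b T lam w (psi i)) g.
have rE w : E T w -> r w = lc m (fun i => ip w (f i)) g.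
  by move=> Ew; apply/funext => t; apply: eq_bigr => i _; rewrite bpsi.
rewrite (eq_bigr (fun i => tE (r (x i)) (r (y i)))); last first.
  by move=> i _; have [? ?] := Exy i; exact: tensor_op_tens.
apply: (projective_contraction nE_ge0 hEpi) => //.
- by move=> w Ew; apply: L2_lc.
- move=> a v w Ev Ew; apply/funext => t; rewrite /r /lc mulr_sumr -big_split.
  apply: eq_bigr => i _ /=; rewrite b_linl//; last exact: Fpsi.
  by rewrite mulrDl mulrA.
- by move=> w Ew; rewrite rE//; exact: bessel.
Qed.

(** The double sum is collected as [sum_i g i (x) (sum_j c_ij g j)]; symmetry of the coefficients
    [c_ij] allows it to be collected the other way round. *)
Lemma tensor_op_sym m psi g u : (forall i, (i < m)%N -> E T (g i)) ->
  (forall i j, (i < m)%N -> (j < m)%N ->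
    B u (tF (psi i) (psi j)) = B u (tF (psi j) (psi i))) ->
  exists n (x y : 'I_n -> R -> R), [/\ forall i, E T (x i) /\ E T (y i),
    tensor_op m psi g u = \sum_(i < n) tE (x i) (y i) &
    tensor_op m psi g u = \sum_(i < n) tE (y i) (x i)].
Proof.
move=> Eg Bsym.
exists m, (fun i => g i), (fun i => lc m (fun j => B u (tF (psi i) (psi j))) g).
split.
- by move=> i; split; [exact: Eg|apply: L2_lc].
- by apply: eq_bigr => i _; rewrite (tens_lcr E_lin E0 bilE)//; exact: Eg.
- rewrite /tensor_op exchange_big; apply: eq_bigr => i _.
  rewrite (tens_lcl E_lin E0 bilE)//; last exact: Eg.
  by apply: eq_bigr => j _; rewrite Bsym.
Qed.

(* The transposition is an isometry of the algebraic tensor product; it is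
   compared with [U] through [P U], where [P] is the tensor square of the
   orthogonal projection onto the span of a tensor close to [U]. *)
Lemma symmetric_distance U n (x y : 'I_n -> R -> R) :
  (forall v1 v2, F T v1 -> F T v2 -> B U (tF v1 v2) = B U (tF v2 v1)) ->
  (forall i, E T (x i) /\ E T (y i)) ->
  `|U - \sum_(i < n) tE (y i) (x i)| <= `|U - \sum_(i < n) tE (x i) (y i)|.
Proof.
move=> Usym Exy; apply/ler_addgt0Pr => e e0.
have : closure (tensor_span tE (E T)) U by rewrite (projective_dense hEpi).
(* [P] will fix [u] and be a contraction, so [|U - P U| <= 2 |U - u|]. This error is paid twice,
   whence [e / 4]. *)
move=> /(_ (ball U (e / 4))) [|u [Du]].
  by apply: nbhsx_ballx; exact: divr_gt0.
rewrite -ball_normE /= => Uu.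
have [l [p [q [Epq uE]]]] := Du.
(* All factors of [u], left ones before right ones, as one family on [nat]; beyond [l + l] the value
   0 is a default. *)
pose xs i := if @idP (i < l + l)%N is ReflectT h
  then match fintype.split (Ordinal h) with inl j => p j | inr j => q j end
  else fun=> 0.
have xsl (j : 'I_l) : xs (lshift l j) = p j.
  rewrite /xs; case: {-}_ / idP => [h|]; last by case; exact: (ltn_ord (lshift l j)).
  by rewrite (_ : Ordinal h = lshift l j) ?(fintype.unsplitK (inl j))//; exact: val_inj.
have xsr (j : 'I_l) : xs (rshift l j) = q j.
  rewrite /xs; case: {-}_ / idP => [h|]; last by case; exact: (ltn_ord (rshift l j)).
  by rewrite (_ : Ordinal h = rshift l j) ?(fintype.unsplitK (inr j))//; exact: val_inj.
have Lxs i : (i < l + l)%N -> L2 T (xs i).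
  move=> il; rewrite /xs; case: {-}_ / idP => [h|//].
  by case: (fintype.split _) => j; case: (Epq j).
have [m [f [Lf of_ fx]]] := gram_schmidt lam_gt0 Lxs.
have [psi [Fpsi bpsi]] := b_representation T_gt0 lam_gt0 Lf.
pose P := tensor_op m psi f.
have Pl : bounded_linear P by exact: tensor_op_bounded.
have Pc v : `|P v| <= `|v| by exact: (tensor_op_contraction Fpsi Lf Lf bpsi of_ of_).
have proj k : (k < l + l)%N -> nE (fun t => -1 * lc m (fun i => b T lam (xs k) (psi i)) f t + xs k t) = 0.
  move=> kl; rewrite -[RHS](fx k kl); congr normE; apply/funext => t.
  by congr (_ * _ + _); apply: eq_bigr => i _; rewrite bpsi//; exact: Lxs.
have Pu : P u = u.
  rewrite uE bounded_linear_sum//; apply: eq_bigr => j _; have [Ep Eq] := Epq j.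
  rewrite /P tensor_op_tens//.
  apply/esym/(projective_tens_congr E_lin nE_ge0 hEpi) => //; try exact: L2_lc.
    by rewrite -xsl; apply: proj; exact: ltn_ord.
  by rewrite -xsr; apply: proj; exact: ltn_ord.
have UP : `|U - P U| <= e / 2.
  have -> : U - P U = (U - u) + P (u - U).
    by rewrite bounded_linearB// Pu addrA subrK.
  rewrite (le_trans (ler_normD _ _))// [leRHS](_ : _ = e / 4 + e / 4); last by field.
  by rewrite lerD ?(ltW Uu)// (le_trans (Pc _))// distrC ltW.
(* Unlike [U], [P U] is a finite sum, and the symmetry of [B U] on the [psi i] makes it equal to its
   own transpose. *)
have [|l' [x' [y' [Exy' PU1 PU2]]]] := @tensor_op_sym m psi f U Lf.
  by move=> i j im jm; apply: Usym; exact: Fpsi.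
rewrite -/P in PU1 PU2.
pose tg (h : 'I_l' -> R -> R) (h' : 'I_n -> R -> R) (i : 'I_(l' + n)) :=
  match fintype.split i with inl j => h j | inr j => h' j end.
have tgl h h' i : tg h h' (lshift n i) = h i by rewrite /tg (fintype.unsplitK (inl i)).
have tgr h h' i : tg h h' (rshift l' i) = h' i by rewrite /tg (fintype.unsplitK (inr i)).
have neg w z : E T w -> E T z -> tE (fun t => -1 * w t) z = - tE w z.
  by move=> Ew Ez; rewrite (tens_scalel E0 bilE)// scaleN1r.
have negr w z : E T w -> E T z -> tE z (fun t => -1 * w t) = - tE z w.
  move=> Ew Ez; have [_] := bilE (-1) Ew E0 Ez.
  rewrite (tens0r E0 bilE)// addr0 scaleN1r => <-.
  by congr tE; apply/funext => t; rewrite addr0.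
(* The two differences become formal sums that are transposes of each other; the minus sign is put
   on the factor [x] in both. *)
pose X := tg x' (fun i t => -1 * x i t); pose Y := tg y' y.
have Exx i : E T (fun t => -1 * x i t) by apply: L2_scale; case: (Exy i).
have EXY i : E T (X i) /\ E T (Y i).
  by rewrite /X /Y /tg; case: (fintype.split i) => j; [exact: Exy'|split => //; case: (Exy j)].
have D1 : P U - \sum_(i < n) tE (x i) (y i) = \sum_(i < l' + n) tE (X i) (Y i).
  rewrite PU1 big_split_ord/= -sumrN; congr (_ + _); apply: eq_bigr => i _.
    by rewrite /X /Y !tgl.
  by rewrite /X /Y !tgr neg//; case: (Exy i).
have D2 : P U - \sum_(i < n) tE (y i) (x i) = \sum_(i < l' + n) tE (Y i) (X i).
  rewrite PU2 big_split_ord/= -sumrN; congr (_ + _); apply: eq_bigr => i _.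
    by rewrite /X /Y !tgl.
  by rewrite /X /Y !tgr negr//; case: (Exy i).
have D12 : `|P U - \sum_(i < n) tE (y i) (x i)| <= `|P U - \sum_(i < n) tE (x i) (y i)|.
  by rewrite D1 D2; exact: (projective_transpose nE_ge0 hEpi).
set w := \sum_(i < n) tE (x i) (y i) in D1 D12 *.
set wt := \sum_(i < n) tE (y i) (x i) in D2 D12 *.
apply: (@le_trans _ _ (`|U - P U| + `|P U - wt|)).
  by rewrite -[X in `|X|](subrKA (P U)) ler_normD.
apply: (@le_trans _ _ (e / 2 + (`|U - P U| + `|U - w|))).
  rewrite lerD// (le_trans D12)// distrC -[X in `|X|](subrKA U).
  by rewrite (le_trans (ler_normD _ _))// addrC distrC lerD2l distrC.
by move: UP; lra.
Qed.

End WithB.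
End Operators.

(** * Positivity of the stability constant *)

Section StabilityConstant.
Context {R : realType}.
Variables (T lam rho : R) (N : nat) (s : scheme).
Hypotheses (T_gt0 : 0 < T) (lam_gt0 : 0 < lam) (N_gt0 : (0 < N)%N).
Variables (Epi Feps : completeNormedModType R).
Variables (tE : (R -> R) -> (R -> R) -> Epi) (tF : (R -> R) -> (R -> R) -> Feps).
Hypotheses (hEpi : projective_tensor (E T) (normE T lam) tE)
  (hFeps : injective_tensor (F T) (normF T lam) tF).
Variables (B Delta box : {bilinear Epi -> Feps -> R^o}).
Hypotheses (hB : extends_form T tE tF
    (fun w1 w2 v1 v2 => b T lam w1 v1 * b T lam w2 v2) B)
  (hDelta : extends_form T tE tF (trace_form T) Delta)
  (hbox : extends_form T tE tF (box_form T N) box).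
Variables (q : (R -> R) -> R -> R) (hq : orthogonal_projection T N q).
Variables (Q : {linear Epi -> Epi}) (hQ : extends_map T tE q Q).
Notation ip := (ip T lam).
Notation nE := (normE T lam).
Notation nF := (normF T lam).
Notation trial := (trial T lam N s).
Notation ebar := (ebar T lam N).
Notation hat := (hat T N).
Notation dual_hat := (dual_hat T lam N s).
Notation kappa := (@kappa R s).
Notation Dk := (Deltak s Delta box Q).
Notation Ek := (Ek T lam N s).

Let E_lin (a : R) x y : E T x -> E T y -> E T (fun t => a * x t + y t).
Proof. exact: L2_lin. Qed.
Let E0 : E T (fun=> 0). Proof. exact: L2_cst. Qed.
Let bilE : bilinear_on (E T) tE := projective_bilinear hEpi.
Let bilF : bilinear_on (F T) tF. Proof. by case: hFeps. Qed.
Let trial_E i : (i < N)%N -> E T (trial i).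
Proof. exact: trial_L2. Qed.
Let ebar_E i : E T (ebar i). Proof. exact: ebar_L2. Qed.

Lemma EkP w : Ek w <-> exists a, w = lc N a trial.
Proof.
split=> [[c ->]|[a ->]].
  by exists (fun i => c i.+1); apply/funext => t; rewrite big_add1 big_mkord.
by exists (fun n => a n.-1); apply/funext => t; rewrite big_add1 big_mkord.
Qed.

Lemma Ek_scale (a : R) w : Ek w -> Ek (fun t => a * w t).
Proof.
move=> /EkP[c ->]; apply/EkP; exists (fun i => a * c i); apply/funext => t.
by rewrite /lc mulr_sumr; apply: eq_bigr => i _; rewrite mulrA.
Qed.

Lemma trial_Ek i : (i < N)%N -> Ek (trial i).
Proof.
move=> iN; apply/EkP; exists (fun j => (j == i)%:R); apply/funext => t.
by rewrite -(sum_delta (trial ^~ t) iN); apply: eq_bigr => j _; rewrite mulrC.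
Qed.

Lemma Ek_E w : Ek w -> E T w.
Proof. by move=> /EkP[a ->]; apply: L2_lc => i; exact: trial_E. Qed.

Lemma projection_trial i : (i < N)%N -> E T (q (trial i)) /\
  ae_eq (@lebesgue_measure R) (J T) (q (trial i)) (fun t => kappa * ebar i t).
Proof.
move=> iN.
have [Eq qe] := projection_ebar T_gt0 lam_gt0 N_gt0 hq (trial_E iN).
split => //; apply: filterS qe => t qt Jt; rewrite qt// /lc.
rewrite (bigD1 (Ordinal iN))//= (ip_trial_ebar s T_gt0 lam_gt0 N_gt0 iN iN).
rewrite eqxx mulr1n mulr1 big1 ?addr0// => j ji.
rewrite (ip_trial_ebar s T_gt0 lam_gt0 N_gt0 iN (ltn_ord j)).
by rewrite (_ : (i == j :> nat) = false) ?mulr0 ?mul0r// eq_sym; exact/negbTE.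
Qed.

Lemma Q_trial i j : (i < N)%N -> (j < N)%N ->
  Q (tE (trial i) (trial j)) = kappa ^+ 2 *: tE (ebar i) (ebar j).
Proof.
move=> iN jN; rewrite hQ.2//; [|exact: trial_E..].
have [Ei qi] := projection_trial iN; have [Ej qj] := projection_trial jN.
have Es l : E T (fun t => kappa * ebar l t) by apply: L2_scale; exact: ebar_E.
rewrite (tens_ae lam_gt0 hEpi Ei (Es i) Ej (Es j) qi qj).
rewrite (tens_scalel E0 bilE)//.
have [_] := bilE kappa (ebar_E j) E0 (ebar_E i).
rewrite (tens0r E0 bilE)// addr0 expr2 -scalerA => <-.
by congr (_ *: tE _ _); apply/funext => t; rewrite addr0.
Qed.

Lemma Dk_tens_trial (i j : nat) v1 v2 : (i < N)%N -> (j < N)%N -> F T v1 -> F T v2 ->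
  Dk (tE (trial i) (trial j)) (tF v1 v2) =
  match s with
  | CN2 | iE2 => trace_form T (trial i) (trial j) v1 v2
  | iE2Q => kappa ^+ 2 * trace_form T (ebar i) (ebar j) v1 v2
  | iE2box => (i == j)%:R * ((T / N%:R)^-1 *
      (\int[lebesgue_measure]_(t in J T) (trial i t * v1 t) *
       \int[lebesgue_measure]_(t in J T) (trial j t * v2 t)))
  end.
Proof.
move=> iN jN F1 F2.
have HQ := Q_trial iN jN; have HE := trial_E iN; have HE' := trial_E jN.
have Hb := box_trial s T_gt0 lam_gt0 N_gt0 iN jN (F_L2 F1) (F_L2 F2).
rewrite /Deltak; case: s HQ HE HE' Hb => HQ HE HE' Hb.
- by rewrite hDelta.2.
- by rewrite hDelta.2.
- by rewrite HQ linearZl_LR/= hDelta.2//; exact: ebar_E.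
- by rewrite hbox.2.
Qed.

(** With equal factors every variant is a nonnegative multiple of an integral of squares or, for the
    box rule, of the square of an integral. *)
Lemma Dk_diag_ge0 i v : (i < N)%N -> F T v ->
  0 <= Dk (tE (trial i) (trial i)) (tF v v).
Proof.
move=> iN Fv; rewrite Dk_tens_trial//; have := trace_form_ge0 T (trial i) v.
case: s => // _.
  by rewrite mulr_ge0 ?sqr_ge0//; exact: trace_form_ge0.
by rewrite eqxx mul1r mulr_ge0 -?expr2 ?sqr_ge0// invr_ge0 ltW// mesh_gt0.
Qed.

(** Uniformity of the mesh lets [Delta11] of the last cell stand for that of the cell before, so
    that [alpha - theta^2] becomes a quadratic form on a single cell. *)
Lemma Dk_diag_hat i j : (i < N)%N -> (j < N)%N ->
  Dk (tE (trial i) (trial i)) (tF (hat i) (hat i)) =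
  Dk (tE (trial j) (trial j)) (tF (hat j) (hat j)).
Proof.
move=> iN jN; have Fi := hat_F T_gt0 N_gt0 iN; have Fj := hat_F T_gt0 N_gt0 jN.
rewrite !Dk_tens_trial// !eqxx.
rewrite (trace_trial_diag s T_gt0 lam_gt0 N_gt0 iN).
rewrite (trace_trial_diag s T_gt0 lam_gt0 N_gt0 jN).
rewrite (trace_ebar_diag lam T_gt0 N_gt0 iN) (trace_ebar_diag lam T_gt0 N_gt0 jN).
have hi l : (l < N)%N -> forall t, Jn T N l.+1 t -> hat l t =
  (1 - 'X).[(t - node T N l) / (T / N%:R)] by move=> lN t; exact: hat_diag.
by rewrite !(@Rintegral_trial _ _ _ _ s T_gt0 lam_gt0 N_gt0 _ _ (1 - 'X))//;
  exact: hi.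
Qed.

(** Clear for the integrals over the diagonal. The box rule vanishes on distinct cells, and on one
    cell it is a product of two integrals that commute. *)
Lemma Dk_sym_trial i j v1 v2 : (i < N)%N -> (j < N)%N -> F T v1 -> F T v2 ->
  Dk (tE (trial i) (trial j)) (tF v1 v2) =
  Dk (tE (trial i) (trial j)) (tF v2 v1).
Proof.
move=> iN jN F1 F2; rewrite !Dk_tens_trial// !(trace_formC T _ _ v1 v2).
case: s => //; have [->|_] := eqVneq i j; last by rewrite !mul0r.
by rewrite [X in _ * (_ * X)]mulrC.
Qed.

Lemma Dk_linr u (a : R) v v' : Dk u (a *: v + v') = a * Dk u v + Dk u v'.
Proof. by rewrite /Deltak; case: s; rewrite linearPr. Qed.

(** Testing a unit vector [w] with the signed and normalized dual hats bounds each coefficient of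
    [w] by [S] times the norm of the dual hat. The trial functions are orthonormal, so the squares
    of the coefficients add up to 1 and [S >= K^(-1/2)]. *)
Lemma gammak_gt0 : 0 < gammak T lam N s.
Proof.
have [M [M0 bM]] := b_bounded hEpi hFeps hB.
have Fd i : (i < N)%N -> F T (dual_hat i) by exact: dual_hat_F.
have nt i : (i < N)%N -> nE (trial i) = 1.
  by move=> iN; rewrite normE_ip ip_trial// eqxx sqrtr1.
have nd i : (i < N)%N -> 0 < nF (dual_hat i).
  move=> iN; have := bM _ _ (trial_E iN) (Fd i iN).
  rewrite b_trial_dual// eqxx normr1 nt// mul1r => h.
  by rewrite -(pmulr_rgt0 _ M0) (lt_le_trans ltr01).
pose K := \sum_(i < N) nF (dual_hat i) ^+ 2.
have K0 : 0 < K.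
  apply: (lt_le_trans (exprn_gt0 2 (nd 0%N N_gt0))).
  rewrite /K (bigD1 (Ordinal N_gt0))//= lerDl.
  by apply: sumr_ge0 => i _; rewrite sqr_ge0.
apply: (@lt_le_trans _ _ (Num.sqrt K)^-1); first by rewrite invr_gt0 sqrtr_gt0.
apply: lb_le_inf.
  (* The infimum of the empty set would be 0 by convention, so a unit vector of [Ek] has to be
     exhibited. *)
  exists (sup [set b T lam (trial 0) v | v in [set v | Fk T N v /\ nF v = 1]]).
  exists (trial 0) => //; split; last exact: nt.
  exact: trial_Ek.
move=> _ [w [Ekw nw] <-]; set S := sup _.
have Ew := Ek_E Ekw; have /EkP[a wE] := Ekw.
have ba i : (i < N)%N -> b T lam w (dual_hat i) = a i.
  move=> iN; rewrite wE b_lc; [|exact: trial_E|exact: Fd].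
  rewrite -[RHS](sum_delta a iN).
  by apply: eq_bigr => j _; rewrite b_trial_dual.
have aS i : (i < N)%N -> `|a i| <= S * nF (dual_hat i).
  move=> iN; rewrite -ler_pdivrMr ?nd//; apply: ub_le_sup.
    exists M => _ [v [Fkv nv] <-]; have Fv := Fk_F T_gt0 N_gt0 Fkv.
    by have := bM _ _ Ew Fv; rewrite nw nv !mulr1; apply: le_trans; exact: ler_norm.
  pose sg : R := if 0 <= a i then 1 else -1.
  have sga : sg * a i = `|a i|.
    by rewrite /sg; case: ger0P => _; rewrite ?mul1r ?mulN1r.
  have nsg : `|sg| = 1 by rewrite /sg; case: ifP => _; rewrite ?normrN normr1.
  exists (fun t => sg / nF (dual_hat i) * dual_hat i t).
    split; first by apply: Fk_scale; exact: dual_hat_Fk.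
    rewrite (normF_scale _ _ (Fd i iN)) normrM nsg mul1r normfV.
    by rewrite (gtr0_norm (nd i iN)) mulVf// gt_eqF// nd.
  by rewrite (b_scaler _ _ Ew (Fd i iN)) ba// mulrAC sga.
have aK : 1 <= S ^+ 2 * K.
  have : ip w w = 1 by rewrite -normE_sq// nw expr1n.
  move=> {1}<-; rewrite {1}wE ip_lc//.
  rewrite mulr_sumr; apply: ler_sum => i _.
  have -> : ip (trial i) w = a i.
    rewrite ipC wE ip_lc//; last exact: trial_E.
    rewrite -[RHS](sum_delta a (ltn_ord i)).
    by apply: eq_bigr => j _; rewrite ip_trial.
  rewrite -exprMn -expr2 -(real_normK (num_real (a i))).
  by rewrite lerXn2r ?nnegrE ?aS// (le_trans _ (aS i _)).
have S0 : 0 <= S.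
  by rewrite -(pmulr_lge0 _ (nd _ N_gt0)); exact: le_trans (aS _ N_gt0).
rewrite -(ler_pXn2r (n := 2))// ?nnegrE ?invr_ge0 ?sqrtr_ge0//.
by rewrite exprVn sqr_sqrtr ?(ltW K0)// -ler_pdivrMr// div1r in aK *.
Qed.

Lemma Ck_gt0 : 0 < beta T lam rho N s tE tF Dk -> 0 < Ck T lam rho N s tE tF Dk.
Proof.
rewrite /Ck; set be := beta _ _ _ _ _ _ _ _; set al := alpha _ _ _ _ _ _ _ _.
set th := theta _ _ _ _; set g := gammak _ _ _ _ => be0.
have gb : 0 < g ^- 2 * be by rewrite mulr_gt0// invr_gt0 exprn_gt0// gammak_gt0.
(* For [N = 1] the values of [alpha] and [theta] cancel. Otherwise [alpha >= theta^2 >= 0] makes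
   every term of the geometric sum nonnegative. *)
suff [N1|thal] : N = 1%N \/ th ^+ 2 <= al.
- rewrite N1; case: ifP => _; rewrite mulr_gt0//.
    by rewrite mul1r addrC subrK.
  by rewrite expr0 subrr mul0r mulr0 addr0.
- case: ifPn => [/eqP al1|al1]; rewrite mulr_gt0//.
    have th1 : 0 <= 1 - th ^+ 2 by rewrite subr_ge0 -al1.
    have : 1 <= N%:R :> R by rewrite ler1n.
    by move=> N1; have := mulr_ge0 th1 (_ : 0 <= N%:R - 1); rewrite subr_ge0 => /(_ N1); lra.
  rewrite ltr_pwDl// mulr_ge0 ?subr_ge0//.
  rewrite subrX1 mulrAC mulfV ?subr_eq0// mul1r sumr_ge0// => i _.
  by rewrite exprn_ge0// (le_trans _ thal)// sqr_ge0.
case EN : N N_gt0 => [//|[|m]] _; [by left|right].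
have mN : (m < N)%N by rewrite EN.
have m1N : (m.+1 < N)%N by rewrite EN.
pose p := rho ^+ 2 * (b_left T lam N s) ^- 2.
have p0 : 0 <= p by rewrite mulr_ge0 ?sqr_ge0// invr_ge0 sqr_ge0.
have bl : b T lam (trial m.+1) (hat m.+1) = b_left T lam N s.
  by rewrite b_trial_hat// eqxx.
have bl' : b T lam (trial m) (hat m) = b_left T lam N s.
  by rewrite b_trial_hat// eqxx.
have br : b T lam (trial m) (hat m.+1) = b_right T lam N s.
  by rewrite b_trial_hat// (_ : (m.+1 == m) = false) ?eqxx// gtn_eqF.
(* As in [alphan N], [D11] belongs to the last cell, [D12] and [D22] to the cell before it. *)
pose D11 := Dk (tE (trial m.+1) (trial m.+1)) (tF (hat m.+1) (hat m.+1)).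
pose D12 := Dk (tE (trial m) (trial m)) (tF (hat m) (hat m.+1)).
pose D22 := Dk (tE (trial m) (trial m)) (tF (hat m.+1) (hat m.+1)).
have N1 : N.-1 = m.+1 by rewrite EN.
have eN : e T lam N s N = trial m.+1 by congr e; rewrite EN.
have eN1 : e T lam N s N.-1 = trial m by rewrite N1.
have beE : be = (1 - p * D11)^-1.
  by rewrite /be /beta /betan /bmat /Delta11 eN N1 bl -/D11 -/p.
have thE : th = (b_left T lam N s)^-1 * b_right T lam N s.
  by rewrite /th /theta /thetan /bmat eN eN1 N1 bl br.
have alE : al = be * (th ^+ 2 + p * (D22 - 2 * th * D12)).
  rewrite /al /alpha /alphan -/(beta _ _ _ _ _ _ _ _) -/be -/(theta _ _ _ _) -/th.
  rewrite thE /bmat /Delta22 /Delta12 eN eN1 N1/=.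
  by rewrite bl bl' br -/D12 -/D22 -/p !mulrA.
have Fm := hat_F T_gt0 N_gt0 mN; have Fm1 := hat_F T_gt0 N_gt0 m1N.
have Fv : F T (fun t => - th * hat m t + hat m.+1 t) by exact: F_lin.
have := Dk_diag_ge0 mN Fv.
rewrite (bilF _ Fm Fm1 Fv).1 (bilF _ Fm Fm1 Fm).2 (bilF _ Fm Fm1 Fm1).2.
rewrite !Dk_linr (Dk_sym_trial mN mN Fm1 Fm) -/D12 -/D22.
rewrite (Dk_diag_hat mN m1N) -/D11 => quad.
have bne : 1 - p * D11 != 0 by rewrite -invr_eq0 -beE gt_eqF.
rewrite -subr_ge0 alE.
(* From [be (1 - p D11) = 1] one gets [be theta^2 - theta^2 = be p D11 theta^2], which completes the
   quadratic form. *)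
have -> : be * (th ^+ 2 + p * (D22 - 2 * th * D12)) - th ^+ 2 =
    be * (p * (- th * (- th * D11 + D12) + (- th * D12 + D22))).
  by rewrite beE; field.
by rewrite mulr_ge0 ?(ltW be0)// mulr_ge0.
Qed.

End StabilityConstant.

(** * The lift from piecewise constants to the trial space *)

Section Lift.
Context {R : realType}.
Variables (T lam rho : R) (N : nat) (s : scheme).
Hypotheses (T_gt0 : 0 < T) (lam_gt0 : 0 < lam) (N_gt0 : (0 < N)%N).
Variables (Epi Feps : completeNormedModType R).
Variables (tE : (R -> R) -> (R -> R) -> Epi) (tF : (R -> R) -> (R -> R) -> Feps).
Hypotheses (hEpi : projective_tensor (E T) (normE T lam) tE).
Variables (B Delta box : {bilinear Epi -> Feps -> R^o}).
Hypotheses (hB : extends_form T tE tF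
    (fun w1 w2 v1 v2 => b T lam w1 v1 * b T lam w2 v2) B)
  (hDelta : extends_form T tE tF (trace_form T) Delta)
  (hbox : extends_form T tE tF (box_form T N) box).
Variables (q : (R -> R) -> R -> R) (hq : orthogonal_projection T N q).
Variables (Q : {linear Epi -> Epi}) (hQ : extends_map T tE q Q).
Notation ip := (ip T lam).
Notation trial := (trial T lam N s).
Notation ebar := (ebar T lam N).
Notation dual_hat := (dual_hat T lam N s).
Notation kappa := (@kappa R s).
Notation Dk := (Deltak s Delta box Q).
Notation Ekpi := (Ekpi T lam N s tE).
Notation BBk := (calB rho B Dk).
Notation top := (tensor_op tE tF B N).

Let E_lin (a : R) x y : E T x -> E T y -> E T (fun t => a * x t + y t).
Proof. exact: L2_lin. Qed.
Let E0 : E T (fun=> 0). Proof. exact: L2_cst. Qed.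
Let bilE : bilinear_on (E T) tE := projective_bilinear hEpi.
Let trial_E i : (i < N)%N -> E T (trial i).
Proof. exact: trial_L2. Qed.
Let ebar_E i : (i < N)%N -> E T (ebar i). Proof. by move=> _; exact: ebar_L2. Qed.
Let kappa0 : kappa != 0. Proof. by rewrite gt_eqF// kappa_gt0. Qed.
Let Qb : bounded_linear Q. Proof. exact: continuous_bounded_linear hQ.1. Qed.
Let topb psi g : bounded_linear (top psi g). Proof. exact: (tensor_op_bounded hB). Qed.

Lemma Ekpi_eq (V : normedModType R) (f g : Epi -> V) :
  bounded_linear f -> bounded_linear g ->
  (forall i j, (i < N)%N -> (j < N)%N ->
    f (tE (trial i) (trial j)) = g (tE (trial i) (trial j))) ->
  forall u, Ekpi u -> f u = g u.
Proof.
move=> fl gl fg u [n [x [y [Exy ->]]]]; rewrite !bounded_linear_sum//.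
apply: eq_bigr => l _; have [/EkP[a ->] /EkP[c ->]] := Exy l.
rewrite (tens_lc E_lin E0 bilE)//.
rewrite !bounded_linear_sum//; apply: eq_bigr => i _.
rewrite !bounded_linear_sum//; apply: eq_bigr => j _.
by rewrite !bounded_linearZ// fg.
Qed.

Lemma Ekpi_op psi u : Ekpi (top psi trial u).
Proof.
apply: tensor_span_sum => i.
have -> : \sum_(j < N) B u (tF (psi i) (psi j)) *: tE (trial i) (trial j) =
    tE (trial i) (lc N (fun j => B u (tF (psi i) (psi j))) trial).
  by rewrite (tens_lcr E_lin E0 bilE)//; exact: trial_E.
by apply: tensor_span1; [exact: trial_Ek|apply/EkP; eexists].
Qed.

Lemma lc_delta (k : R) g i : (i < N)%N ->
  lc N (fun j => k * (i == j)%:R) g = fun t => k * g i t.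
Proof.
move=> iN; apply/funext => t; rewrite -(sum_delta (fun i => k * g i t) iN).
by apply: eq_bigr => j _; rewrite [i == _]eq_sym mulrAC.
Qed.

Lemma op_tens_trial psi (k : R) g i j : (i < N)%N -> (j < N)%N ->
  (forall l, (l < N)%N -> F T (psi l)) -> (forall l, (l < N)%N -> E T (g l)) ->
  (forall i l, (i < N)%N -> (l < N)%N -> b T lam (trial i) (psi l) = k * (i == l)%:R) ->
  top psi g (tE (trial i) (trial j)) = k ^+ 2 *: tE (g i) (g j).
Proof.
move=> iN jN Fpsi Eg bk; rewrite (tensor_op_tens hEpi hB)//; [|exact: trial_E..].
have lE i' : (i' < N)%N -> lc N (fun l => b T lam (trial i') (psi l)) g =
    fun t => k * g i' t.
  move=> iN'; rewrite -lc_delta//; apply/funext => t; apply: eq_bigr => l _.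
  by rewrite bk.
rewrite !lE// (tens_scalel E0 bilE)//; [|exact: Eg|exact/L2_scale/Eg].
have [_] := bilE k (Eg j jN) E0 (Eg i iN).
rewrite (tens0r E0 bilE) ?addr0 ?expr2 -?scalerA; last exact: Eg.
by move=> <-; congr (_ *: tE _ _); apply/funext => t; rewrite addr0.
Qed.

(* On [Ekpi], [Q] is [kappa^2] times the tensor square of the isometry that
   maps the trial functions to the normalized indicators of the cells. *)
Lemma Q_norm_Ekpi u : Ekpi u -> `|Q u| <= kappa ^+ 2 * `|u|.
Proof.
move=> Eu; have [psi [Fpsi bpsi]] := b_representation T_gt0 lam_gt0 trial_E.
have -> : Q u = kappa ^+ 2 *: top psi ebar u.
  apply: (@Ekpi_eq _ Q (fun u => kappa ^+ 2 *: top psi ebar u)) => //.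
    exact: bounded_linear_scale.
  move=> i j iN jN; rewrite (Q_trial s T_gt0 lam_gt0 N_gt0 hEpi hq hQ iN jN).
  rewrite (@op_tens_trial _ 1)// ?expr1n ?scale1r// => i' l iN' lN.
  by rewrite bpsi// ?ip_trial ?mul1r//; exact: trial_E.
rewrite normrZ ger0_norm ?sqr_ge0// ler_wpM2l ?sqr_ge0//.
apply: (tensor_op_contraction lam_gt0 hEpi hB Fpsi trial_E ebar_E bpsi).
- by move=> i j iN jN; exact: ip_trial.
- by move=> i j iN jN; exact: ip_ebar_ebar.
Qed.

(** [W] takes the coefficients of a tensor against the normalized indicators and attaches them,
    times [kappa^-2], to the trial functions. Up to that factor it is a contraction, and the factor
    undoes the [kappa^2] of [Q]. *)
Lemma lift_exists : exists W : Epi -> Epi,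
  [/\ bounded_linear W, forall u, Ekpi (W u) & forall u, Ekpi u -> W u = u] /\
  [/\ forall u, Q (W u) = Q u, forall u, W (Q u) = W u &
      forall u, `|W u| <= kappa ^- 2 * `|u|].
Proof.
have [psi [Fpsi bpsi]] := b_representation T_gt0 lam_gt0 ebar_E.
pose W u := kappa ^- 2 *: top psi trial u.
have k20 : 0 < kappa ^- 2 by rewrite invr_gt0 exprn_gt0// kappa_gt0.
have Wb : bounded_linear W by exact: bounded_linear_scale.
have Wtens x y : E T x -> E T y -> W (tE x y) = kappa ^- 2 *:
    tE (lc N (fun i => ip x (ebar i)) trial) (lc N (fun i => ip y (ebar i)) trial).
  move=> Ex Ey; rewrite /W (tensor_op_tens hEpi hB)//; congr (_ *: tE _ _);
    by apply/funext => t; apply: eq_bigr => i _; rewrite bpsi.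
have Qtens x y : E T x -> E T y -> Q (tE x y) =
    tE (lc N (fun i => ip x (ebar i)) ebar) (lc N (fun i => ip y (ebar i)) ebar).
  move=> Ex Ey; rewrite hQ.2//.
  have [Eqx qx] := projection_ebar T_gt0 lam_gt0 N_gt0 hq Ex.
  have [Eqy qy] := projection_ebar T_gt0 lam_gt0 N_gt0 hq Ey.
  by apply: (tens_ae lam_gt0 hEpi) => //; apply: L2_lc.
exists W; split; split => //.
- move=> u; rewrite /W -[top _ _ _]addr0.
  have := @tensor_span_scale R (E T) E0 _ _ bilE (Ek T lam N s) (kappa ^- 2)
    (top psi trial u).
  rewrite addr0; apply; last exact: Ekpi_op.
    by move=> x; exact: Ek_E.
  by move=> x; exact: Ek_scale.
- move=> u Eu; apply: (@Ekpi_eq _ W id) => //.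
    exact: bounded_linear_id.
  move=> i j iN jN; rewrite /W (@op_tens_trial _ kappa)//.
    by rewrite scalerA mulVf ?scale1r// expf_neq0.
  move=> i' l iN' lN; rewrite bpsi//; last exact: trial_E.
  exact: ip_trial_ebar.
- apply: (span_eq hEpi) => //.
    exact: bounded_linear_comp.
  move=> x y Ex Ey; rewrite Wtens// Qtens// linearZ/=.
  rewrite (tens_lc E_lin E0 bilE)// (tens_lc E_lin E0 bilE)//.
  rewrite linear_sum scaler_sumr; apply: eq_bigr => i _.
  rewrite linear_sum scaler_sumr; apply: eq_bigr => j _.
  rewrite linearZ/= (Q_trial s T_gt0 lam_gt0 N_gt0 hEpi hq hQ)//.
  by rewrite !scalerA mulrAC mulVf ?mul1r// expf_neq0.
- apply: (span_eq hEpi) => //.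
    exact: bounded_linear_comp.
  move=> x y Ex Ey; rewrite Qtens// !Wtens//; try by apply: L2_lc.
  have ipl z : lc N (fun i => ip (lc N (fun i => ip z (ebar i)) ebar) (ebar i)) trial =
      lc N (fun i => ip z (ebar i)) trial.
    apply/funext => t; apply: eq_bigr => i _; congr (_ * _).
    rewrite ip_lc//; last exact: ebar_E.
    rewrite -[RHS](sum_delta (fun i => ip z (ebar i)) (ltn_ord i)).
    by apply: eq_bigr => j _; rewrite ip_ebar_ebar.
  by congr (_ *: tE _ _); exact: ipl.
- move=> u; rewrite normrZ ger0_norm ?(ltW k20)// ler_wpM2l ?(ltW k20)//.
  apply: (tensor_op_contraction lam_gt0 hEpi hB Fpsi ebar_E trial_E bpsi).
  + by move=> i j iN jN; exact: ip_ebar_ebar.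
  + by move=> i j iN jN; exact: ip_trial.
Qed.

(** [Qinv] is a choice among preimages; as [W] is a left inverse of [Q] on [Ekpi], there is only one
    preimage to choose. *)
Lemma Qinv_lift W :
  (forall u, Ekpi (W u)) -> (forall u, Ekpi u -> W u = u) ->
  (forall u, Q (W u) = Q u) -> (forall u, W (Q u) = W u) ->
  forall u, Qinv T lam N s tE Q (Q u) = W u.
Proof.
move=> WE Wid QW WQ u; apply: xget_unique; first by split.
by move=> y [Ey Qy]; rewrite -(Wid y Ey) -WQ Qy WQ.
Qed.

(** For the constant profile the trial functions are the normalized indicators themselves. *)
Lemma Q_id_CN u : s = CN2 -> Ekpi u -> Q u = u.
Proof.
move=> sCN Eu; have k1 : kappa = 1 by rewrite sCN.
apply: (@Ekpi_eq _ Q id) => //.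
  exact: bounded_linear_id.
move=> i j iN jN; rewrite (Q_trial s T_gt0 lam_gt0 N_gt0 hEpi hq hQ)// k1 expr1n scale1r.
have te l : (l < N)%N -> trial l = ebar l.
  move=> lN; apply/funext => t; rewrite trialE// /trial_scale k1 /ebar chiE !patchE.
  by case: ifP => _; rewrite ?mulr0// sCN /trial_poly hornerC invr1 !mulr1.
by rewrite !te.
Qed.

Lemma Dk_bounded_linear v : bounded_linear (fun u => Dk u v : R^o).
Proof.
rewrite /Deltak; case: s.
- exact: bilinear_bounded_linear hDelta.1.
- exact: bilinear_bounded_linear hDelta.1.
- exact: bounded_linear_comp (bilinear_bounded_linear v hDelta.1) Qb.
- exact: bilinear_bounded_linear hbox.1.
Qed.

Lemma Dk_bound : exists M : R, 0 < M /\ forall u v, `|Dk u v| <= M * `|u| * `|v|.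
Proof.
rewrite /Deltak; case: s.
- exact: bilinear_bound hDelta.1.
- exact: bilinear_bound hDelta.1.
- have [K [K0 DK]] := bilinear_bound hDelta.1; have [_ [L [L0 QL]]] := Qb.
  exists (K * L); split; first exact: mulr_gt0.
  move=> u v; rewrite (le_trans (DK _ _))// ler_wpM2r// -mulrA ler_wpM2l//.
  exact: ltW.
- exact: bilinear_bound hbox.1.
Qed.

Lemma BBk_linl v (a : R) u u' : BBk (a *: u + u') v = a * BBk u v + BBk u' v.
Proof.
rewrite /calB linearPl (Dk_bounded_linear v).1 -[a *: (B u v : R^o)]/(a * B u v).
rewrite -[a *: (Dk u v : R^o)]/(a * Dk u v); ring.
Qed.

Lemma BBk_linr u (a : R) v v' : BBk u (a *: v + v') = a * BBk u v + BBk u v'.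
Proof.
rewrite /calB linearPr (Dk_linr s Delta box Q u a v v').
rewrite -[a *: (B u v : R^o)]/(a * B u v); ring.
Qed.

Lemma BBk_bound : exists M : R, 0 < M /\ forall u v, `|BBk u v| <= M * `|u| * `|v|.
Proof.
have [K [K0 BK]] := bilinear_bound hB.1; have [L [L0 DL]] := Dk_bound.
exists (K + rho ^+ 2 * L); split; first by rewrite ltr_wpDr// mulr_ge0 ?sqr_ge0 ?ltW.
move=> u v; rewrite (le_trans (ler_normB _ _))// !mulrDl lerD//.
rewrite normrM ger0_norm ?sqr_ge0//.
rewrite (_ : _ * L * _ * _ = rho ^+ 2 * (L * `|u| * `|v|)); last by ring.
by rewrite ler_wpM2l ?sqr_ge0.
Qed.

Lemma Delta_sym u v1 v2 : F T v1 -> F T v2 ->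
  Delta u (tF v1 v2) = Delta u (tF v2 v1).
Proof.
move=> F1 F2; apply: (span_eq hEpi (f := fun u => Delta u (tF v1 v2) : R^o)
    (g := fun u => Delta u (tF v2 v1) : R^o)).
- exact: bilinear_bounded_linear hDelta.1.
- exact: bilinear_bounded_linear hDelta.1.
- by move=> x y Ex Ey; rewrite !hDelta.2// trace_formC.
Qed.

(** [top dual_hat trial] reproduces [Ekpi], so an element is determined by its values under [B] on
    pairs of dual hats. The equation makes these values symmetric, since [ell] and [Dk u] are, while
    for the transposed sum [V] they are the same values transposed. *)
Lemma Ekpi_sym_solution u (ell : Feps -> R) :
  (forall v1 v2, F T v1 -> F T v2 -> ell (tF v1 v2) = ell (tF v2 v1)) ->
  Ekpi u -> (forall v, Fkeps T N tF v -> BBk u v = ell v) ->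
  Ekpi_sym T lam N s tE u.
Proof.
move=> ell_sym Eu uell; have [n [x [y [Exy uE]]]] := Eu.
exists n, x, y; split => //.
have Fd i : (i < N)%N -> F T (dual_hat i) by exact: dual_hat_F.
have opid v : Ekpi v -> top dual_hat trial v = v.
  move=> Ev; apply: (@Ekpi_eq _ (top dual_hat trial) id) => //.
    exact: bounded_linear_id.
  move=> i j iN jN; rewrite (@op_tens_trial _ 1)// ?expr1n ?scale1r//.
  by move=> i' l iN' lN; rewrite mul1r; exact: b_trial_dual.
have Dsym i j : (i < N)%N -> (j < N)%N -> Dk u (tF (dual_hat i) (dual_hat j)) =
    Dk u (tF (dual_hat j) (dual_hat i)).
  move=> iN jN; apply: (Ekpi_eq (f := fun u => Dk u (tF (dual_hat i) (dual_hat j)) : R^o)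
    (g := fun u => Dk u (tF (dual_hat j) (dual_hat i)) : R^o)) => //.
  - exact: Dk_bounded_linear.
  - exact: Dk_bounded_linear.
  - move=> i' j' iN' jN'.
    exact: (Dk_sym_trial s T_gt0 lam_gt0 N_gt0 hEpi hDelta hbox hq hQ iN' jN' (Fd i iN) (Fd j jN)).
have Bsym i j : (i < N)%N -> (j < N)%N -> B u (tF (dual_hat i) (dual_hat j)) =
    B u (tF (dual_hat j) (dual_hat i)).
  move=> iN jN.
  have Fk2 i' j' : (i' < N)%N -> (j' < N)%N -> Fkeps T N tF (tF (dual_hat i') (dual_hat j')).
    by move=> iN' jN'; apply: tensor_span1; exact: dual_hat_Fk.
  have := uell _ (Fk2 _ _ iN jN).
  rewrite (ell_sym _ _ (Fd i iN) (Fd j jN)) -(uell _ (Fk2 _ _ jN iN)).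
  by rewrite /calB Dsym// => /addIr.
pose V := \sum_(i < n) tE (y i) (x i).
have EV : Ekpi V by exists n, y, x; split => // i; have [] := Exy i.
have BV i j : (i < N)%N -> (j < N)%N ->
    B V (tF (dual_hat i) (dual_hat j)) = B u (tF (dual_hat j) (dual_hat i)).
  move=> iN jN; rewrite uE !linear_sumlz; apply: eq_bigr => l _.
  have [Ekx Eky] := Exy l.
  have Ex := Ek_E T_gt0 lam_gt0 N_gt0 Ekx; have Ey := Ek_E T_gt0 lam_gt0 N_gt0 Eky.
  have [_ HB] := hB.
  by rewrite (HB _ _ _ _ Ey Ex (Fd i iN) (Fd j jN)) (HB _ _ _ _ Ex Ey (Fd j jN) (Fd i iN)) mulrC.
rewrite -/V -(opid u Eu) -(opid V EV).
apply: eq_bigr => i _; apply: eq_bigr => j _.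
by rewrite BV// Bsym.
Qed.

End Lift.

(** * Quasi-optimality *)

Section InfSup.
Context {R : realType} {V W : normedModType R}.
Variables (f : V -> W -> R) (A : set V) (A' : set W).
Hypotheses (f_linl : forall v (a : R) u u', f (a *: u + u') v = a * f u v + f u' v)
  (f_linr : forall u (a : R) v v', f u (a *: v + v') = a * f u v + f u v')
  (f_bound : exists M : R, 0 < M /\ forall u v, `|f u v| <= M * `|u| * `|v|).

Let f0l v : f 0 v = 0.
Proof. by have := f_linl v (-1) 0 0; rewrite scaler0 addr0 mulN1r addNr. Qed.

Let f0r u : f u 0 = 0.
Proof. by have := f_linr u (-1) 0 0; rewrite scaler0 addr0 mulN1r addNr. Qed.

Let fZl (a : R) u v : f (a *: u) v = a * f u v.
Proof. by have := f_linl v a u 0; rewrite !addr0 f0l addr0. Qed.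

Let fZr (a : R) u v : f u (a *: v) = a * f u v.
Proof. by have := f_linr u a v 0; rewrite !addr0 f0r addr0. Qed.

Lemma unit_scale (U : normedModType R) (u : U) : u != 0 -> `| (`|u|^-1 *: u) | = 1.
Proof.
by move=> u0; rewrite normrZ normfV normr_id mulVf// normr_eq0.
Qed.

Lemma operator_norm_bound u v : `|f u v| <= operator_norm f * `|u| * `|v|.
Proof.
have [->|u0] := eqVneq u 0; first by rewrite f0l !normr0 mulr0 mul0r.
have [->|v0] := eqVneq v 0; first by rewrite f0r !normr0 mulr0.
have nu : 0 < `|u| by rewrite normr_gt0.
have nv : 0 < `|v| by rewrite normr_gt0.
have [M [M0 fM]] := f_bound.
have : `|f (`|u|^-1 *: u) (`|v|^-1 *: v)| <= operator_norm f.
  apply: ub_le_sup.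
    by exists M => _ [x [y [x1 y1 ->]]]; have := fM x y; rewrite x1 y1 !mulr1.
  by exists (`|u|^-1 *: u), (`|v|^-1 *: v); rewrite !unit_scale.
rewrite fZl fZr !normrM !normfV !normr_id ler_pdivrMl// ler_pdivrMl// => h.
by rewrite (le_trans h)// le_eqVlt; apply/orP; left; apply/eqP; ring.
Qed.

(** The inf-sup condition applied to [z / |z|]. The unit vector [v0] makes the suprema range over a
    nonempty set, bounds the infimum below by [- M], and for [z = 0] shows that [D] is
    nonnegative. *)
Lemma inf_sup_bound (C D : R) z :
  (forall (a : R) u, A u -> A (a *: u)) ->
  (exists2 v, A' v & `|v| = 1) ->
  0 < C -> C^-1 <= inf_sup A A' f -> A z ->
  (forall v, A' v -> `|v| = 1 -> f z v <= D) -> `|z| <= C * D.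
Proof.
move=> AZ [v0 Av0 v01] C0 hC Az zD.
have [z0|z0] := eqVneq z 0.
  by rewrite z0 normr0 mulr_ge0 ?(ltW C0)//; have := zD _ Av0 v01; rewrite z0 f0l.
have nz : 0 < `|z| by rewrite normr_gt0.
have [M [M0 fM]] := f_bound.
have ub u : `|u| = 1 -> has_ubound [set f u v | v in unit_sphere_in A'].
  move=> u1; exists M => _ [v [_ v1] <-]; have := fM u v; rewrite u1 v1 !mulr1.
  by apply: le_trans; exact: ler_norm.
rewrite mulrC -ler_pdivrMr// mulrC -ler_pdivlMr// (le_trans hC)//.
apply: (@le_trans _ _ (sup [set f (`|z|^-1 *: z) v | v in unit_sphere_in A'])).
  apply: ge_inf.
    exists (- M) => _ [u [_ u1] <-].
    apply: (@le_trans _ _ (f u v0)); last by apply: ub_le_sup; [exact: ub|exists v0].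
    by have := fM u v0; rewrite u1 v01 !mulr1 ler_norml => /andP[].
  by exists (`|z|^-1 *: z) => //; split; [exact: AZ|exact: unit_scale].
apply: ge_sup; first by exists (f (`|z|^-1 *: z) v0), v0.
by move=> _ [v [Av v1] <-]; rewrite fZl mulrC ler_pM2r ?invr_gt0// zD.
Qed.

Lemma dual_norm_bound (g : W -> R) v :
  (exists M : R, forall v, `|g v| <= M * `|v|) -> A' v -> `|v| = 1 ->
  `|g v| <= dual_norm A' g.
Proof.
move=> [M gM] Av v1; apply: ub_le_sup; last by exists v.
by exists M => _ [u [_ u1] <-]; have := gM u; rewrite u1 mulr1.
Qed.

End InfSup.

Theorem proposition3p11 (R : realType) (T lam rho : R)
  (hT : 0 < T) (hlam : 0 < lam) (hrho : 0 <= rho)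
  (N : nat) (hN : (0 < N)%N) (s : scheme)
  (Epi Feps : completeNormedModType R)
  (tE : (R -> R) -> (R -> R) -> Epi) (tF : (R -> R) -> (R -> R) -> Feps)
  (hEpi : projective_tensor (E T) (normE T lam) tE)
  (hFeps : injective_tensor (F T) (normF T lam) tF)
  (B Delta box : {bilinear Epi -> Feps -> R^o})
  (hB : extends_form T tE tF
          (fun w1 w2 v1 v2 => b T lam w1 v1 * b T lam w2 v2) B)
  (hDelta : extends_form T tE tF (trace_form T) Delta)
  (hbox : extends_form T tE tF (box_form T N) box)
  (q : (R -> R) -> R -> R) (hq : orthogonal_projection T N q)
  (Q : {linear Epi -> Epi}) (hQ : extends_map T tE q Q)
  (ell : {linear Feps -> R^o}) (hell : continuous ell)
  (ell_sym : forall v1 v2, F T v1 -> F T v2 ->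
    ell (tF v1 v2) = ell (tF v2 v1)) :
  let Dk := Deltak s Delta box Q in
  let BB := calB rho B Delta in
  let BBk := calB rho B Dk in
  let BBbar := calBbar T lam N s tE BBk Q in
  let C := Ck T lam rho N s tE tF Dk in
  let QEk := Q @` Ekpi T lam N s tE in
  0 < beta T lam rho N s tE tF Dk ->
  C^-1 <= inf_sup (Ekpi_sym T lam N s tE) (Fkeps_sym T N tF) BBk ->
  forall U Ubar : Epi,
  (forall v : Feps, B U v - rho ^+ 2 * Delta U v = ell v) ->
  QEk Ubar ->
  (forall v : Feps, Fkeps T N tF v -> BBbar Ubar v = ell v) ->
  (s = CN2 ->
     `|U - Ubar| <= (1 + C * operator_norm BBk) * best_approximation QEk U) /\
  (s <> CN2 ->
     `|U - Ubar| <= (1 + C * operator_norm BBk) * best_approximation QEk U +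
       4^-1 * C * dual_norm (Fkeps T N tF) (fun v => BB U v - BBbar U v)).
Proof.
move=> Dk BB BBk BBbar C QEk beta_gt0 hC U Ubar hU QUbar hUbar.
have C0 : 0 < C by exact: (Ck_gt0 hT hlam hN hEpi hFeps hB hDelta hbox hq hQ beta_gt0).
have bilE := projective_bilinear hEpi.
have bilF : bilinear_on (F T) tF by case: hFeps.
have E0 : E T (fun=> 0) by exact: L2_cst.
have BBkl : forall v a u u', BBk (a *: u + u') v = a * BBk u v + BBk u' v.
  exact: (BBk_linl rho s B hDelta hbox hQ).
have BBkr : forall u a v v', BBk u (a *: v + v') = a * BBk u v + BBk u v'.
  exact: BBk_linr.
have BBkb := BBk_bound rho s hB hDelta hbox hQ.
have opn := operator_norm_bound BBkl BBkr BBkb.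
have [W [[Wb WE Wid] [QW WQ Wn]]] := lift_exists s hT hlam hN hEpi hB hq hQ.
have Qb : bounded_linear Q by exact: continuous_bounded_linear hQ.1.
have BBbarE u v : BBbar u v = BBk (W u) v.
  by rewrite /BBbar /calBbar (Qinv_lift WE Wid QW WQ).
have BBU v : BB U v = ell v by exact: hU.
have QUk : Q (W Ubar) = Ubar by have [z Ez <-] := QUbar; rewrite WQ (Wid z Ez).
have hUk v : Fkeps T N tF v -> BBk (W Ubar) v = ell v.
  by move=> Fv; rewrite -BBbarE; exact: hUbar.
have Uksym : Ekpi_sym T lam N s tE (W Ubar).
  exact: (Ekpi_sym_solution hT hlam hN hEpi hB hDelta hbox hq hQ ell_sym (WE _) hUk).
have Usym v1 v2 : F T v1 -> F T v2 -> B U (tF v1 v2) = B U (tF v2 v1).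
  move=> F1 F2; have := hU (tF v1 v2).
  rewrite (Delta_sym hEpi hDelta U F1 F2) ell_sym// -hU.
  by move=> /addIr.
have tr0 : E T (trial T lam N s 0) by exact: trial_L2.
have dh0 : F T (dual_hat T lam N s 0) by exact: dual_hat_F.
(* A pair of elementary tensors with value 1 under [B]: neither is 0, so normalizing them yields
   points of both unit spheres. *)
have Bne : B (tE (trial T lam N s 0) (trial T lam N s 0))
    (tF (dual_hat T lam N s 0) (dual_hat T lam N s 0)) = 1.
  have [_ HB] := hB; rewrite (HB _ _ _ _ tr0 tr0 dh0 dh0).
  by rewrite (b_trial_dual s hT hlam hN hN hN) mulr1.
have Fsph : exists v, Fkeps_sym T N tF v /\ `|v| = 1.
  set v := tF (dual_hat T lam N s 0) (dual_hat T lam N s 0) in Bne.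
  have v0 : v != 0.
    by apply/eqP => v0; move/eqP: Bne; rewrite v0 linear0r eq_sym oner_eq0.
  exists (`|v|^-1 *: v); split; last exact: unit_scale.
  apply: (sym_tensor_span_scale (F0 T) bilF).
  - by move=> w; exact: (Fk_F hT hN).
  - by move=> w; exact: Fk_scale.
  - by exists 1%N, (fun=> dual_hat T lam N s 0), (fun=> dual_hat T lam N s 0);
      rewrite !big_ord1; split => // i; split; exact: dual_hat_Fk.
have Esph : exists u : Epi, Ekpi T lam N s tE u /\ `|u| = 1.
  set u := tE (trial T lam N s 0) (trial T lam N s 0) in Bne.
  have u0 : u != 0.
    by apply/eqP => u0; move/eqP: Bne; rewrite u0 linear0l eq_sym oner_eq0.
  exists (`|u|^-1 *: u); split; last exact: unit_scale.
  apply: (tensor_span_scale E0 bilE).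
  - by move=> w; exact: (Ek_E hT hlam hN).
  - by move=> w; exact: Ek_scale.
  - by apply: tensor_span1; exact: trial_Ek.
have opn0 : 0 <= operator_norm BBk.
  rewrite leNgt; apply/negP => op_lt0.
  have [v0 [Fv0 v01]] := Fsph; have [u0 [Eu0 u01]] := Esph.
  have := opn u0 v0; rewrite u01 v01 !mulr1 => /(le_trans (normr_ge0 _)).
  by rewrite leNgt op_lt0.
have K0 : 0 < 1 + C * operator_norm BBk.
  by rewrite ltr_pwDl// mulr_ge0// ltW.
(* Division by the positive factor passes from each [om] to the infimum; [Ubar] shows that the set
   is nonempty. *)
have quasi (c : R) : (forall om, Ekpi T lam N s tE om ->
    `|U - Ubar| <= (1 + C * operator_norm BBk) * `|U - Q om| + c) ->
    `|U - Ubar| <= (1 + C * operator_norm BBk) * best_approximation QEk U + c.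
  move=> H; rewrite -lerBlDr -ler_pdivrMl//; apply: lb_le_inf.
    by exists `|U - Ubar|, Ubar.
  move=> _ [_ [om Eom <-] <-]; rewrite ler_pdivrMl// lerBlDr; exact: H.
(* Averaging [om] with its transpose does not increase the distance to [U]. *)
have symmetrize om : Ekpi T lam N s tE om -> exists oms,
    [/\ Ekpi_sym T lam N s tE oms & `|U - Q oms| <= `|U - Q om|].
  move=> [n [x [y [Exy omE]]]].
  have ExyE i : E T (x i) /\ E T (y i).
    by have [Ex Ey] := Exy i; split; apply: (Ek_E hT hlam hN); [exact: Ex|exact: Ey].
  pose omt := \sum_(i < n) tE (y i) (x i).
  exists (2^-1 *: (om + omt)); split.
    apply: (sym_tensor_span_scale E0 bilE) => //.
    - by move=> w; exact: (Ek_E hT hlam hN).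
    - by move=> w; exact: Ek_scale.
    - by rewrite omE; exact: sym_tensor_span_transpose.
  have Qt a b : E T a -> E T b -> Q (tE a b) = tE (q a) (q b) by exact: hQ.2.
  have QE a : E T a -> E T (q a).
    by move=> Ea; have [] := projection_ebar hT hlam hN hq Ea.
  (* [Q] acts on the factors, so [Q omt] is the transpose of [Q om] and the comparison of distances
     applies to the projected sums. *)
  have h : `|U - Q omt| <= `|U - Q om|.
    have Qs (x' y' : 'I_n -> R -> R) : (forall i, E T (x' i) /\ E T (y' i)) ->
        Q (\sum_(i < n) tE (x' i) (y' i)) = \sum_(i < n) tE (q (x' i)) (q (y' i)).
      move=> H; rewrite bounded_linear_sum//; apply: eq_bigr => i _.
      by have [? ?] := H i; exact: Qt.
    rewrite omE (Qs x y ExyE) (Qs y x); last by move=> i; have [] := ExyE i.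
    apply: (symmetric_distance hT hlam hEpi hB) => // i.
    by have [? ?] := ExyE i; split; exact: QE.
  have -> : U - Q (2^-1 *: (om + omt)) = 2^-1 *: ((U - Q om) + (U - Q omt)).
    rewrite linearZ/= linearD addrACA -opprD scalerBr -mulr2n -(scaler_nat 2 U).
    by rewrite scalerA mulVf ?scale1r// pnatr_eq0.
  rewrite normrZ ger0_norm ?invr_ge0//.
  rewrite ler_pdivrMl// (le_trans (ler_normD _ _))// mulr_natl mulr2n lerD2l//.
have zbound oms D : Ekpi_sym T lam N s tE oms ->
    (forall v, Fkeps_sym T N tF v -> `|v| = 1 -> BBk (oms - W Ubar) v <= D) ->
    `|oms - W Ubar| <= C * D.
  move=> Eoms; apply: (inf_sup_bound BBkl BBkb _ _ C0 hC).
  - move=> a u; apply: (sym_tensor_span_scale E0 bilE).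
      by move=> w; exact: (Ek_E hT hlam hN).
    by move=> w; exact: Ek_scale.
  - by have [v0 [Fv0 v01]] := Fsph; exists v0.
  - apply: sym_tensor_span_add => //; rewrite -scaleN1r.
    apply: (sym_tensor_span_scale E0 bilE) => //.
      by move=> w; exact: (Ek_E hT hlam hN).
    by move=> w; exact: Ek_scale.
have BBkB u u' v : BBk (u - u') v = BBk u v - BBk u' v.
  by rewrite (addrC u) -scaleN1r BBkl mulN1r addrC.
have Fsub v : Fkeps_sym T N tF v -> Fkeps T N tF v by exact: sym_tensor_span_sub.
have tri oms : `|U - Ubar| <= `|U - Q oms| + `|Q (oms - W Ubar)|.
  rewrite (bounded_linearB _ _ Qb) QUk; apply: le_trans (ler_normD _ _).
  by rewrite subrKA.
have Ez oms : Ekpi_sym T lam N s tE oms -> Ekpi T lam N s tE (oms - W Ubar).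
  move=> Eoms; apply: tensor_span_add; first exact: sym_tensor_span_sub.
  rewrite -scaleN1r; apply: (tensor_span_scale E0 bilE).
  - by move=> w; exact: (Ek_E hT hlam hN).
  - by move=> w; exact: Ek_scale.
  - exact: WE.
split=> [sCN|sN].
- rewrite -[leRHS]addr0; apply: quasi => om Eom; rewrite addr0.
  have [oms [Eoms hs]] := symmetrize om Eom.
  apply: le_trans (tri oms) _; apply: le_trans (_ : (1 + C * operator_norm BBk) * `|U - Q oms| <= _).
    rewrite mulrDl mul1r lerD2l -mulrA.
    have Qid := Q_id_CN hT hlam hN hEpi hq hQ sCN.
    rewrite (Qid _ (Ez _ Eoms)); apply: zbound => // v Fv v1.
    rewrite BBkB hUk; last exact: Fsub.
    (* Galerkin orthogonality: with [Delta^k = Delta] the exact solution satisfies the discrete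
       equation. *)
    have -> : ell v = BBk U v by rewrite -BBU /BB /BBk /Dk sCN.
    rewrite -BBkB (le_trans (ler_norm _))// (le_trans (opn _ _))// v1 mulr1.
    by rewrite distrC (Qid oms)//; exact: sym_tensor_span_sub.
  by rewrite ler_wpM2l// ltW.
- set D := dual_norm _ _; apply: quasi => om Eom.
  have k2 : @kappa R s ^+ 2 = 4^-1 by case: (s) sN => //= _; rewrite exprVn; congr (_^-1); ring.
  have [oms [Eoms hs]] := symmetrize om Eom.
  have Qz := Q_norm_Ekpi hT hlam hN hEpi hB hq hQ (Ez _ Eoms); rewrite k2 in Qz.
  have zb : `|oms - W Ubar| <= C * (operator_norm BBk * (4 * `|U - Q oms|) + D).
    apply: zbound => // v Fv v1; have Fv' := Fsub v Fv.
    (* [BBbar U v = BBk (W U) v] is inserted; together with [ell v = BB U v] this leaves the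
       consistency error. *)
    have -> : BBk (oms - W Ubar) v =
        BBk (W (Q oms - U)) v + - (BB U v - BBbar U v).
      rewrite BBkB hUk// BBU BBbarE (bounded_linearB _ _ Wb) WQ BBkB (Wid oms); last first.
        exact: sym_tensor_span_sub.
      by ring.
    rewrite lerD// (le_trans (ler_norm _))//.
      rewrite (le_trans (opn _ _))// v1 mulr1 ler_wpM2l// (le_trans (Wn _))//.
      by rewrite k2 invrK distrC.
    rewrite normrN.
    apply: (dual_norm_bound (g := fun v => BB U v - BBbar U v) _ Fv' v1).
    (* The consistency functional is bounded, so the supremum in [dual_norm] is taken over a bounded
       set. *)
    have [K [K1 KB]] := bilinear_bound hB.1; have [L [L0 LB]] := BBkb.
    have [M [M0 DM]] := bilinear_bound hDelta.1.
    exists ((K * `|U| + rho ^+ 2 * (M * `|U|)) + L * `|W U|) => u.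
    rewrite BBbarE (le_trans (ler_normB _ _))// mulrDl lerD//; last exact: LB.
    rewrite (le_trans (ler_normB _ _))// mulrDl lerD//.
    by rewrite normrM ger0_norm ?sqr_ge0// -(mulrA (rho ^+ 2)) ler_wpM2l ?sqr_ge0.
  apply: le_trans (tri oms) _.
  apply: le_trans (_ : (1 + C * operator_norm BBk) * `|U - Q oms| + 4^-1 * C * D <= _).
    have : `|Q (oms - W Ubar)| <=
        4^-1 * (C * (operator_norm BBk * (4 * `|U - Q oms|) + D)).
      by rewrite (le_trans Qz)// ler_wpM2l// invr_ge0.
    have -> : 4^-1 * (C * (operator_norm BBk * (4 * `|U - Q oms|) + D)) =
      C * operator_norm BBk * `|U - Q oms| + 4^-1 * C * D by field.
    by move=> h; rewrite mulrDl mul1r -addrA lerD2l.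
  by rewrite lerD2r ler_wpM2l// ltW.
Qed.
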